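(* Let the dimension $n\ge2$ be even, $d$ a positive integer, $c>0$, and $$\varphi(x)=(c^{2d}+\|x\|^{2d})\log\left(c^{2d}+\|x\|^{2d}\right),\qquad x\in\mathbb{R}^n.$$ Let $m_0\ge0$ be the smallest nonnegative integer such that $d$ divides $\frac n2+m_0$. There exist coefficients $\mu_\beta$, $\beta\in\mathbb{Z}^n$, such that the quasi-Lagrange function $\Psi(x):=\sum_{\beta\in\mathbb{Z}^n}\mu_\beta\,\varphi(x-\beta)$ has the decay property $$|\Psi(x)|\le C\,(1+\|x\|)^{-2n-2d-2m_0},\qquad x\in\mathbb{R}^n,$$ for some constant $C$, and furthermore the quasi-interpolation operator $$Q f(x):=\sum_{j\in\mathbb{Z}^n}f(jh)\,\Psi\left(\frac{x-jh}{h}\right),\qquad x\in\mathbb{R}^n,\ 0<h<1,$$ reproduces all polynomials of degree $n+2d-1$ and, for every bounded function $f\in C^{n+2d}(\mathbb{R}^n)$ with bounded derivatives, converges uniformly with order, as $h\to0$, $$\|Qf-f\|_\infty=\begin{cases}\mathcal{O}\left(h^{n+2d}\log(1/h)\right), & m_0=0,\\ \mathcal{O}\left(h^{n+2d}\right), & m_0>0.\end{cases}$$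
   Context: $\|\cdot\|$ is the Euclidean norm on $\mathbb{R}^n$. The coefficients $\mu_\beta$ may be finite or infinite in number. ''Reproduces all polynomials of degree $m$'' means $Qp=p$ for every polynomial $p$ on $\mathbb{R}^n$ of total degree at most $m$. The number $h$ is the fill distance (grid spacing). *)

(* Defs.v *)
From HB Require Import structures.
From mathcomp Require Import all_boot all_order all_algebra.
From mathcomp Require Import all_classical all_reals all_analysis.
From mathcomp Require Import -(notations) mpoly.

Set Implicit Arguments.
Unset Strict Implicit.
Unset Printing Implicit Defensive.

Import Order.TTheory GRing.Theory Num.Theory.
Import numFieldNormedType.Exports.

Local Open Scope classical_set_scope.
Local Open Scope ring_scope.

Section EuclideanSpace.
Context {R : realType} {n : nat}.
Implicit Types (x : 'rV[R]_n) (f : 'rV[R]_n -> R).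

(* The library norm on 'rV[R]_n is the maximum norm, hence this definition. *)
Definition enorm x : R := Num.sqrt (\sum_(i < n) x 0 i ^+ 2).

Definition supnorm f : \bar R := ereal_sup [set `|f x|%:E | x in setT].

(* [pderiv [:: i_1; ...; i_k] f] is the iterated partial derivative
   d/dx_{i_1} ... d/dx_{i_k} f. *)
Definition pderiv (s : seq 'I_n) f : 'rV[R]_n -> R :=
  foldr (fun i g => 'D_(delta_mx 0 i : 'rV[R]_n) g) f s.

(* The derivability clause is needed because 'D_v is a total operator. *)
Definition Cn (k : nat) f : Prop :=
  (forall s i x, (size s < k)%N ->
     derivable (pderiv s f) x (delta_mx 0 i)) /\
  (forall s, (size s <= k)%N -> continuous (pderiv s f)).

(* The case [s = [::]] is the boundedness of [f] itself. *)
Definition bounded_derivatives (k : nat) f : Prop :=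
  forall s, (size s <= k)%N -> bounded_fun (pderiv s f).

Definition peval (p : mpoly.mpoly n R) x : R :=
  mpoly.meval (fun i => x 0 i) p.

(* [mpoly.msize p] is the total degree of [p] plus one, and 0 for [p = 0]. *)
Definition tdeg_le (m : nat) (p : mpoly.mpoly n R) : Prop :=
  (mpoly.msize p <= m.+1)%N.

End EuclideanSpace.

Section LatticeSums.
Context {R : realType} {n : nat}.
Implicit Type a : 'rV[int]_n -> R.

Definition lattice_pt (b : 'rV[int]_n) : 'rV[R]_n := map_mx intr b.

Definition lattice_summable a : Prop := summable setT (EFin \o a).

(* Positive part minus negative part; it is the sum of the (unordered) family
   [a] only when [lattice_summable a] holds. *)
Definition lattice_sum a : R :=
  fine (esum setT (EFin \o a)^\+ - esum setT (EFin \o a)^\-)%E.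

End LatticeSums.

Section QuasiInterpolation.
Context {R : realType} {n : nat}.
Implicit Types (mu : 'rV[int]_n -> R) (f Psi phi : 'rV[R]_n -> R).

Definition rbf (d : nat) (c : R) (x : 'rV[R]_n) : R :=
  (c ^+ (2 * d) + enorm x ^+ (2 * d)) *
  ln (c ^+ (2 * d) + enorm x ^+ (2 * d)).

Definition quasi_lagrange_term mu phi (x : 'rV[R]_n) (b : 'rV[int]_n) : R :=
  mu b * phi (x - lattice_pt b).

Definition quasi_lagrange mu phi (x : 'rV[R]_n) : R :=
  lattice_sum (quasi_lagrange_term mu phi x).

Definition quasi_interp_term Psi (h : R) f (x : 'rV[R]_n)
    (j : 'rV[int]_n) : R :=
  f (h *: lattice_pt j) * Psi (h^-1 *: (x - h *: lattice_pt j)).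

Definition quasi_interp Psi (h : R) f (x : 'rV[R]_n) : R :=
  lattice_sum (quasi_interp_term Psi h f x).

End QuasiInterpolation.

(* Main.v *)
Require Import Defs.
From HB Require Import structures.
From mathcomp Require Import all_boot all_order all_algebra.
From mathcomp Require Import all_classical all_reals all_analysis.
From mathcomp Require Import -(notations) mpoly.
From mathcomp Require Import finmap zify ring lra.

(** Write s for the squared Euclidean norm of x, K = n/2 + d and M = n + 2d = 2K.
    With C = c^(2d), u = C + s^d and w = C / u, the given function is
    phi = u ln u.

    Decay.  At infinity phi is a combination of s^d ln s, ln s and powers of s,
    and the K-th power of the Laplacian kills all of these terms that
    precede the first s^(-j) with j >= n/2, that is j = n/2 + m0.  Hence
    Lap^K phi is O(|x|^-(2n+2d+2m0)).  The computation below is exact: the operator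
    theta = s d/ds preserves the combinations of u ln u, ln u, u and
    polynomials in w, the Laplacian is 4/s times a product of two factors
    theta - a, and the roots d, d, 0, 0, -d, -2d, ... that occur among those of
    Lap^K turn u ln u into w^k times a polynomial in w ([is_pow_tail_base], [is_pow_tail_gain],
    [radial_lap_tail]).  Replacing the Laplacian by a finite difference operator
    D of high order changes the result by a term of arbitrarily fast decay, so
    psi0 = D^K phi, a finite combination of integer shifts of phi, has the
    required decay ([iter_dlap_decays]).  Moreover D lowers the degree of a
    polynomial below its order by two, so D^K kills the polynomials of degree less than M.

    Moments.  For a polynomial q of degree less than M let
    G(x) = sum_j q(x - j) psi0(x - j).  This function is bounded.  A difference of
    high order of G, with any real step, vanishes: that many differences of q phi
    decay so fast that the sum over j may be rearranged, and then the coefficients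
    of D^K meet a polynomial that they kill.  A bounded function whose m-th
    differences vanish for every step is constant ([bounded_step_diff],
    [moment_const]).  So G is a number L(q), linear in q.

    The number L(1) is not zero.  Indeed psi0 is a discrete divergence of a field
    which at infinity is kappa x s^(-n/2) with kappa != 0; its flux through each
    face of a large cube has the sign of kappa, and the total does not tend to 0
    ([diff1_flux], [flux_sum_neq0]).

    Reproduction.  A linear functional on the polynomials of bounded degree is a
    finite combination of evaluations at lattice points ([poly_functional_eval]).
    Applied to L, this makes q -> L(q(. + y)) a finite combination of shifts; it is
    L(1) times the identity up to lower degree, hence invertible by a finite
    Neumann series ([stencil_inverse]).  Applying the inverse to psi0 gives a
    finite combination Psi of shifts of phi with
    sum_j q(x - j) Psi(x - j) = q(0) ([reproducing_kernel]), which is the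
    reproduction of polynomials on every grid.

    Rate.  Subtract from f its Taylor polynomial at x, which Q reproduces.  With
    z = x/h - j the remainder is O(h^M |z|^M), and |z|^M |Psi(z)| is
    O(|z|^(-n-2m0)).  The sum over j converges if m0 > 0; if m0 = 0 the shells
    |z| ~ 2^i with 2^i < 1/h contribute O(1) each, whence the logarithm, and the
    growth of order M - 1 of the remainder controls the outer shells ([sums_le_log],
    [quasi_interp_error]). *)

Set Implicit Arguments.
Unset Strict Implicit.
Unset Printing Implicit Defensive.

Import Order.TTheory GRing.Theory Num.Theory.
Import numFieldNormedType.Exports.

Local Open Scope classical_set_scope.
Local Open Scope ring_scope.

(** * Unordered sums *)

Section HasSum.
Context {R : realType} {T : choiceType}.
Implicit Types (a b : T -> R) (l C : R) (A B : {fset T}).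

(** Convergence along the directed set of finite subsets: in this form linearity and
    reindexing are immediate. *)
Definition has_sum a l : Prop :=
  forall e : R, 0 < e ->
  exists A, forall B, (A `<=` B)%fset -> `|\sum_(j <- B) a j - l| <= e.

Definition sums_le a C : Prop := forall B, \sum_(j <- B) `|a j| <= C.

Lemma has_sum_unique a l1 l2 : has_sum a l1 -> has_sum a l2 -> l1 = l2.
Proof.
move=> h1 h2; apply/eqP; rewrite -subr_eq0 -normr_le0.
apply/ler_addgt0Pr => e e0; rewrite add0r; have e20 : 0 < e / 2 by rewrite divr_gt0.
have [A hA] := h1 _ e20; have [A' hA'] := h2 _ e20.
have := hA _ (fsubsetUl A A'); have := hA' _ (fsubsetUr A A').
set S := \sum_(j <- _) _ => k2 k1.
have -> : l1 - l2 = (S - l2) - (S - l1) by ring.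
by apply: le_trans (ler_normB _ _) _; lra.
Qed.

Lemma has_sumD a b l1 l2 : has_sum a l1 -> has_sum b l2 ->
  has_sum (fun j => a j + b j) (l1 + l2).
Proof.
move=> h1 h2 e e0; have e20 : 0 < e / 2 by rewrite divr_gt0.
have [A hA] := h1 _ e20; have [A' hA'] := h2 _ e20.
exists (A `|` A')%fset => B AB.
have := hA _ (fsubset_trans (fsubsetUl A A') AB).
have := hA' _ (fsubset_trans (fsubsetUr A A') AB) => k2 k1.
rewrite big_split /=.
have -> : forall x y : R, x + y - (l1 + l2) = (x - l1) + (y - l2) by move=> *; ring.
by apply: le_trans (ler_normD _ _) _; lra.
Qed.

Lemma has_sumZ c a l : has_sum a l -> has_sum (fun j => c * a j) (c * l).
Proof.
move=> h e e0; have e20 : 0 < e / (`|c| + 1) by rewrite divr_gt0// ltr_wpDl.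
have [A hA] := h _ e20; exists A => B /hA hB.
rewrite -mulr_sumr -mulrBr normrM (le_trans (ler_wpM2l _ hB))//.
rewrite mulrCA ler_piMr ?(ltW e0)// ler_pdivrMr ?mul1r ?lerDl ?ltr_wpDl//.
Qed.

Lemma has_sum0 : has_sum (fun _ => 0) 0.
Proof. by move=> e e0; exists fset0 => B _; rewrite big1// subr0 normr0 ltW. Qed.

Lemma eq_has_sum a b l : a =1 b -> has_sum a l -> has_sum b l.
Proof. by move=> ab; rewrite (funext ab). Qed.

Lemma has_sum_bigsum (I : Type) (s : seq I) (F : I -> T -> R) (L : I -> R) :
  (forall i, has_sum (F i) (L i)) ->
  has_sum (fun j => \sum_(i <- s) F i j) (\sum_(i <- s) L i).
Proof.
move=> h; elim: s => [|i s ih].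
  by rewrite big_nil; apply: eq_has_sum has_sum0 => j; rewrite big_nil.
rewrite big_cons; apply: eq_has_sum (has_sumD (h i) ih) => j.
by rewrite big_cons.
Qed.

Lemma has_sum_norm_le a l C : has_sum a l -> sums_le a C -> `|l| <= C.
Proof.
move=> h hC; apply/ler_addgt0Pr => e e0; have [A hA] := h _ e0.
have := hA A (fsubset_refl _); have := le_trans (ler_norm_sum _ _ _) (hC A).
set S := \sum_(j <- _) _ => k2 k1.
have -> : l = S - (S - l) by ring.
by apply: le_trans (ler_normB _ _) _; lra.
Qed.

Lemma sums_le_le a b C : (forall j, `|a j| <= b j) ->
  (forall B, \sum_(j <- B) b j <= C) -> sums_le a C.
Proof. by move=> ab bC B; apply: le_trans (bC B); exact: ler_sum. Qed.

Lemma esum_fsetsE (a : T -> R) x :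
  [set \sum_(i \in X) (EFin \o a) i | X in fsets setT]%E x <->
  exists B, x = (\sum_(j <- B) a j)%:E.
Proof.
split=> [[X [finX _] <-]|[B ->]].
  by exists (fset_set X); rewrite fsbig_finite//= sumEFin.
exists [set` B]; first by split.
by rewrite fsbig_finite//= set_fsetK sumEFin.
Qed.

(** For a nonnegative family the supremum of the finite sums is also their limit,
    since finite sums increase with the index set. *)
Lemma nneg_esum a C : (forall j, 0 <= a j) -> sums_le a C ->
  (esum setT (EFin \o a) \is a fin_num) /\
  has_sum a (fine (esum setT (EFin \o a))).
Proof.
move=> a0 aC; set S := esum setT _.
have SC : (S <= C%:E)%E.
  apply: ge_ereal_sup => x /esum_fsetsE [B ->]; rewrite lee_fin.
  by apply: le_trans (aC B); apply: ler_sum => j _; exact: ler_norm.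
have S0 : (0 <= S)%E by apply: esum_ge0 => x _; rewrite lee_fin.
have Sfin : S \is a fin_num.
  by rewrite ge0_fin_numE// (le_lt_trans SC)// ltry.
split=> // e e0.
have /ub_ereal_sup_adherent : ereal_sup [set (\sum_(i \in X) (EFin \o a) i)%E | X in
  fsets setT]
   \is a fin_num by [].
move=> /(_ e e0)[x /esum_fsetsE[A ->]].
rewrite -/(esum setT (EFin \o a)) -/S -(fineK Sfin) -EFinB lte_fin => lA.
exists A => B AB.
have AB' : \sum_(j <- A) a j <= \sum_(j <- B) a j.
  rewrite [leRHS](big_fsetID _ (mem A))/=.
  rewrite (_ : [fset x | x in B & x \in A]%fset = A); last first.
    apply/fsetP => y; rewrite !inE/=; case: (boolP (y \in A)); rewrite ?andbF// andbT.
    by move=> /(fsubsetP AB) ->.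
  by rewrite lerDl; apply: sumr_ge0.
have BS : \sum_(j <- B) a j <= fine S.
  rewrite -lee_fin fineK//; apply: ereal_sup_ubound.
  by apply/esum_fsetsE; exists B.
by rewrite ler_norml; apply/andP; split; lra.
Qed.

End HasSum.

Section HasSumReindex.
Context {R : realType} {T : choiceType}.

Lemma has_sum_bij (a : T -> R) l (g h : T -> T) :
  cancel g h -> cancel h g -> has_sum a l -> has_sum (fun j => a (g j)) l.
Proof.
move=> gK hK ha e /ha[A hA].
exists [fset h x | x in A]%fset => B AB.
rewrite [X in `|X - _|](_ : _ = \sum_(j <- [fset g x | x in B]%fset) a j); last first.
  by rewrite big_imfset//= => x y _ _; exact: can_inj gK _ _.
apply: hA; apply/fsubsetP => x xA.
rewrite -(hK x); apply: in_imfset => /=; apply: (fsubsetP AB).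
exact: in_imfset.
Qed.

Lemma has_sum_finsupp (a : T -> R) (A : {fset T}) :
  (forall j, j \notin A -> a j = 0) -> has_sum a (\sum_(j <- A) a j).
Proof.
move=> a0 e e0; exists A => B AB.
rewrite (big_fsetID _ (mem A) B)/= (_ : [fset x | x in B & x \in A]%fset = A).
  rewrite addrAC subrr add0r big_seq big1 ?normr0 ?ltW// => j.
  by rewrite !inE/= => /andP[_ /a0].
apply/fsetP => x; rewrite !inE/=; case: (boolP (x \in A)); rewrite ?andbF// andbT.
by move=> /(fsubsetP AB) ->.
Qed.

Lemma sums_le_finsupp (a : T -> R) (A : {fset T}) :
  (forall j, j \notin A -> a j = 0) -> sums_le a (\sum_(j <- A) `|a j|).
Proof.
move=> a0 B; rewrite (big_fsetID _ (mem A) B)/=.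
rewrite [X in _ + X]big_seq [X in _ + X]big1 ?addr0; last first.
  by move=> j; rewrite !inE/= => /andP[_ /a0 ->]; rewrite normr0.
rewrite (_ : [fset x | x in B & x \in A] = [fset x | x in A & x \in B])%fset; last first.
  by apply/fsetP => x; rewrite !inE/= andbC.
rewrite [leRHS](big_fsetID _ (mem B))/= lerDl.
by apply: sumr_ge0.
Qed.

End HasSumReindex.

Section LatticeSum.
Context {R : realType} {n : nat}.
Implicit Types a : 'rV[int]_n -> R.

(** The positive and the negative part both have bounded finite sums, so each is summed
    by its supremum and the difference sums the family itself. *)
Lemma lattice_sumP a C : sums_le a C ->
  lattice_summable a /\ has_sum a (lattice_sum a).
Proof.
move=> aC.
have pos : sums_le (fun j => Num.max (a j) 0) C.
  move=> B; apply: le_trans (aC B); apply: ler_sum => j _.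
  by case: (leP (a j) 0) => h; rewrite ?normr0.
have neg : sums_le (fun j => Num.max (- a j) 0) C.
  move=> B; apply: le_trans (aC B); apply: ler_sum => j _.
  by case: (leP (- a j) 0) => h; rewrite ?normr0 ?normrN.
have nrm : sums_le (fun j => `|a j|) C.
  by move=> B; under eq_bigr do rewrite normr_id.
have max_ge0 (y : R) : 0 <= Num.max y 0 by rewrite le_max lexx orbT.
have [f1 h1] := nneg_esum (fun j => max_ge0 (a j)) pos.
have [f2 h2] := nneg_esum (fun j => max_ge0 (- a j)) neg.
have [f3 h3] := nneg_esum (fun j => normr_ge0 (a j)) nrm.
split.
  rewrite /lattice_summable summableE.
  by rewrite (_ : (fun x => _) = EFin \o (fun j => `|a j|)).
rewrite /lattice_sum.
have -> : ((EFin \o a)^\+)%E = EFin \o (fun j => Num.max (a j) 0).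
  by apply/funext => j; rewrite funeposE /= EFin_max.
have -> : ((EFin \o a)^\-)%E = EFin \o (fun j => Num.max (- a j) 0).
  by apply/funext => j; rewrite funenegE /= EFin_max.
rewrite fineB//; have := has_sumD h1 (has_sumZ (-1) h2).
rewrite mulN1r; apply: eq_has_sum => j.
by rewrite mulN1r maxEle; case: (leP (a j) 0) => h; case: (leP (- a j) 0) => h'; lra.
Qed.

Lemma has_sum_lattice_sum a C l : sums_le a C -> has_sum a l ->
  lattice_sum a = l.
Proof. by move=> /lattice_sumP[_ h] /(has_sum_unique h). Qed.

End LatticeSum.

(** * Lattice points in dyadic shells *)

Section LatticeCounting.
Context {R : realType} {n : nat}.
Implicit Types (x : 'rV[R]_n) (j : 'rV[int]_n) (B : {fset 'rV[int]_n}).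

Lemma normr_coord_le m (x : 'rV[R]_m) k : `|x 0 k| <= `|x|.
Proof.
have -> : `|x| = mx_norm x by []; rewrite mx_normrE.
exact: (le_bigmax _ (fun ij => `|x ij.1 ij.2|) (0, k)).
Qed.

Lemma normr_row_le m (x : 'rV[R]_m) (r : R) : 0 <= r ->
  (forall k, `|x 0 k| <= r) -> `|x| <= r.
Proof.
move=> r0 h; have -> : `|x| = mx_norm x by []; rewrite mx_normrE.
by apply: bigmax_le => // -[i k] _ /=; rewrite ord1.
Qed.

(** Subtracting the integer part of x from the coordinates and adding P maps these
    lattice points injectively into the cube of side 2P + 1. *)
Lemma card_lattice_ball x (P : nat) B :
  (forall j, j \in B -> `|x - lattice_pt j| < P%:R) ->
  (#|` B| <= (2 * P).+1 ^ n)%N.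
Proof.
move=> hB.
pose g j : {ffun 'I_n -> 'I_(2 * P).+1} :=
  [ffun k => inord (absz (j 0 k - Num.floor (x 0 k) + P%:Z))].
have bnd j k : j \in B -> 0 <= j 0 k - Num.floor (x 0 k) + P%:Z <= (2 * P)%:Z.
  move=> /hB h; have := le_lt_trans (normr_coord_le _ k) h.
  rewrite !mxE ltr_norml => /andP[h1 h2].
  have /andP[f1 f2] := floor_itv (x 0 k).
  have e1 : Num.floor (x 0 k) - P%:Z < j 0 k + 1.
    by rewrite -(ltr_int R) !rmorphD rmorphN /=; move: f1 f2 h1 h2; lra.
  have e2 : j 0 k < Num.floor (x 0 k) + 1 + P%:Z.
    by rewrite -(ltr_int R) !rmorphD /=; move: f1 f2 h1 h2; rewrite rmorphD/=; lra.
  lia.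
have ginj : {in B &, injective g}.
  move=> j1 j2 j1B j2B /ffunP e; apply/rowP => k.
  have := congr1 (@nat_of_ord _) (e k); rewrite !ffunE.
  have := bnd _ k j1B; have := bnd _ k j2B => /andP[a1 a2] /andP[b1 b2].
  by rewrite !inordK; lia.
rewrite cardfE -(card_in_imset (f := fun b : B => g (val b))); last first.
  by move=> b1 b2 _ _ /ginj h; apply/val_inj/h; exact: valP.
by apply: leq_trans (max_card _) _; rewrite card_ffun !card_ord.
Qed.

Definition dyadic_level (r : R) : nat := trunc_log 2 (Num.truncn (1 + r)).

Lemma dyadic_levelP (r : R) : 0 <= r ->
  2 ^+ dyadic_level r <= 1 + r < 2 ^+ (dyadic_level r).+1.
Proof.
move=> r0; rewrite /dyadic_level.
have h1 : 0 <= 1 + r by lra.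
have /andP[t1 t2] := truncn_itv h1.
set p := Num.truncn _ in t1 t2 *.
have p0 : (0 < p)%N by rewrite /p truncn_gt0 lerDl.
have /andP[l1 l2] : (2 ^ trunc_log 2 p <= p < 2 ^ (trunc_log 2 p).+1)%N.
  exact: trunc_log_bounds.
rewrite -!natrX; apply/andP; split.
  by apply: le_trans t1; rewrite ler_nat.
by apply: lt_le_trans t2 _; rewrite ler_nat.
Qed.

(** The shell of level i lies in a ball of radius 2^(i+1), so it has at most (8 2^i)^n
    points. *)
Lemma sum_dyadic_le x B (I : nat) (F : nat -> R) :
  (forall i, 0 <= F i) ->
  (forall j, j \in B -> (dyadic_level `|x - lattice_pt j|%R < I)%N) ->
  \sum_(j <- B) F (dyadic_level `|x - lattice_pt j|%R) <=
  8 ^+ n * \sum_(i < I) F i * 2 ^+ (i * n).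
Proof.
move=> F0 hI; pose lv j := dyadic_level `|x - lattice_pt j|.
have -> : \sum_(j <- B) F (dyadic_level `|x - lattice_pt j|%R) =
    \sum_(i < I) \sum_(j <- B | lv j == i) F i.
  rewrite (exchange_big_dep xpredT)//= big_seq [RHS]big_seq.
  apply: eq_bigr => j /hI jI.
  by rewrite (big_pred1 (Ordinal jI)) => // i; rewrite eq_sym.
rewrite mulr_sumr; apply: ler_sum => i _.
rewrite big_fset_condE/= big_const_seq count_predT iter_addr_0.
rewrite -[leLHS]mulr_natr [leRHS]mulrCA ler_wpM2l//.
rewrite exprM -exprMn (_ : 8 * 2 ^+ i = (8 * 2 ^ i)%N%:R :> R); last first.
  by rewrite natrM natrX.
rewrite -natrX ler_nat.
apply: leq_trans (card_lattice_ball (x := x) (P := 2 ^ i.+1) _) _.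
  move=> j; rewrite !inE /= => /andP[_ /eqP <-].
  rewrite natrX; have /andP[_ h] := dyadic_levelP (normr_ge0 (x - lattice_pt j)).
  by apply: le_lt_trans h; rewrite lerDr.
case: (posnP n) => [->//|n0]; rewrite leq_exp2r// expnS.
by have := expn_gt0 2 i; lia.
Qed.

Lemma sum_geometric_half (I : nat) : \sum_(i < I) (2^-1 : R) ^+ i <= 2.
Proof.
suff: \sum_(i < I) (2^-1 : R) ^+ i = 2 - 2 * 2^-1 ^+ I.
  by move=> ->; rewrite gerBl mulr_ge0// exprn_ge0// invr_ge0.
elim: I => [|I ih]; first by rewrite big_ord0 expr0; lra.
by rewrite big_ord_recr/= ih exprS; lra.
Qed.

Lemma dyadic_level_bounded x B : exists I : nat,
  forall j, j \in B -> (dyadic_level `|x - lattice_pt j|%R < I)%N.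
Proof.
exists (\max_(j <- B) dyadic_level `|x - lattice_pt j|%R).+1 => j jB.
rewrite ltnS (big_fsetD1 j)//=; exact: leq_maxl.
Qed.

Lemma sums_le_dyadic x (F : nat -> R) C (w : 'rV[int]_n -> R) :
  (forall j, `|w j| <= F (dyadic_level `|x - lattice_pt j|%R)) ->
  (forall i, 0 <= F i) ->
  (forall I, \sum_(i < I) F i * 2 ^+ (i * n) <= C) ->
  sums_le w (8 ^+ n * C).
Proof.
move=> wF F0 FC; apply: (sums_le_le wF) => B.
have [I hI] := dyadic_level_bounded x B.
by apply: le_trans (sum_dyadic_le F0 hI) _; rewrite ler_wpM2l// exprn_ge0.
Qed.

(** The shell of level i contributes O(2^(in) 2^(-i(n+1))), a geometric series. *)
Lemma sums_le_pow x (w : 'rV[int]_n -> R) D : 0 <= D ->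
  (forall j, `|w j| <= D * (1 + `|x - lattice_pt j|) ^- n.+1) ->
  sums_le w (8 ^+ n * (D * 2)).
Proof.
move=> D0 hw; apply: (@sums_le_dyadic x (fun i => D * 2 ^- (i * n.+1))).
- move=> j; apply: le_trans (hw j) _; rewrite ler_wpM2l//.
  have /andP[h _] := dyadic_levelP (normr_ge0 (x - lattice_pt j)).
  rewrite lef_pV2 ?posrE ?exprn_gt0 ?ltr_pwDl// exprM lerXn2r//.
    by rewrite nnegrE exprn_ge0.
  by rewrite nnegrE addr_ge0.
- by move=> i; rewrite mulr_ge0// invr_ge0 exprn_ge0.
- move=> I; apply: le_trans (ler_wpM2l D0 (sum_geometric_half I)).
  rewrite mulr_sumr le_eqVlt; apply/orP; left; apply/eqP; apply: eq_bigr => i _.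
  rewrite -mulrA; congr (_ * _).
  by rewrite mulnS exprD invfM -mulrA mulVf ?expf_neq0// mulr1 exprVn.
Qed.

(** Each of the shells with 2^i <= rho contributes O(1), and there are about ln rho
    of them; the outer ones form a geometric series. *)
Lemma sums_le_log x (w : 'rV[int]_n -> R) D rho : 0 <= D -> 1 <= rho ->
  (forall j, `|w j| <= D * (1 + `|x - lattice_pt j|) ^- n *
      Num.min 1 (rho / (1 + `|x - lattice_pt j|))) ->
  sums_le w (8 ^+ n * (D * (3 + ln rho / ln 2))).
Proof.
move=> D0 rho1 hw; have rho0 : 0 < rho by lra.
pose F i := D * 2 ^- (i * n) * Num.min 1 (rho / 2 ^+ i).
apply: (@sums_le_dyadic x F).
- move=> j; apply: le_trans (hw j) _.
  have /andP[h _] := dyadic_levelP (normr_ge0 (x - lattice_pt j)).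
  have := normr_ge0 (x - lattice_pt j).
  move: (dyadic_level _) h => i; move: `|x - _| => r h r0; rewrite /F.
  have : 0 < (2 ^+ i : R) by rewrite exprn_gt0.
  rewrite exprM; move: (2 ^+ i) h => T h T0.
  apply: ler_pM.
  + by rewrite mulr_ge0// invr_ge0 exprn_ge0// addr_ge0.
  + by rewrite le_min ler01 divr_ge0//; lra.
  + rewrite ler_wpM2l// lef_pV2 ?posrE ?exprn_gt0 ?ltr_pwDl//.
    by rewrite lerXn2r// ?nnegrE; lra.
  + rewrite le_min ge_min lexx/= ge_min; apply/orP; right.
    by rewrite ler_pM2l// lef_pV2 ?posrE; lra.
- move=> i; rewrite !mulr_ge0 ?invr_ge0 ?exprn_ge0//.
  by rewrite le_min ler01 divr_ge0// ?exprn_ge0// ltW.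
- move=> I; have -> : \sum_(i < I) F i * 2 ^+ (i * n) =
      D * \sum_(i < I) Num.min 1 (rho / 2 ^+ i).
    rewrite mulr_sumr; apply: eq_bigr => i _; rewrite /F.
    by field; rewrite expf_neq0.
  rewrite ler_wpM2l//.
  have m0 i : 0 <= Num.min 1 (rho / 2 ^+ i).
    by rewrite le_min ler01 divr_ge0// ?exprn_ge0// ltW.
  have [t [t1 t2]] : exists t, 2 ^+ t <= rho /\ rho < 2 ^+ t.+1.
    have rho1' : 0 <= rho - 1 by rewrite subr_ge0.
    have := dyadic_levelP rho1'; rewrite (addrC 1) subrK => /andP[? ?].
    by exists (dyadic_level (rho - 1)).
  have tln : t%:R <= ln rho / ln 2.
    have l2 : 0 < ln (2 : R) by rewrite ln_gt0// ltr1n.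
    by rewrite ler_pdivlMr// mulr_natl -lnXn// ler_ln// posrE exprn_gt0.
  apply: (@le_trans _ _ (\sum_(i < t.+1 + I) Num.min 1 (rho / 2 ^+ i))).
    rewrite addnC big_split_ord/= lerDl.
    by apply: sumr_ge0 => i _; exact: m0.
  rewrite big_split_ord/= [leRHS](_ : _ = (1 + ln rho / ln 2) + 2); last by ring.
  apply: lerD.
    apply: (@le_trans _ _ (\sum_(i < t.+1) 1)).
      by apply: ler_sum => i _; rewrite ge_min lexx.
    by rewrite sumr_const card_ord -natr1; lra.
  apply: le_trans (sum_geometric_half I); apply: ler_sum => i _.
  rewrite ge_min; apply/orP; right.
  rewrite exprD invfM mulrA exprVn ler_piMl ?invr_ge0 ?exprn_ge0//.
  by rewrite ler_pdivrMr ?exprn_gt0// mul1r ltW.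
Qed.

End LatticeCounting.

(** * Polynomial functions of bounded degree *)

Section PolynomialFunctions.
Context {R : realType} {n : nat}.
Implicit Types (p q f : 'rV[R]_n -> R) (x y a : 'rV[R]_n).

(** Indexing by a strict bound on the degree gives the zero function the index 0, so
    that derivatives and differences lower the index without an exception for constants. *)
Inductive poly_lt : nat -> ('rV[R]_n -> R) -> Prop :=
| poly_lt0 m : poly_lt m (fun _ => 0)
| poly_ltC m c : poly_lt m.+1 (fun _ => c)
| poly_ltX m i p : poly_lt m p -> poly_lt m.+1 (fun y => y 0 i * p y)
| poly_ltD m p q : poly_lt m p -> poly_lt m q -> poly_lt m (fun y => p y + q y).

Lemma eq_poly_lt m p q : p =1 q -> poly_lt m p -> poly_lt m q.
Proof. by move=> pq; rewrite (funext pq). Qed.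

Lemma poly_lt_eq0 p : poly_lt 0 p -> p = fun _ => 0.
Proof.
suff h m : poly_lt m p -> m = 0%N -> p = fun _ => 0 by move=> /h; exact.
elim=> {m p} //.
by move=> m p q _ ihp _ ihq m0; rewrite ihp// ihq//; apply/funext => y; rewrite addr0.
Qed.

Lemma poly_lt_mono m m' p : (m <= m')%N -> poly_lt m p -> poly_lt m' p.
Proof.
move=> + pm; elim: pm m' => {m p}.
- by move=> m m' _; exact: poly_lt0.
- by move=> m c [//|m'] _; exact: poly_ltC.
- by move=> m i p _ ih [//|m'] mm'; apply/poly_ltX/ih.
- by move=> m p q _ ihp _ ihq m' mm'; apply: poly_ltD; [exact: ihp|exact: ihq].
Qed.

Lemma poly_ltZ m c p : poly_lt m p -> poly_lt m (fun y => c * p y).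
Proof.
elim=> {m p} [m|m c'|m i p _ ih|m p q _ ihp _ ihq].
- by apply: eq_poly_lt (poly_lt0 _) => y; rewrite mulr0.
- exact: poly_ltC.
- by apply: eq_poly_lt (poly_ltX i ih) => y; rewrite mulrCA.
- by apply: eq_poly_lt (poly_ltD ihp ihq) => y; rewrite mulrDr.
Qed.

Lemma poly_ltB m p q : poly_lt m p -> poly_lt m q -> poly_lt m (fun y => p y - q y).
Proof.
move=> hp hq; apply: eq_poly_lt (poly_ltD hp (poly_ltZ (-1) hq)) => y.
by rewrite mulN1r.
Qed.

Lemma poly_lt_sum (I : Type) (s : seq I) m (F : I -> 'rV[R]_n -> R) :
  (forall i, poly_lt m (F i)) -> poly_lt m (fun y => \sum_(i <- s) F i y).
Proof.
move=> h; elim: s => [|i s ih].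
  by apply: eq_poly_lt (poly_lt0 _) => y; rewrite big_nil.
by apply: eq_poly_lt (poly_ltD (h i) ih) => y; rewrite big_cons.
Qed.

Lemma poly_ltM k m p q : poly_lt k p -> poly_lt m q ->
  poly_lt (k + m).-1 (fun y => p y * q y).
Proof.
elim=> {k p} [k|k c|k i p hp ih|k p1 p2 _ ih1 _ ih2] hq.
- by apply: eq_poly_lt (poly_lt0 _) => y; rewrite mul0r.
- by apply: (@poly_lt_mono m); [lia|exact: poly_ltZ].
- case: k p hp ih => [|k] p hp ih.
    rewrite (poly_lt_eq0 hp); apply: eq_poly_lt (poly_lt0 _) => y.
    by rewrite mulr0 mul0r.
  by apply: eq_poly_lt (poly_ltX i (ih hq)) => y; rewrite mulrA.
- by apply: eq_poly_lt (poly_ltD (ih1 hq) (ih2 hq)) => y; rewrite mulrDl.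
Qed.

Lemma poly_lt_coord i : poly_lt 2 (fun y => y 0 i).
Proof. by apply: eq_poly_lt (poly_ltX i (poly_ltC 0 1)) => y; rewrite mulr1. Qed.

Lemma poly_lt_affine m p (g : 'rV[R]_n -> 'rV[R]_n) :
  (forall i, poly_lt 2 (fun y => g y 0 i)) -> poly_lt m p ->
  poly_lt m (fun y => p (g y)).
Proof.
move=> hg; elim=> {m p} [m|m c|m i p _ ih|m p1 p2 _ ih1 _ ih2].
- exact: poly_lt0.
- exact: poly_ltC.
- exact: (poly_ltM (hg i) ih).
- exact: poly_ltD.
Qed.

Lemma poly_lt_scale_shift m p (c : R) a : poly_lt m p ->
  poly_lt m (fun y => p (c *: y + a)).
Proof.
apply: poly_lt_affine => i.
apply: eq_poly_lt (poly_ltD (poly_ltZ c (poly_lt_coord i)) (poly_ltC 1 (a 0 i))) => y.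
by rewrite !mxE.
Qed.

Lemma poly_lt_shift m p a : poly_lt m p -> poly_lt m (fun y => p (y + a)).
Proof.
by move=> /(poly_lt_scale_shift 1 a); apply: eq_poly_lt => y; rewrite scale1r.
Qed.

Lemma poly_lt_diff m p a : poly_lt m p -> poly_lt m.-1 (fun y => p (y + a) - p y).
Proof.
elim=> {m p} [m|m c|m i p hp ih|m p1 p2 _ ih1 _ ih2].
- by apply: eq_poly_lt (poly_lt0 _) => y; rewrite subr0.
- by apply: eq_poly_lt (poly_lt0 _) => y; rewrite subrr.
- case: m hp ih => [|m] hp ih /=.
    rewrite (poly_lt_eq0 hp); apply: eq_poly_lt (poly_lt0 _) => y.
    by rewrite !mulr0 subr0.
  apply: eq_poly_lt (poly_ltD (poly_ltX i ih) (poly_ltZ (a 0 i) (poly_lt_shift a hp)))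
    => y /=.
  by rewrite !mxE; ring.
- by apply: eq_poly_lt (poly_ltD ih1 ih2) => y /=; ring.
Qed.

Lemma poly_lt1_const p y : poly_lt 1 p -> p y = p 0.
Proof.
move=> /(poly_lt_diff y)/= /poly_lt_eq0 /(congr1 (fun f => f 0))/eqP.
by rewrite add0r subr_eq0 => /eqP.
Qed.

Lemma poly_lt_bound m p : poly_lt m p ->
  exists2 C : R, 0 <= C & forall y, `|p y| <= C * (1 + `|y|) ^+ m.-1.
Proof.
elim=> {m p} [m|m c|m i p hp [C C0 ih]|m p1 p2 _ [C1 C10 ih1] _ [C2 C20 ih2]].
- by exists 0 => // y; rewrite normr0 mul0r.
- exists `|c| => // y; rewrite ler_peMr// exprn_ege1// lerDl//.
- exists C => // y; rewrite normrM /=; case: m hp ih => [|m] hp ih.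
    by rewrite (poly_lt_eq0 hp) normr0 mulr0 mulr_ge0.
  rewrite exprS mulrCA ler_pM//; apply: le_trans (normr_coord_le _ _) _.
  by rewrite lerDr.
- exists (C1 + C2); first exact: addr_ge0.
  by move=> y; rewrite mulrDl (le_trans (ler_normD _ _))// lerD.
Qed.

Definition basis_vec (i : 'I_n) : 'rV[R]_n := delta_mx 0 i.

(** A discrete form of Euler's identity for homogeneous functions: a unit difference
    agrees with the derivative up to terms of lower degree. *)
Lemma poly_lt_euler m p : poly_lt m.+1 p ->
  poly_lt m (fun y => m%:R * p y -
    \sum_(i < n) y 0 i * (p (y + basis_vec i) - p y)).
Proof.
move em : m.+1 => m1 pm; move: em; elim: pm m => {p m1}.
- move=> m1 m _; apply: eq_poly_lt (poly_lt0 _) => y.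
  by rewrite mulr0 big1 ?subr0// => i _ /=; rewrite ?subr0 ?mulr0.
- move=> m1 c m _; case: m => [|m].
    apply: eq_poly_lt (poly_lt0 _) => y.
    by rewrite mul0r big1 ?subr0// => i _ /=; rewrite ?subrr ?mulr0.
  apply: eq_poly_lt (poly_ltC m (m.+1%:R * c)) => y.
  by rewrite big1 ?subr0// => i _ /=; rewrite ?subrr ?mulr0.
- move=> m1 j p hp ih _ [->]; case: m1 hp ih => [|m] hp ih.
    rewrite (poly_lt_eq0 hp); apply: eq_poly_lt (poly_lt0 _) => y.
    by rewrite mul0r big1 ?subr0// => i _ /=; rewrite ?mulr0 ?subr0 ?mulr0.
  apply: eq_poly_lt (poly_ltB (poly_ltX j (ih _ erefl))
    (poly_lt_mono _ (poly_ltX j (poly_lt_diff (basis_vec j) hp)))) => //.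
  move=> y /=.
  have -> : \sum_(i < n) y 0 i * ((y + basis_vec i) 0 j * p (y + basis_vec i) - y 0 j * p y)
    = y 0 j * (\sum_(i < n) y 0 i * (p (y + basis_vec i) - p y)) +
      y 0 j * p (y + basis_vec j).
    rewrite mulr_sumr [in RHS](bigD1 j)//= [in LHS](bigD1 j)//=.
    rewrite addrAC; congr (_ + _); last first.
      apply: eq_bigr => i ij; rewrite !mxE eqxx /= eq_sym (negbTE ij) mulr0n; ring.
    by rewrite !mxE !eqxx mulr1n; ring.
  by rewrite -natr1; ring.
- move=> m1 p q _ ihp _ ihq m em.
  apply: eq_poly_lt (poly_ltD (ihp _ em) (ihq _ em)) => y.
  rewrite [X in _ = _ - X](eq_bigr (fun i => y 0 i * (p (y + basis_vec i) - p y) +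
    y 0 i * (q (y + basis_vec i) - q y))); last by move=> i _; ring.
  by rewrite big_split /=; ring.
Qed.

End PolynomialFunctions.

(** * Finite combinations of lattice shifts *)

Section FiniteDifferences.
Context {R : realType} {n : nat}.
Implicit Types (p q f : 'rV[R]_n -> R) (x y a : 'rV[R]_n).
Implicit Types (s : seq (R * 'rV[int]_n)).

Definition stencil s f x : R := \sum_(t <- s) t.1 * f (x + lattice_pt t.2).

Lemma lattice_pt0 : lattice_pt (0 : 'rV[int]_n) = 0 :> 'rV[R]_n.
Proof. exact: map_mx0. Qed.
Lemma lattice_ptD (b b' : 'rV[int]_n) :
  lattice_pt (b + b') = lattice_pt b + lattice_pt b' :> 'rV[R]_n.
Proof. exact: map_mxD. Qed.
Lemma lattice_ptN (b : 'rV[int]_n) : lattice_pt (- b) = - lattice_pt b :> 'rV[R]_n.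
Proof. exact: map_mxN. Qed.
Lemma lattice_ptB (b b' : 'rV[int]_n) :
  lattice_pt (b - b') = lattice_pt b - lattice_pt b' :> 'rV[R]_n.
Proof. exact: map_mxB. Qed.

(** The shifts and weights are hidden, so that sums and compositions of such operators
    need no bookkeeping. *)
Definition is_stencil (A : ('rV[R]_n -> R) -> 'rV[R]_n -> R) : Prop :=
  exists s, forall f x, A f x = stencil s f x.

Lemma is_stencil_shift (b : 'rV[int]_n) :
  is_stencil (fun f x => f (x + lattice_pt b)).
Proof. by exists [:: (1, b)] => f x; rewrite /stencil big_seq1 mul1r. Qed.

Lemma is_stencil_id : is_stencil (fun f => f).
Proof.
have [s hs] := is_stencil_shift 0; exists s => f x.
by rewrite -hs lattice_pt0 addr0.
Qed.

Lemma is_stencil0 : is_stencil (fun _ _ => 0).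
Proof. by exists [::] => f x; rewrite /stencil big_nil. Qed.

Lemma is_stencilD A B : is_stencil A -> is_stencil B ->
  is_stencil (fun f x => A f x + B f x).
Proof.
move=> [s hs] [s' hs']; exists (s ++ s') => f x.
by rewrite /stencil big_cat /= hs hs'.
Qed.

Lemma is_stencilZ c A : is_stencil A -> is_stencil (fun f x => c * A f x).
Proof.
move=> [s hs]; exists [seq (c * t.1, t.2) | t <- s] => f x.
rewrite /stencil big_map hs mulr_sumr.
by apply: eq_bigr => t _; rewrite mulrA.
Qed.

Lemma is_stencil_sum (I : Type) (r : seq I) (F : I -> _) :
  (forall i, is_stencil (F i)) ->
  is_stencil (fun f x => \sum_(i <- r) F i f x).
Proof.
move=> h; elim: r => [|i r ih].
  have [s hs] := is_stencil0; exists s => f x; by rewrite big_nil -(hs f x).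
have [s hs] := is_stencilD (h i) ih; exists s => f x.
by rewrite big_cons hs.
Qed.

Lemma is_stencil_comp A B : is_stencil A -> is_stencil B ->
  is_stencil (fun f => A (B f)).
Proof.
move=> [s hs] hB.
suff [s' hs'] : is_stencil (fun f x => \sum_(t <- s) t.1 * B f (x + lattice_pt t.2)).
  by exists s' => f x; rewrite -hs' hs.
apply: is_stencil_sum => -[c b]; apply: is_stencilZ.
have [s' hs'] := hB; exists [seq (t.1, b + t.2) | t <- s'] => f x /=.
rewrite hs' /stencil big_map; apply: eq_bigr => t _ /=.
by rewrite lattice_ptD addrA.
Qed.

Lemma is_stencil_iter k A : is_stencil A -> is_stencil (iter k A).
Proof.
move=> hA; elim: k => [|k ih]; first exact: is_stencil_id.
exact: (is_stencil_comp hA ih).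
Qed.

Lemma is_stencil_linear A : is_stencil A -> forall c f g,
  A (fun x => c * f x + g x) = fun x => c * A f x + A g x.
Proof.
move=> [s hs] c f g; apply/funext => x; rewrite !hs /stencil mulr_sumr -big_split.
by apply: eq_bigr => t _ /=; ring.
Qed.

Lemma is_stencil_comm_shift A (a : 'rV[R]_n) : is_stencil A -> forall f x,
  A (fun y => f (y + a)) x = A f (x + a).
Proof.
move=> [s hs] f x; rewrite !hs; apply: eq_bigr => t _.
by rewrite addrAC.
Qed.

Definition is_eval (L : ('rV[R]_n -> R) -> R) : Prop :=
  exists s, forall f, L f = stencil s f 0.

Lemma is_eval_stencil A (L : ('rV[R]_n -> R) -> R) : is_stencil A -> is_eval L ->
  is_eval (fun f => L (A f)).
Proof.
move=> hA [s hs].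
have hs' : is_stencil (stencil s) by exists s.
have [s'' e] := is_stencil_comp hs' hA; exists s'' => f.
by rewrite hs -e.
Qed.

Lemma is_evalD L1 L2 : is_eval L1 -> is_eval L2 -> is_eval (fun f => L1 f + L2 f).
Proof.
move=> [s hs] [s' hs']; exists (s ++ s') => f.
by rewrite /stencil big_cat /= hs hs'.
Qed.

Lemma is_evalZ c L : is_eval L -> is_eval (fun f => c * L f).
Proof.
move=> [s hs]; exists [seq (c * t.1, t.2) | t <- s] => f.
rewrite /stencil big_map hs mulr_sumr.
by apply: eq_bigr => t _; rewrite mulrA.
Qed.

Lemma is_eval_sum (I : Type) (r : seq I) (F : I -> _) :
  (forall i, is_eval (F i)) -> is_eval (fun f => \sum_(i <- r) F i f).
Proof.
move=> h; elim: r => [|i r ih].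
  by exists [::] => f; rewrite /stencil !big_nil.
have [s hs] := is_evalD (h i) ih; exists s => f.
by rewrite big_cons hs.
Qed.

Lemma is_evalX i L : is_eval L -> is_eval (fun f => L (fun y => y 0 i * f y)).
Proof.
move=> [s hs]; exists [seq (t.1 * (lattice_pt t.2) 0 i, t.2) | t <- s] => f.
rewrite /stencil big_map hs; apply: eq_bigr => t _ /=.
by rewrite add0r mulrA.
Qed.

Lemma lattice_pt_delta i : lattice_pt (delta_mx 0 i) = basis_vec i :> 'rV[R]_n.
Proof. by apply/rowP => k; rewrite !mxE; case: (_ && _). Qed.

Lemma is_stencil_diff i : is_stencil (fun f x => f (x + basis_vec i) - f x).
Proof.
have [s hs] := is_stencilD (is_stencil_shift (delta_mx 0 i)) (is_stencilZ (-1)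
  is_stencil_id).
by exists s => f x; rewrite -hs mulN1r lattice_pt_delta.
Qed.

(** By the discrete Euler identity, m q is the sum of the y_i times differences of q, up to
    lower degree.  The functionals p -> L(y_i p) act on these differences and L itself on
    the remainder; all of them are combinations of evaluations by induction. *)
Lemma poly_functional_eval m (L : ('rV[R]_n -> R) -> R) :
  (forall c p q, poly_lt m p -> poly_lt m q ->
     L (fun y => c * p y + q y) = c * L p + L q) ->
  exists2 L', is_eval L' & forall q, poly_lt m q -> L q = L' q.
Proof.
elim: m L => [|m ih] L lin.
  exists (fun _ => 0); first by exists [::] => f; rewrite /stencil big_nil.
  move=> q /poly_lt_eq0 ->.
  have := lin (-1) _ _ (poly_lt0 0) (poly_lt0 0).
  rewrite [RHS](_ : _ = 0) => [e|]; last by ring.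
  rewrite -[RHS]e.
  by congr L; apply/funext => y; rewrite mulr0 addr0.
have L0 : L (fun _ => 0) = 0.
  have := lin (-1) _ _ (poly_lt0 m.+1) (poly_lt0 m.+1).
  rewrite [RHS](_ : _ = 0) => [e|]; last by ring.
  rewrite -[RHS]e.
  by congr L; apply/funext => y; rewrite mulr0 addr0.
have LZ c p : poly_lt m.+1 p -> L (fun y => c * p y) = c * L p.
  move=> hp; rewrite -[RHS]addr0 -L0 -lin//; last exact: poly_lt0.
  by congr L; apply/funext => y; rewrite addr0.
have LD p q : poly_lt m.+1 p -> poly_lt m.+1 q -> L (fun y => p y + q y) = L p + L q.
  move=> hp hq; rewrite -[L p]mul1r -lin//.
  by congr L; apply/funext => y; rewrite mul1r.
case: m ih lin L0 LZ LD => [|m] ih lin L0 LZ LD.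
  exists (fun f => L (fun _ => 1) * f 0).
    by apply: is_evalZ; exists [:: (1, 0)] => f; rewrite /stencil big_seq1 mul1r
      lattice_pt0 addr0.
  move=> q hq; rewrite mulrC -LZ; last exact: poly_ltC.
  by congr L; apply/funext => y; rewrite mulr1 (poly_lt1_const y hq).
have hX i : exists2 L', is_eval L' &
    forall q, poly_lt m.+1 q -> L (fun y => y 0 i * q y) = L' q.
  apply: (ih (fun f => L (fun y => y 0 i * f y))) => c p q hp hq.
  rewrite -lin; [|exact: poly_ltX|exact: poly_ltX].
  by congr L; apply/funext => y; ring.
have [L1 hL1 eL1] := fin_all_exists2 hX.
have [L2 hL2 eL2] : exists2 L', is_eval L' & forall q, poly_lt m.+1 q -> L q = L' q.
  by apply: ih => c p q hp hq; apply: lin; apply: (@poly_lt_mono _ _ m.+1).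
pose dif i f : 'rV[R]_n -> R := fun x => f (x + basis_vec i) - f x.
pose E f : 'rV[R]_n -> R := fun y => \sum_(i < n) y 0 i * dif i f y.
exists (fun f => m.+1%:R^-1 * (\sum_(i < n) L1 i (dif i f) +
   (m.+1%:R * L2 f + -1 * \sum_(i < n) L2 (fun y => y 0 i * dif i f y)))).
  apply/is_evalZ/is_evalD; first by apply: is_eval_sum => i;
    apply: is_eval_stencil => //; exact: is_stencil_diff.
  apply/is_evalD; first exact: is_evalZ.
  apply/is_evalZ; apply: is_eval_sum => i.
  apply: (is_eval_stencil (A := dif i) (L := fun g => L2 (fun y => y 0 i * g y))).
    exact: is_stencil_diff.
  exact: is_evalX.
move=> q hq.
have hd i : poly_lt m.+1 (dif i q) by exact: (poly_lt_diff (basis_vec i) hq).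
have hE : poly_lt m.+2 (E q).
  by apply: poly_lt_sum => i; exact: poly_ltX.
have he := poly_lt_euler hq.
have LE : L (E q) = \sum_(i < n) L1 i (dif i q).
  have : forall r : seq 'I_n, L (fun y => \sum_(i <- r) y 0 i * dif i q y) = \sum_(i <-
    r) L1 i (dif i q).
    elim=> [|i r ihr]; first by rewrite big_nil -[RHS]L0; congr L; apply/funext => y;
      rewrite big_nil.
    rewrite big_cons -ihr -(eL1 i) // -LD.
    - by congr L; apply/funext => y; rewrite big_cons.
    - exact: poly_ltX.
    - by apply: poly_lt_sum => k; exact: poly_ltX.
  exact.
have L2E f : L2 (fun y => m.+1%:R * q y - E q y) =
    m.+1%:R * L2 q + -1 * \sum_(i < n) L2 (fun y => y 0 i * dif i q y).
  have [s hs] := hL2; rewrite !hs /stencil.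
  rewrite (eq_bigr (fun i => stencil s (fun y => y 0 i * dif i q y) 0));
    last by move=> i _; rewrite hs.
  rewrite /stencil exchange_big /= mulN1r mulr_sumr -sumrB; apply: eq_bigr => t _.
  by rewrite mulrBr mulr_sumr mulrCA.
rewrite -LE -L2E//.
rewrite -eL2// -LD//; last exact: (poly_lt_mono (leqnSn _) he).
rewrite -LZ; last first.
  apply: poly_ltD => //; exact: (poly_lt_mono (leqnSn _) he).
congr L; apply/funext => y; rewrite addrC subrK mulKf//.
Qed.

End FiniteDifferences.

(** * Derivatives on the real line *)

Section RealDerivatives.
Context {R : realType}.
Implicit Types (f g : R -> R) (t l : R).

(** [is_derive] in direction 1 and for functions written pointwise, so that the rules
    below compose by unification. *)
Definition has_deriv f t l : Prop := is_derive t (1 : R) f l.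

Lemma has_deriv_eq f t l l' : has_deriv f t l -> l = l' -> has_deriv f t l'.
Proof. by move=> h <-. Qed.

Lemma has_deriv_cst c t : has_deriv (fun _ => c) t 0.
Proof. exact: is_derive_cst. Qed.

Lemma has_deriv_id t : has_deriv (fun x => x) t 1.
Proof. exact: is_derive_id. Qed.

Lemma has_derivD f g t l m : has_deriv f t l -> has_deriv g t m ->
  has_deriv (fun x => f x + g x) t (l + m).
Proof. by move=> hf hg; exact: is_deriveD. Qed.

Lemma has_derivM f g t l m : has_deriv f t l -> has_deriv g t m ->
  has_deriv (fun x => f x * g x) t (l * g t + f t * m).
Proof.
move=> hf hg; apply: (has_deriv_eq (is_deriveM hf hg)).
by rewrite addrC mulrC.
Qed.

Lemma has_derivZ c f t l : has_deriv f t l -> has_deriv (fun x => c * f x) t (c * l).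
Proof.
move=> hf; apply: (has_deriv_eq (has_derivM (has_deriv_cst c t) hf)).
by rewrite mul0r add0r.
Qed.

Lemma has_derivX f n t l : has_deriv f t l ->
  has_deriv (fun x => f x ^+ n) t (n%:R * f t ^+ n.-1 * l).
Proof.
move=> hf; rewrite /has_deriv (_ : (fun x => _) = f ^+ n); last first.
  by apply/funext => x; rewrite exprfctE.
exact: (is_deriveX n hf).
Qed.

Lemma has_derivV f t l : f t != 0 -> has_deriv f t l ->
  has_deriv (fun x => (f x)^-1) t (- (f t) ^- 2 * l).
Proof. by move=> f0 hf; exact: (is_deriveV f0 hf). Qed.

Lemma has_deriv_comp f g t l m : has_deriv f (g t) l -> has_deriv g t m ->
  has_deriv (fun x => f (g x)) t (l * m).
Proof. by move=> hf hg; exact: (is_derive1_comp hf hg). Qed.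

Lemma has_deriv_ln t : 0 < t -> has_deriv (@ln R) t t^-1.
Proof. exact: is_derive1_ln. Qed.

Lemma has_deriv_horner (p : {poly R}) t : has_deriv (horner p) t p^`().[t].
Proof. exact: is_derive_poly. Qed.

End RealDerivatives.

(** * Radial functions and the Euler operator *)

Section RadialCalculus.
Context {R : realType} (d : nat) (C : R).
Hypotheses (d_gt0 : (0 < d)%N) (C_gt0 : 0 < C).

(** The coefficients of u ln u, ln u, u and a polynomial in w, where u = C + s^d and
    w = C / u.  The span of these functions is stable under theta = s d/ds. *)
Record radial := Radial {
  rad_ulog : R; rad_log : R; rad_u : R; rad_poly : {poly R} }.

Definition radial_u (s : R) : R := C + s ^+ d.

Definition radial_eval (v : radial) (s : R) : R :=
  rad_ulog v * radial_u s * ln (radial_u s) + rad_log v * ln (radial_u s)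
  + rad_u v * radial_u s + (rad_poly v).[C / radial_u s].

(** The operator theta - a on coefficients.  It encodes theta u = d (u - C),
    theta (ln u) = d (1 - w) and theta w = d (w^2 - w). *)
Definition euler_sub (a : R) (v : radial) : radial :=
  let d' := d%:R in
  Radial (d' * rad_ulog v - a * rad_ulog v)
    (- (d' * C) * rad_ulog v - a * rad_log v)
    (d' * rad_ulog v + d' * rad_u v - a * rad_u v)
    ((d'%:P * 'X^2 - d'%:P * 'X) * (rad_poly v)^`() - a%:P * rad_poly v
     + (- (d' * C) * rad_ulog v - d' * C * rad_u v)%:P
     + (d' * rad_log v)%:P * (1 - 'X)).

Lemma radial_u_gt0 s : 0 <= s -> 0 < radial_u s.
Proof. by move=> s0; rewrite ltr_wpDr// exprn_ge0. Qed.

Lemma euler_sub_eval a v s :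
  radial_eval (euler_sub a v) s = radial_eval (euler_sub 0 v) s - a * radial_eval v s.
Proof.
rewrite /radial_eval /euler_sub /= !(hornerD, hornerN, hornerM, hornerC, hornerX, hornerXn).
by ring.
Qed.

Lemma radial_eval_deriv v s : 0 < s ->
  has_deriv (radial_eval v) s (radial_eval (euler_sub 0 v) s / s).
Proof.
move=> s0; have u0 := radial_u_gt0 (ltW s0); have un0 := lt0r_neq0 u0.
have sn0 := lt0r_neq0 s0.
have hu : has_deriv radial_u s (d%:R * s ^+ d / s).
  apply: (has_deriv_eq (has_derivD (has_deriv_cst C s) (has_derivX d (has_deriv_id s)))).
  case: d d_gt0 => // d' _ /=; rewrite add0r mulr1 exprS; field; exact: sn0.
have hl := has_deriv_comp (has_deriv_ln u0) hu.
have hw := has_derivZ C (has_derivV un0 hu).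
have hp := has_deriv_comp (has_deriv_horner (rad_poly v) _) hw.
have := has_derivD (has_derivD (has_derivD
  (has_derivM (has_derivZ (rad_ulog v) hu) hl) (has_derivZ (rad_log v) hl))
  (has_derivZ (rad_u v) hu)) hp.
move=> h; apply: (has_deriv_eq h); rewrite /radial_eval /euler_sub /= !(hornerD,
  hornerN, hornerM, hornerC, hornerX, hornerXn).
have -> : s ^+ d = radial_u s - C by rewrite /radial_u; ring.
move: (radial_u s) u0 un0 => u u0 un0.
field; by rewrite un0 sn0.
Qed.

Definition radial_pow k v (s : R) : R := s ^- k * radial_eval v s.

(** Since theta (s^-k F) = s^-k (theta - k) F, a derivative in s multiplies by 1/s and
    applies theta - k to the radial part. *)
Lemma radial_pow_deriv k v s : 0 < s ->
  has_deriv (radial_pow k v) s (radial_pow k.+1 (euler_sub k%:R v) s).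
Proof.
move=> s0; have sn0 := lt0r_neq0 s0; have skn0 : s ^+ k != 0 by rewrite expf_neq0.
have := has_derivM (@has_derivV _ (fun x => x ^+ k) s _ skn0 (has_derivX k (has_deriv_id
  s))) (radial_eval_deriv v s0).
move=> h; apply: (has_deriv_eq h); rewrite /radial_pow [in RHS]euler_sub_eval.
move: (radial_eval _ _) (radial_eval _ _) => A B.
clear h; case: k skn0 => [|k] skn0.
  by rewrite !(mul0r, mulr0, add0r, subr0, expr0, expr1, invr1, mul1r, oppr0) mulrC.
rewrite /= !exprS; have := skn0; rewrite expf_eq0 /= => _.
by field; rewrite sn0 expf_neq0.
Qed.

Lemma eq_radial v v' : rad_ulog v = rad_ulog v' -> rad_log v = rad_log v' ->
  rad_u v = rad_u v' -> rad_poly v = rad_poly v' -> v = v'.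
Proof. by case: v v' => ???? [????] /= -> -> -> ->. Qed.

Lemma euler_subC a b v : euler_sub a (euler_sub b v) = euler_sub b (euler_sub a v).
Proof.
apply: eq_radial => /=; [ring|ring|ring|].
rewrite !(derivD, derivN, derivM, derivC, derivX, derivXn) /= expr1.
rewrite !(polyCD, polyCN, polyCM); ring.
Qed.

Definition euler_subs (l : seq R) (v : radial) : radial := foldr euler_sub v l.

Lemma euler_subs_cat l l' v : euler_subs (l ++ l') v = euler_subs l (euler_subs l' v).
Proof. exact: foldr_cat. Qed.

Lemma euler_subs_subC l a v : euler_subs l (euler_sub a v) = euler_sub a (euler_subs l v).
Proof. by elim: l => //= b l ->; rewrite euler_subC. Qed.

(** The factors theta - a commute, so only the multiset of roots counts. *)
Lemma euler_subs_perm l l' v : perm_eq l l' -> euler_subs l v = euler_subs l' v.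
Proof.
elim: l l' => [|a l ih] l' ll'.
  by move: ll'; rewrite perm_sym => /perm_nilP ->.
have al' : a \in l' by rewrite -(perm_mem ll') mem_head.
have [l1 [l2 e]] : exists l1 l2, l' = l1 ++ a :: l2.
  by case/splitPr: al' => l1 l2; exists l1, l2.
move: ll'; rewrite e perm_sym perm_catC /= perm_cons perm_catC perm_sym => /ih /= ->.
by rewrite !euler_subs_cat /= -euler_subs_subC.
Qed.

Lemma perm_extract (T : eqType) (l l0 : seq T) : uniq l -> uniq l0 ->
  {subset l0 <= l} -> perm_eq l ([seq x <- l | x \notin l0] ++ l0).
Proof.
move=> ul ul0 sub; apply: uniq_perm => //.
  rewrite cat_uniq filter_uniq//= ul0 andbT; apply/hasPn => x xl0.
  by rewrite mem_filter xl0.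
move=> x; rewrite mem_cat mem_filter; case: (boolP (x \in l0)) => [/sub ->//|_].
by rewrite orbF.
Qed.

Definition radial_phi : radial := Radial 1 0 0 0.

(** A multiple of w^k, hence O(s^(-dk)) at infinity. *)
Definition is_pow_tail k v := exists q, v = Radial 0 0 0 ('X^k * q).

Lemma is_pow_tail_sub k a v : is_pow_tail k v -> is_pow_tail k (euler_sub a v).
Proof.
move=> [q ->]; case: k => [|k].
  exists (((d%:R)%:P * 'X^2 - (d%:R)%:P * 'X) * q^`() - a%:P * q).
  by apply: eq_radial => /=; rewrite ?mulr0 ?subr0 ?addr0 ?mul0r ?addr0 ?expr0 ?mul1r
    ?polyC0 ?addr0.
exists ((d%:R)%:P * k.+1%:R%:P * 'X * q - (d%:R)%:P * k.+1%:R%:P * q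
   + ((d%:R)%:P * 'X^2 - (d%:R)%:P * 'X) * q^`() - a%:P * q).
apply: eq_radial => /=; rewrite ?mulr0 ?subr0 ?addr0 ?mul0r ?addr0 ?polyC0 ?addr0//.
rewrite derivM derivXn /= !polyC_natr !exprS; ring.
Qed.

Lemma is_pow_tail_subs k l v : is_pow_tail k v -> is_pow_tail k (euler_subs l v).
Proof. by move=> h; elim: l => //= a l; exact: is_pow_tail_sub. Qed.

(** From theta w^k = -dk w^k + dk w^(k+1), the factor theta + dk removes the leading
    term. *)
Lemma is_pow_tail_gain k v : is_pow_tail k v ->
  is_pow_tail k.+1 (euler_sub (- (d * k)%:R) v).
Proof.
move=> [q ->]; case: k => [|k].
  exists (((d%:R)%:P * 'X - (d%:R)%:P) * q^`()).
  apply: eq_radial => /=; rewrite ?muln0 ?mulr0 ?oppr0 ?mul0r ?subr0 ?addr0 ?mul0r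
    ?addr0 ?polyC0 ?mul0r ?subr0 ?addr0//.
  by rewrite expr0 mul1r expr1; ring.
exists ((d%:R)%:P * k.+1%:R%:P * q + ((d%:R)%:P * 'X - (d%:R)%:P) * q^`()).
apply: eq_radial => /=; rewrite ?mulr0 ?subr0 ?addr0 ?mul0r ?addr0 ?polyC0 ?addr0//.
rewrite derivM derivXn /= !polyCN !polyC_natr natrM !exprS; ring.
Qed.

Lemma is_pow_tail_gains k : is_pow_tail 1 (euler_subs [:: 0; 0; d%:R; d%:R] radial_phi) ->
  is_pow_tail k.+1 (euler_subs ([seq - (d * j.+1)%:R | j <- rev (iota 0 k)] ++ [:: 0; 0;
    d%:R; d%:R]) radial_phi).
Proof.
move=> h; elim: k => [//|k ih].
by rewrite -[in iota _ _]addn1 iotaD rev_cat /= add0n; exact: is_pow_tail_gain.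
Qed.

(** One factor theta - d removes u ln u, a second one removes u, theta removes ln u, and
    a last theta removes the constant term. *)
Lemma is_pow_tail_base : is_pow_tail 1 (euler_subs [:: 0; 0; d%:R; d%:R] radial_phi).
Proof.
have [v [ev1 ev2]] : exists v, euler_subs [:: 0; d%:R; d%:R] radial_phi = v /\
  is_pow_tail 0 v.
  eexists; split; first reflexivity.
  eexists; apply: eq_radial => /=; last by rewrite expr0 mul1r.
  - ring.
  - ring.
  - ring.
by rewrite /= -[X in euler_sub 0 X]/(euler_subs [:: 0; d%:R; d%:R] radial_phi) ev1;
  have := is_pow_tail_gain ev2; rewrite muln0 oppr0.
Qed.

End RadialCalculus.

(** * Growth of the radial functions *)

Section RadialBounds.
Context {R : realType} (d : nat) (C : R).
Hypotheses (d_gt0 : (0 < d)%N) (C_gt0 : 0 < C).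
Local Notation u := (radial_u d C).

Lemma radial_u_le s : 1 <= s -> u s <= (C + 1) * s ^+ d.
Proof.
move=> s1; rewrite /radial_u mulrDl mul1r lerD2r ler_peMr ?(ltW C_gt0)//.
exact: exprn_ege1.
Qed.

Lemma radial_w_itv s : 0 <= s -> 0 <= C / u s <= 1.
Proof.
move=> s0; have u0 := radial_u_gt0 d C_gt0 s0.
apply/andP; split; first by apply: divr_ge0; exact: ltW.
by rewrite ler_pdivrMr// mul1r /radial_u lerDl exprn_ge0.
Qed.

Lemma poly_bound01 (p : {poly R}) :
  exists2 B, 0 <= B & forall w, 0 <= w <= 1 -> `|p.[w]| <= B.
Proof.
elim/poly_ind: p => [|p c [B B0 ih]].
  by exists 0 => // w _; rewrite horner0 normr0.
exists (B + `|c|); first by rewrite addr_ge0.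
move=> w /[dup] /ih hw /andP[w0 w1].
rewrite hornerMXaddC (le_trans (ler_normD _ _))// lerD2r normrM.
by rewrite (ger0_norm w0) -[leRHS]mulr1 ler_pM.
Qed.

Lemma radial_eval_bound_nolog v : rad_ulog v = 0 -> rad_log v = 0 ->
  exists2 B, 0 <= B & forall s, 1 <= s -> `|radial_eval d C v s| <= B * s ^+ d.
Proof.
move=> v1 v2; have [B B0 hB] := poly_bound01 (rad_poly v).
exists (`|rad_u v| * (C + 1) + B).
  by rewrite addr_ge0 ?mulr_ge0 ?addr_ge0// ltW.
move=> s s1; have s0 : 0 <= s by lra.
rewrite /radial_eval v1 v2 !mul0r !add0r mulrDl (le_trans (ler_normD _ _))// lerD//.
  rewrite normrM -mulrA ler_wpM2l// ger0_norm ?radial_u_le//.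
  exact/ltW/radial_u_gt0.
apply: le_trans (hB _ (radial_w_itv s0)) _.
by rewrite ler_peMr// exprn_ege1.
Qed.

(** The exponent 2d is a crude substitute for s^d ln s; the loss is made up for by taking
    more derivatives. *)
Lemma radial_eval_bound v :
  exists2 B, 0 <= B & forall s, 1 <= s -> `|radial_eval d C v s| <= B * s ^+ (2 * d).
Proof.
pose v' := Radial 0 0 (rad_u v) (rad_poly v).
have [B B0 hB] := @radial_eval_bound_nolog v' erefl erefl.
pose D := `|ln C| + (C + 1).
have D0 : 0 <= D by rewrite !addr_ge0// ltW.
exists (`|rad_ulog v| * (C + 1) * D + `|rad_log v| * D + B).
  by rewrite !addr_ge0 ?mulr_ge0 ?addr_ge0// ltW.
move=> s s1; have s0 : 0 <= s by lra.
have sd1 : 1 <= s ^+ d by exact: exprn_ege1.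
have u0 := radial_u_gt0 d C_gt0 s0.
have ub := radial_u_le s1.
have lnb : `|ln (u s)| <= D * s ^+ d.
  have l1 : ln C <= ln (u s) by rewrite ler_ln ?posrE// lerDl exprn_ge0.
  have l2 : ln (u s) <= u s.
    by have := ln_sublinear u0; exact: ltW.
  have l3 := ler_norm (ln C); have l4 := ler_norm (- ln C); rewrite normrN in l4.
  have l5 : `|ln C| <= `|ln C| * s ^+ d by rewrite ler_peMr.
  have p1 : 0 <= (C + 1) * s ^+ d by rewrite mulr_ge0 ?addr_ge0 ?exprn_ge0// ltW.
  have p2 : 0 <= `|ln C| * s ^+ d by rewrite mulr_ge0// exprn_ge0.
  rewrite (_ : D * s ^+ d = `|ln C| * s ^+ d + (C + 1) * s ^+ d); last first.
    by rewrite /D mulrDl.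
  move: (`|ln C| * _) ((C + 1) * _) (ln (u s)) p1 p2 l1 l2 l3 l4 l5 ub => a b l p1 p2 l1
    l2 l3 l4 l5 ub.
  rewrite ler_norml; apply/andP; split; lra.
have -> : radial_eval d C v s = rad_ulog v * u s * ln (u s) + rad_log v * ln (u s)
    + radial_eval d C v' s by rewrite /radial_eval /= !mul0r !add0r addrA.
have sd2 : s ^+ d <= s ^+ (2 * d).
  by rewrite mul2n -addnn exprD ler_peMr// exprn_ge0.
apply: le_trans (ler_normD _ _) _; rewrite mulrDl lerD//; last first.
  by apply: le_trans (hB _ s1) _; rewrite ler_wpM2l.
apply: le_trans (ler_normD _ _) _; rewrite mulrDl lerD//.
  rewrite !normrM mul2n -addnn exprD.
  rewrite [leRHS](_ : _ = (`|rad_ulog v| * ((C + 1) * s ^+ d)) * (D * s ^+ d));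
    last by ring.
  rewrite ler_pM ?mulr_ge0// ler_wpM2l// ger0_norm//; exact: ltW.
rewrite normrM -mulrA ler_wpM2l// (le_trans lnb)// ler_wpM2l//.
Qed.

Lemma radial_eval_bound_tail k v : is_pow_tail k v ->
  exists2 B, 0 <= B & forall s, 1 <= s -> `|radial_eval d C v s| <= B * s ^- (d * k).
Proof.
move=> [q ->]; have [B B0 hB] := poly_bound01 q.
exists (B * C ^+ k); first by rewrite mulr_ge0// exprn_ge0// ltW.
move=> s s1; have s0 : 0 <= s by lra.
have u0 := radial_u_gt0 d C_gt0 s0.
rewrite /radial_eval /= !mul0r !add0r hornerM hornerXn normrM mulrC -mulrA.
rewrite ler_pM// ?hB ?radial_w_itv//.
have /andP[w0 _] := radial_w_itv s0.
rewrite ger0_norm ?exprn_ge0// expr_div_n.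
rewrite ler_wpM2l//; first by rewrite exprn_ge0// ltW.
have sd0 : 0 < s ^+ d by rewrite exprn_gt0; lra.
rewrite exprM lef_pV2 ?posrE ?exprn_gt0//.
  have le : s ^+ d <= u s by rewrite /radial_u lerDr ltW.
  by rewrite lerXn2r ?nnegrE// ltW.
by lra.
Qed.

End RadialBounds.

(** * Roots of the iterated Laplacian *)

Section IteratedLaplacian.
Context {R : realType} (d : nat) (C : R) (n2 : nat).
Hypotheses (d_gt0 : (0 < d)%N) (C_gt0 : 0 < C) (n2_gt0 : (0 < n2)%N).
Let K := (n2 + d)%N.

(** [radial_lap k] is the radial part of the k-th iterated Laplacian of phi, up to the
    factor 4^k s^-k: see [radial_fun_laplacian]. *)
Fixpoint radial_lap k : radial (R := R) := if k is k'.+1 then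
  euler_sub d C k'%:R (euler_sub d C (k'.+1%:R - n2%:R) (radial_lap k'))
  else radial_phi.

Let roots1 k : seq R := [seq i%:R | i <- iota 0 k].
Let roots2 k : seq R := [seq i.+1%:R - n2%:R | i <- iota 0 k].

Lemma radial_lapE k :
  radial_lap k = euler_subs d C (roots1 k) (euler_subs d C (roots2 k) radial_phi).
Proof.
elim: k => [//|k ih]; rewrite [LHS]/= ih.
have r1 : roots1 k.+1 = roots1 k ++ [:: k%:R].
  by rewrite /roots1 -(addn1 k) iotaD map_cat.
have r2 : roots2 k.+1 = roots2 k ++ [:: k.+1%:R - n2%:R].
  by rewrite /roots2 -(addn1 k) iotaD map_cat /= add0n addn1.
by rewrite r1 r2 !euler_subs_cat /= !euler_subs_subC.
Qed.

Let uniq_roots1 k : uniq (roots1 k).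
Proof. by rewrite map_inj_uniq ?iota_uniq// => i j /eqP; rewrite eqr_nat => /eqP. Qed.

Let uniq_roots2 k : uniq (roots2 k).
Proof.
rewrite map_inj_uniq ?iota_uniq// => i j /addIr/eqP.
by rewrite eqr_nat => /eqP[].
Qed.

(** The n/2 + d Laplacians contribute the roots 0, ..., n/2 + d - 1 and 1 - n/2, ..., d.
    Both lists contain 0 and d, and the second one contains -d, ..., -(q0 d) because
    q0 d < n/2. *)
Lemma radial_lap_tail m0 q0 : (d * q0.+1 = n2 + m0)%N -> (d * q0 < n2)%N ->
  is_pow_tail q0.+1 (radial_lap K).
Proof.
move=> eq0 ltq0; rewrite radial_lapE.
have d0 : d%:R != 0 :> R by rewrite pnatr_eq0 -lt0n.
pose l1 : seq R := [:: 0; d%:R].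
pose l2 : seq R := [seq - (d * j.+1)%:R | j <- rev (iota 0 q0)] ++ [:: 0; d%:R].
have sub1 : {subset l1 <= roots1 K}.
  move=> x; rewrite !inE => /orP[] /eqP ->.
    by apply/mapP; exists 0%N => //; rewrite mem_iota /K; lia.
  by apply/mapP; exists d => //; rewrite mem_iota /K; lia.
have sub2 : {subset l2 <= roots2 K}.
  move=> x; rewrite mem_cat !inE => /orP[/mapP[j + ->]|/orP[] /eqP ->].
  - rewrite mem_rev mem_iota add0n => /andP[_ jq].
    have dj : (d * j.+1 < n2)%N.
      by apply: leq_ltn_trans ltq0; rewrite leq_mul2l jq orbT.
    (* The root k + 1 - n/2 equals - d (j + 1) for k = n/2 - 1 - d (j + 1). *)
    apply/mapP; exists (n2.-1 - d * j.+1)%N; first by rewrite mem_iota /K; lia.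
    rewrite (_ : (n2.-1 - d * j.+1).+1 = n2 - d * j.+1)%N; last by lia.
    by rewrite natrB ?(ltnW dj)//; ring.
  - apply/mapP; exists n2.-1; first by rewrite mem_iota /K; lia.
    by rewrite prednK// subrr.
  - apply/mapP; exists (n2 + d).-1; first by rewrite mem_iota /K; lia.
    by rewrite prednK ?addn_gt0 ?n2_gt0// natrD; ring.
have u1 : uniq l1 by rewrite /= inE eq_sym d0.
have u2 : uniq l2.
  rewrite cat_uniq; apply/and3P; split.
  - rewrite map_inj_uniq ?rev_uniq ?iota_uniq// => i j /oppr_inj/eqP.
    by rewrite eqr_nat eqn_pmul2l// eqSS => /eqP.
  - apply/hasPn => x; rewrite !inE => xe; apply/mapP => -[j _ xj].
    have : x < 0 by rewrite xj oppr_lt0 ltr0n muln_gt0 d_gt0.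
    by case/orP: xe => /eqP ->; rewrite ?ltxx// ltNge ler0n.
  - by rewrite /= inE eq_sym d0.
have e1 := perm_extract (uniq_roots1 K) u1 sub1.
have e2 := perm_extract (uniq_roots2 K) u2 sub2.
move: (seq.filter _ (roots1 K)) (seq.filter _ (roots2 K)) e1 e2 => r1 r2 e1 e2.
rewrite (euler_subs_perm _ _ _ e1) (euler_subs_perm _ _ _ e2).
rewrite -!euler_subs_cat.
have pe : perm_eq ((r1 ++ l1) ++ r2 ++ l2)
   ((r1 ++ r2) ++ [seq - (d * j.+1)%:R | j <- rev (iota 0 q0)] ++ [:: 0; 0; d%:R; d%:R]).
  rewrite /l1 /l2; apply/permP => a; rewrite !count_cat /=.
  move: (count a r1) (count a r2) (count a (map _ _)) (nat_of_bool (a 0)) (nat_of_bool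
    (a _)) => x y z b b'.
  ring.
rewrite (euler_subs_perm _ _ _ pe) euler_subs_cat.
apply: is_pow_tail_subs; apply: is_pow_tail_gains.
exact: is_pow_tail_base.
Qed.

(** With one factor less the root d occurs only once, so that a nonzero multiple of u
    survives: the other factors multiply it by d - a with a != d. *)
Lemma radial_lap_flux :
  let v := euler_sub d C K.-1%:R (radial_lap K.-1) in
  [/\ rad_ulog v = 0, rad_log v = 0 & rad_u v != 0].
Proof.
move=> v; have d0 : d%:R != 0 :> R by rewrite pnatr_eq0 -lt0n.
pose l1 : seq R := [:: 0; d%:R].
have K0 : (0 < K)%N by rewrite addn_gt0 n2_gt0.
have sub1 : {subset l1 <= roots1 K}.
  move=> x; rewrite !inE => /orP[] /eqP ->.
    by apply/mapP; exists 0%N => //; rewrite mem_iota /K; lia.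
  by apply/mapP; exists d => //; rewrite mem_iota /K; lia.
have u1 : uniq l1 by rewrite /= inE eq_sym d0.
have -> : v = euler_subs d C (roots2 K.-1 ++ [seq x <- roots1 K | x \notin l1])
    (euler_subs d C l1 radial_phi).
  rewrite /v radial_lapE -!euler_subs_cat -[euler_sub d C K.-1%:R _]/(euler_subs d C
    (K.-1%:R :: _) _).
  apply: euler_subs_perm; rewrite -catA.
  have e : perm_eq (K.-1%:R :: roots1 K.-1) (roots1 K).
    rewrite [in X in perm_eq _ X](_ : K = K.-1.+1); last by rewrite prednK.
    move: K.-1 => k; rewrite /roots1 -(addn1 k) iotaD map_cat /= add0n.
    by rewrite perm_sym perm_catC.
  apply/permP => a.
  have := permP (perm_trans e (perm_extract (uniq_roots1 K) u1 sub1)) a.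
  rewrite /= !count_cat /= => e'; rewrite [LHS]addnA e' [LHS]addnC; ring.
have : all (fun x => x != d%:R) (roots2 K.-1 ++ [seq x <- roots1 K | x \notin l1]).
  rewrite all_cat; apply/andP; split.
    apply/allP => x /mapP[i]; rewrite mem_iota add0n => /andP[_ iK] ->.
    by rewrite subr_eq -natrD eqr_nat; apply/eqP; rewrite /K in iK *; lia.
  by apply/allP => x; rewrite mem_filter !inE negb_or => /andP[/andP[]].
elim: (_ ++ _) => [_|a l ih /= /andP[ad /ih[e1 e2 e3]]].
  split => /=; [ring|ring|].
  rewrite (_ : _ - _ = d%:R * d%:R) ?mulf_neq0//; ring.
rewrite e1 e2; split; [ring|ring|].
rewrite mulr0 add0r -mulrBl mulf_neq0// subr_eq0 eq_sym//.
Qed.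

End IteratedLaplacian.

(** * Taylor expansion on a segment *)

Section TaylorOnSegment.
Context {R : realType}.
Implicit Types (f g : R -> R).

Lemma has_deriv_sum (I : Type) (s : seq I) (F : I -> R -> R) (L : I -> R) t :
  (forall i, has_deriv (F i) t (L i)) ->
  has_deriv (fun x => \sum_(i <- s) F i x) t (\sum_(i <- s) L i).
Proof.
move=> h; elim: s => [|i s ih].
  rewrite big_nil (_ : (fun x => _) = fun _ => 0); first exact: has_deriv_cst.
  by apply/funext => x; rewrite big_nil.
rewrite big_cons (_ : (fun x => _) = fun x => F i x + \sum_(i <- s) F i x).
  exact: has_derivD.
by apply/funext => x; rewrite big_cons.
Qed.

Lemma mean_value f f' (T : R) : 0 <= T ->
  (forall t, 0 <= t <= T -> has_deriv f t (f' t)) ->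
  exists2 c, 0 <= c <= T & f T - f 0 = f' c * T.
Proof.
move=> T0 h.
have [||c] := @MVT_segment R f f' 0 T T0.
- by move=> x; rewrite in_itv /= => /andP[x0 xT]; apply: h; rewrite !ltW.
- apply: derivable_within_continuous => x; rewrite in_itv /= => xT.
  by have := h x xT; move=> /@ex_derive.
- by rewrite in_itv /= subr0 => cT e; exists c.
Qed.

(** Induction on the order by the mean value theorem: the derivative of the remainder is
    the remainder of the derivative. *)
Lemma taylor_segment m (F : nat -> R -> R) (T B : R) : 0 <= T ->
  (forall k t, (k < m)%N -> 0 <= t <= T -> has_deriv (F k) t (F k.+1 t)) ->
  (forall t, 0 <= t <= T -> `|F m t| <= B) ->
  `|F 0%N T - \sum_(k < m) F k 0 * T ^+ k / k`!%:R| <= B * T ^+ m.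
Proof.
elim: m F T => [|m ih] F T T0 hF hB.
  by rewrite big_ord0 subr0 mulr1; apply: hB; rewrite T0 lexx.
pose E t := F 0%N t - \sum_(k < m.+1) F k 0 * t ^+ k / k`!%:R.
pose E' t := F 1%N t - \sum_(k < m) F k.+1 0 * t ^+ k / k`!%:R.
have dE t : 0 <= t <= T -> has_deriv E t (E' t).
  move=> tT; apply: has_derivD; first exact: hF.
  rewrite (_ : (fun x => _) = fun x => -1 * (F 0%N 0 +
      \sum_(k < m) F k.+1 0 * x ^+ k.+1 / k.+1`!%:R)); last first.
    by apply/funext => x; rewrite big_ord_recl /= expr0 fact0 divr1 mulr1 mulN1r.
  rewrite -[X in has_deriv _ _ X]mulN1r; apply: has_derivZ.
  rewrite -[X in has_deriv _ _ X]add0r; apply: has_derivD; first exact: has_deriv_cst.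
  apply: has_deriv_sum => k.
  rewrite (_ : (fun x => _) = fun x => F k.+1 0 / k.+1`!%:R * x ^+ k.+1); last first.
    by apply/funext => x; rewrite mulrAC.
  apply: (has_deriv_eq (has_derivZ _ (has_derivX k.+1 (has_deriv_id t)))).
  rewrite /= mulr1 factS natrM.
  by field; rewrite nat1r !pnatr_eq0 -!lt0n fact_gt0.
have [c /andP[c0 cT] e] := mean_value T0 dE.
have E0 : E 0 = 0.
  rewrite /E big_ord_recl /= expr0 fact0 divr1 mulr1 big1 ?addr0 ?subrr// => k _.
  by rewrite exprS mul0r mulr0 mul0r.
rewrite E0 subr0 in e; rewrite -/(E T) e normrM (ger0_norm T0) exprSr mulrA.
rewrite ler_wpM2r//.
have := ih (fun k => F k.+1) c c0.
rewrite -/(E' c) => /(_ _ _)/le_trans; apply.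
- move=> k t km /andP[t0 tc]; apply: hF => //; rewrite t0/=; exact: le_trans cT.
- by move=> t /andP[t0 tc]; apply: hB; rewrite t0/=; exact: le_trans cT.
- rewrite ler_wpM2l//; last by rewrite lerXn2r.
  apply: le_trans (hB 0 _); rewrite ?normr_ge0// lexx//.
Qed.

End TaylorOnSegment.

(** * Partial derivatives and the Euclidean norm *)

Section PartialDerivatives.
Context {R : realType} {n : nat}.
Implicit Types (f g p : 'rV[R]_n -> R) (x y : 'rV[R]_n) (i : 'I_n).

Definition has_pd i f x (l : R) : Prop :=
  has_deriv (fun t => f (x + t *: basis_vec i)) 0 l.

Lemma has_pd_line i f x (t l : R) : has_pd i f (x + t *: basis_vec i) l ->
  has_deriv (fun t => f (x + t *: basis_vec i)) t l.
Proof.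
move=> h; have h1 : has_deriv (fun t' : R => t' - t) t 1.
  rewrite -[1]addr0; apply: has_derivD; [exact: has_deriv_id|exact: has_deriv_cst].
have h2 : has_deriv (fun t' => f (x + t *: basis_vec i + t' *: basis_vec i)) (t - t) l.
  by rewrite subrr.
have := @has_deriv_comp _ _ (fun t' => t' - t) _ _ _ h2 h1; rewrite mulr1.
by congr has_deriv; apply/funext => t'; rewrite -addrA -scalerDl addrCA subrr addr0.
Qed.

Lemma has_pdD i f g x l m : has_pd i f x l -> has_pd i g x m ->
  has_pd i (fun x => f x + g x) x (l + m).
Proof. exact: has_derivD. Qed.

Lemma has_pdM i f g x l m : has_pd i f x l -> has_pd i g x m ->
  has_pd i (fun x => f x * g x) x (l * g x + f x * m).
Proof.
by move=> hf hg; have := has_derivM hf hg; rewrite scale0r addr0.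
Qed.

Lemma has_pd_cst i c x : has_pd i (fun _ => c) x 0.
Proof. exact: has_deriv_cst. Qed.

Lemma has_pd_coord i j x : has_pd i (fun x => x 0 j) x (j == i)%:R.
Proof.
rewrite /has_pd (_ : (fun t => _) = fun t : R => x 0 j + (j == i)%:R * t); last first.
  by apply/funext => t; rewrite !mxE eqxx /= mulrC.
apply: (has_deriv_eq (has_derivD (has_deriv_cst _ _) (has_derivZ _ (has_deriv_id _)))).
by rewrite add0r mulr1.
Qed.

Lemma has_pd_comp i (h : R -> R) f x l m : has_deriv h (f x) m -> has_pd i f x l ->
  has_pd i (fun x => h (f x)) x (m * l).
Proof.
move=> hh hf; apply: (@has_deriv_comp _ h (fun t => f (x + t *: basis_vec i))) => //.
by rewrite scale0r addr0.
Qed.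

Lemma poly_lt_pd i m p : poly_lt m p ->
  exists2 p', poly_lt m.-1 p' & forall x, has_pd i p x (p' x).
Proof.
elim=> {m p} [m|m c|m j p hp [p' hp' ih]|m p q _ [p' hp' ihp] _ [q' hq' ihq]].
- by exists (fun _ => 0); [exact: poly_lt0|move=> x; exact: has_pd_cst].
- by exists (fun _ => 0); [exact: poly_lt0|move=> x; exact: has_pd_cst].
- exists (fun x => (j == i)%:R * p x + x 0 j * p' x).
    apply: poly_ltD; first exact: poly_ltZ.
    case: m hp hp' {ih} => [|m] hp hp'; last exact: poly_ltX.
    by rewrite (poly_lt_eq0 hp'); apply: eq_poly_lt (poly_lt0 _) => x; rewrite mulr0.
  by move=> x; apply: has_pdM => //; exact: has_pd_coord.
- exists (fun x => p' x + q' x); first exact: poly_ltD.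
  by move=> x; exact: has_pdD.
Qed.

Definition nsq x : R := \sum_(k < n) x 0 k ^+ 2.

Lemma nsq_pd i x : has_pd i nsq x (2 * x 0 i).
Proof.
have h : forall s : seq 'I_n, has_pd i (fun x => \sum_(k <- s) x 0 k ^+ 2) x
    (\sum_(k <- s) 2 * x 0 k * (k == i)%:R).
  move=> s; apply: (@has_deriv_sum R _ s (fun k t => (x + t *: basis_vec i) 0 k ^+ 2)) => k.
  have := has_derivX 2 (has_pd_coord i k x).
  by rewrite /= scale0r addr0 expr1.
have h' := h (index_enum 'I_n); apply: (has_deriv_eq h').
by rewrite (bigD1 i)//= eqxx mulr1 big1 ?addr0// => k /negbTE ->; rewrite mulr0.
Qed.

Lemma nsq_ge0 x : 0 <= nsq x.
Proof. by apply: sumr_ge0 => k _; exact: sqr_ge0. Qed.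

Lemma enorm_sqr x : enorm x ^+ 2 = nsq x.
Proof. by rewrite sqr_sqrtr// nsq_ge0. Qed.

Lemma normr_sqr_le_nsq x : `|x| ^+ 2 <= nsq x.
Proof.
have e : `|x| <= Num.sqrt (nsq x).
  apply: normr_row_le; first exact: sqrtr_ge0.
  move=> k; rewrite -sqrtr_sqr ler_wsqrtr//.
  by rewrite /nsq (bigD1 k)//= lerDl sumr_ge0// => j _; exact: sqr_ge0.
by rewrite -(sqr_sqrtr (nsq_ge0 x)) lerXn2r ?nnegrE ?sqrtr_ge0.
Qed.

Lemma nsq_le_normr_sqr x : nsq x <= n%:R * `|x| ^+ 2.
Proof.
rewrite -[n in n%:R]card_ord -sum1_card natr_sum mulr_suml; apply: ler_sum => k _.
by rewrite mul1r -[leLHS]ger0_norm ?sqr_ge0// normrX lerXn2r ?nnegrE// normr_coord_le.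
Qed.

Lemma enorm_le_normr x : enorm x <= n%:R * `|x|.
Proof.
rewrite -(@ler_pXn2r _ 2) ?nnegrE ?sqrtr_ge0 ?mulr_ge0// enorm_sqr.
apply: le_trans (nsq_le_normr_sqr x) _.
rewrite exprMn ler_wpM2r ?exprn_ge0//.
by case: (n) => [|m]; rewrite ?expr0n//= expr2 ler_peMr// ler1n.
Qed.

End PartialDerivatives.

(** * Decay at infinity *)

Section Decay.
Context {R : realType} {n : nat}.
Implicit Types (f g p : 'rV[R]_n -> R) (x y : 'rV[R]_n) (i : 'I_n).

(** Only large x count, since the radial functions met below are singular at the origin. *)
Definition decays (k : nat) f : Prop :=
  exists B r0 : R, [/\ 0 <= B, 1 <= r0 & forall x, r0 <= `|x| -> `|f x| <= B / `|x| ^+ k].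

Lemma eq_decays k f g : f =1 g -> decays k f -> decays k g.
Proof. by move=> fg; rewrite (funext fg). Qed.

Lemma decays0 k : decays k (fun _ => 0).
Proof. by exists 0, 1; split=> // x _; rewrite normr0 mul0r. Qed.

Lemma decaysD k f g : decays k f -> decays k g -> decays k (fun x => f x + g x).
Proof.
move=> [B [r [B0 r1 hB]]] [B' [r' [B'0 r'1 hB']]].
exists (B + B'), (Num.max r r'); split; first exact: addr_ge0.
  by rewrite le_max r1.
move=> x; rewrite ge_max => /andP[/hB h /hB' h'].
by rewrite mulrDl (le_trans (ler_normD _ _))// lerD.
Qed.

Lemma decaysZ k c f : decays k f -> decays k (fun x => c * f x).
Proof.
move=> [B [r [B0 r1 hB]]]; exists (`|c| * B), r; split=> //; first exact: mulr_ge0.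
by move=> x /hB h; rewrite normrM -mulrA ler_wpM2l.
Qed.

Lemma decays_sum k (I : Type) (s : seq I) (F : I -> 'rV[R]_n -> R) :
  (forall j, decays k (F j)) -> decays k (fun x => \sum_(j <- s) F j x).
Proof.
move=> h; elim: s => [|i s ih].
  by apply: eq_decays (decays0 k) => x; rewrite big_nil.
by apply: eq_decays (decaysD (h i) ih) => x; rewrite big_cons.
Qed.

(** Far from the origin a bounded displacement changes the norm by a factor of at most 2.
    This covers shifts and the intermediate points of the mean value theorem. *)
Lemma decays_near k f g a : 0 <= a ->
  (exists r1, forall x, r1 <= `|x| -> exists2 y, `|x - y| <= a & `|f x| <= `|g y|) ->
  decays k g -> decays k f.
Proof.
move=> a0 [r1 hr1] [B [r [B0 r1' hB]]].
exists (B * 2 ^+ k), (Num.max r1 (r + 2 * a)); split; first by rewrite mulr_ge0// exprn_ge0.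
  by rewrite le_max; apply/orP; right; lra.
move=> x; rewrite ge_max => /andP[/hr1[y xy fg] xr].
have hy : `|x| <= 2 * `|y|.
  have := ler_normB x (x - y); rewrite opprB addrC subrK => h1.
  have := ler_normD (x - y) y; rewrite subrK => h2.
  lra.
have yr : r <= `|y| by have := ler_normD (x - y) y; rewrite subrK; lra.
apply: le_trans fg _; apply: le_trans (hB y yr) _.
rewrite -mulrA ler_wpM2l// -[leRHS]invrK invfM invrK.
have y0 : 0 < `|y| by lra.
have x0 : 0 < `|x| by lra.
rewrite lef_pV2 ?posrE ?mulr_gt0 ?invr_gt0 ?exprn_gt0//.
by rewrite mulrC ler_pdivrMr ?exprn_gt0// mulrC -exprMn lerXn2r ?nnegrE// mulr_ge0.
Qed.

Lemma decays_shift k f a : decays k f -> decays k (fun x => f (x + a)).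
Proof.
apply: (@decays_near k _ _ `|a|) => //; exists 0 => x _; exists (x + a) => //.
by rewrite opprD addrA subrr sub0r normrN.
Qed.

Lemma decays_stencil k A f : is_stencil A -> decays k f -> decays k (A f).
Proof.
move=> [s hs] hf.
apply: (@eq_decays k (fun x => \sum_(t <- s) t.1 * f (x + lattice_pt t.2))).
  by move=> x; rewrite hs.
by apply: decays_sum => t; exact/decaysZ/decays_shift.
Qed.

End Decay.

(** * Taylor expansion along coordinate lines *)

Section LineTaylor.
Context {R : realType} {n : nat}.
Implicit Types (f g p : 'rV[R]_n -> R) (x y : 'rV[R]_n) (i : 'I_n).

Lemma norm_basis_vec i : `|basis_vec i : 'rV[R]_n| <= 1.
Proof.
apply: normr_row_le => // k; rewrite !mxE eqxx /=.
by case: (k == i); rewrite ?normr1 ?normr0.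
Qed.

Lemma norm_scale_basis_vec (t : R) i : `|t *: basis_vec i : 'rV[R]_n| <= `|t|.
Proof. by rewrite normrZ ler_piMr// norm_basis_vec. Qed.

Lemma line_taylor i m (F : nat -> 'rV[R]_n -> R) x (T B : R) : 0 <= T ->
  (forall k t, (k < m)%N -> 0 <= t <= T ->
     has_pd i (F k) (x + t *: basis_vec i) (F k.+1 (x + t *: basis_vec i))) ->
  (forall t, 0 <= t <= T -> `|F m (x + t *: basis_vec i)| <= B) ->
  `|F 0%N (x + T *: basis_vec i) - \sum_(k < m) F k x * T ^+ k / k`!%:R| <= B * T ^+ m.
Proof.
move=> T0 hF hB.
have := @taylor_segment _ m (fun k t => F k (x + t *: basis_vec i)) T B T0.
rewrite scale0r addr0; apply=> // k t km tT.
exact/has_pd_line/hF.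
Qed.

Lemma poly_lt_chain i m p : poly_lt m p -> exists F : nat -> 'rV[R]_n -> R,
  [/\ F 0%N = p, forall k, poly_lt (m - k) (F k) &
      forall k x, has_pd i (F k) x (F k.+1 x)].
Proof.
elim: m p => [|m ih] p hp.
  exists (fun _ _ => 0); split; first by rewrite (poly_lt_eq0 hp).
    by move=> k; exact: poly_lt0.
  by move=> k x; exact: has_pd_cst.
have [p' /ih[F [F0 hF dF]] hp'] := poly_lt_pd i hp.
exists (fun k => if k is k'.+1 then F k' else p); split=> //.
  by case=> [|k]; [rewrite subn0|rewrite subSS].
by case=> [|k] x //; rewrite F0.
Qed.

Lemma poly_line_taylor i m N p : poly_lt m p -> (m <= N)%N ->
  exists F : nat -> 'rV[R]_n -> R, [/\ F 0%N = p, forall k, poly_lt (m - k) (F k) &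
    forall x T, 0 <= T ->
      p (x + T *: basis_vec i) = \sum_(k < N) F k x * T ^+ k / k`!%:R].
Proof.
move=> hp mN; have [F [F0 hF dF]] := poly_lt_chain i hp.
exists F; split=> // x T T0; apply/eqP; rewrite -subr_eq0 -normr_le0 -F0.
have := @line_taylor i N F x T 0 T0; rewrite mul0r; apply=> // t tT.
have := hF N; rewrite (eqP mN) => /poly_lt_eq0 ->.
by rewrite normr0.
Qed.

(** Far out the segment from x to x + T e_i stays at distance at least |x| / 2 from the
    origin, where the m-th derivative decays. *)
Lemma decays_line i m (F : nat -> 'rV[R]_n -> R) (T r0 : R) q : 0 <= T ->
  (forall k x, (k < m)%N -> r0 <= `|x| -> has_pd i (F k) x (F k.+1 x)) ->
  decays q (F m) ->
  decays q (fun x => F 0%N (x + T *: basis_vec i) -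
                     \sum_(k < m) F k x * T ^+ k / k`!%:R).
Proof.
move=> T0 hF [B [r [B0 r1 hB]]].
exists (B * 2 ^+ q * T ^+ m), (2 * (Num.max r r0 + T)); split.
- by rewrite !mulr_ge0// exprn_ge0.
- have : 1 <= Num.max r r0 by rewrite le_max r1.
  lra.
move=> x xr.
have [mr mr0] : r <= Num.max r r0 /\ r0 <= Num.max r r0 by rewrite !le_max !lexx orbT.
have far t : 0 <= t <= T -> `|x| / 2 <= `|x + t *: basis_vec i| /\ Num.max r r0 <= `|x +
  t *: basis_vec i|.
  move=> /andP[t0 tT]; have := norm_scale_basis_vec t i; rewrite (ger0_norm t0) => h.
  have := ler_normB (x + t *: basis_vec i) (t *: basis_vec i); rewrite addrK => h'.
  have m1 : 1 <= Num.max r r0 by rewrite le_max r1.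
  split; lra.
have x0 : 0 < `|x|.
  have m1 : 1 <= Num.max r r0 by rewrite le_max r1.
  lra.
rewrite [leRHS](_ : _ = B * 2 ^+ q / `|x| ^+ q * T ^+ m); last by rewrite mulrAC.
apply: line_taylor => // [k t km /far[_ h]|t /far[h1 h2]].
  by apply: hF => //; exact: le_trans h.
apply: le_trans (hB _ (le_trans mr h2)) _.
rewrite -mulrA ler_wpM2l// (_ : _ / _ = ((`|x| / 2) ^+ q)^-1); last first.
  by rewrite expr_div_n invf_div.
rewrite lef_pV2 ?posrE ?exprn_gt0//; try lra.
by rewrite lerXn2r ?nnegrE//; lra.
Qed.

End LineTaylor.

(** * Symbols *)

Section Symbols.
Context {R : realType} {n : nat} (d : nat) (C : R).
Hypotheses (d_gt0 : (0 < d)%N) (C_gt0 : 0 < C).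
Implicit Types (f g p : 'rV[R]_n -> R) (x y : 'rV[R]_n) (i : 'I_n).

Definition radial_fun b v x : R := radial_pow d C b v (nsq x).

(** Sums of terms p(x) s^-b F(s) with p polynomial and F radial.  The index k counts the
    decay gained: a partial derivative raises it by one ([symbol_pd]). *)
Inductive symbol (A : nat) : nat -> ('rV[R]_n -> R) -> Prop :=
| symbol0 k : symbol A k (fun _ => 0)
| symbol_base k a b v p : poly_lt a.+1 p -> (a + k <= A + 2 * b)%N ->
    symbol A k (fun x => p x * radial_fun b v x)
| symbolD k f g : symbol A k f -> symbol A k g -> symbol A k (fun x => f x + g x).

Lemma nsq_gt0 x : 0 < `|x| -> 0 < nsq x.
Proof. by move=> x0; apply: lt_le_trans (normr_sqr_le_nsq x); rewrite exprn_gt0. Qed.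

Lemma radial_fun_pd i b v x : 0 < `|x| ->
  has_pd i (radial_fun b v) x (2 * x 0 i * radial_fun b.+1 (euler_sub d C b%:R v) x).
Proof.
move=> x0; have := has_pd_comp (radial_pow_deriv d_gt0 C_gt0 b v (nsq_gt0 x0)) (nsq_pd i x).
by move=> h; apply: (has_deriv_eq h); rewrite mulrC.
Qed.

Lemma symbol_pd A k f i : symbol A k f ->
  exists2 f', symbol A k.+1 f' & forall x, 0 < `|x| -> has_pd i f x (f' x).
Proof.
elim=> {k f} [k|k a b v p hp hk|k f g _ [f' hf' ihf] _ [g' hg' ihg]].
- by exists (fun _ => 0); [exact: symbol0|move=> x _; exact: has_pd_cst].
- have [p' hp' dp] := poly_lt_pd i hp.
  exists (fun x => p' x * radial_fun b v x +
     (2 * (x 0 i * p x)) * radial_fun b.+1 (euler_sub d C b%:R v) x).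
    apply: symbolD; last first.
      apply: (@symbol_base _ _ a.+1); last by lia.
      exact/poly_ltZ/poly_ltX.
    case: a hp hk hp' => [|a] hp hk hp'.
      rewrite (poly_lt_eq0 hp') (_ : (fun x => _) = fun _ => 0); first exact: symbol0.
      by apply/funext => x; rewrite mul0r.
    by apply: symbol_base hp' _; lia.
  move=> x x0; have := has_pdM (dp x) (radial_fun_pd i b v x0).
  by move=> h; apply: (has_deriv_eq h); ring.
- exists (fun x => f' x + g' x); first exact: symbolD.
  by move=> x x0; apply: has_pdD; [exact: ihf|exact: ihg].
Qed.

Lemma symbol_chain A k f i m : symbol A k f -> exists F : nat -> 'rV[R]_n -> R,
  [/\ F 0%N = f, forall j, (j <= m)%N -> symbol A (k + j) (F j) &
   forall j x, (j < m)%N -> 0 < `|x| -> has_pd i (F j) x (F j.+1 x)].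
Proof.
elim: m k f => [|m ih] k f hf.
  by exists (fun _ => f); split=> // -[|//] _; rewrite addn0.
have [f' /ih[F [F0 hF dF]] df] := symbol_pd i hf.
exists (fun j => if j is j'.+1 then F j' else f); split=> //.
  case=> [_|j jm]; first by rewrite addn0.
  by rewrite -addSnnS; exact: hF.
case=> [|j] x jm x0; last exact: dF.
by rewrite F0; exact: df.
Qed.

Lemma nsq_pow_bound m x : 1 <= `|x| ->
  nsq x ^+ m <= n%:R ^+ m * `|x| ^+ (2 * m) /\ nsq x ^- m <= `|x| ^- (2 * m).
Proof.
move=> x1; have h1 := nsq_le_normr_sqr x; have h2 := normr_sqr_le_nsq x.
have x0 : 0 < `|x| by lra.
rewrite exprM; split.
  by rewrite -exprMn lerXn2r ?nnegrE ?mulr_ge0// ?exprn_ge0// nsq_ge0.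
rewrite lef_pV2 ?posrE ?exprn_gt0//; last exact: nsq_gt0.
by rewrite lerXn2r ?nnegrE ?exprn_ge0// nsq_ge0.
Qed.

Lemma nsq_ge1 x : 1 <= `|x| -> 1 <= nsq x.
Proof. by move=> x1; apply: le_trans (normr_sqr_le_nsq x); exact: exprn_ege1. Qed.

Lemma decays_of_bound q f B : 0 <= B ->
  (forall x, 1 <= `|x| -> `|f x| <= B / `|x| ^+ q) -> decays q f.
Proof. by move=> B0 h; exists B, 1. Qed.

(** The factor F(s) costs at most s^(2d), whence the shift by 4d. *)
Lemma symbol_decays A k q f : symbol A k f -> (A + 4 * d + q <= k)%N -> decays q f.
Proof.
elim=> {k f} [k|k a b v p hp hk|k f g _ ihf _ ihg] hq.
- exact: decays0.
- have [B1 B10 hB1] := poly_lt_bound hp.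
  have [B2 B20 hB2] := radial_eval_bound d C_gt0 v.
  apply: (@decays_of_bound _ _ (B1 * 2 ^+ a * (B2 * n%:R ^+ (2 * d)))).
    by rewrite !mulr_ge0// ?exprn_ge0.
  move=> x x1; have x0 : 0 < `|x| by lra.
  have [k1 _] := nsq_pow_bound (2 * d) x1.
  have [_ k2] := nsq_pow_bound b x1.
  have nn0 : 0 <= nsq x ^- b by rewrite invr_ge0 exprn_ge0// nsq_ge0.
  rewrite normrM normrM (ger0_norm nn0).
  have e1 : `|p x| <= B1 * 2 ^+ a * `|x| ^+ a.
    apply: le_trans (hB1 x) _; rewrite -mulrA ler_wpM2l// -exprMn lerXn2r ?nnegrE; lra.
  have e2 : `|radial_eval d C v (nsq x)| <= B2 * n%:R ^+ (2 * d) * `|x| ^+ (2 * (2 * d)).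
    apply: le_trans (hB2 _ (nsq_ge1 x1)) _; rewrite -mulrA ler_wpM2l//.
  apply: le_trans (ler_pM _ _ e1 (ler_pM _ _ k2 e2)) _ => //.
    by rewrite mulr_ge0.
  rewrite [leLHS](_ : _ = (B1 * 2 ^+ a * (B2 * n%:R ^+ (2 * d))) *
     (`|x| ^+ a * `|x| ^+ (2 * (2 * d)) / `|x| ^+ (2 * b))); last by ring.
  rewrite ler_wpM2l//; first by rewrite !mulr_ge0// exprn_ge0.
  rewrite ler_pdivrMr ?exprn_gt0// ler_pdivlMl ?exprn_gt0//.
  rewrite -!exprD ler_weXn2l//; lia.
- by apply: decaysD; [exact: ihf|exact: ihg].
Qed.

(** The summands are the second derivatives of s^-b F(s) in the coordinate directions.
    As the x_i^2 add up to s, the sum is again radial. *)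
Lemma radial_fun_laplacian n2 b v x : n = (2 * n2)%N -> 0 < `|x| ->
  \sum_(i < n) (2 * radial_fun b.+1 (euler_sub d C b%:R v) x +
     2 * x 0 i * (2 * x 0 i * radial_fun b.+2
         (euler_sub d C b.+1%:R (euler_sub d C b%:R v)) x)) =
  4 * radial_fun b.+1 (euler_sub d C b%:R (euler_sub d C (b.+1%:R - n2%:R) v)) x.
Proof.
move=> en x0; have s0 := nsq_gt0 x0; have sn0 := lt0r_neq0 s0.
rewrite big_split /= sumr_const card_ord.
rewrite (eq_bigr (fun i => x 0 i ^+ 2 * (4 * radial_fun b.+2
  (euler_sub d C b.+1%:R (euler_sub d C b%:R v)) x))); last by move=> i _; ring.
rewrite -mulr_suml -/(nsq x) /radial_fun /radial_pow.
rewrite [euler_sub d C b%:R (euler_sub _ _ (_ - _) _)]euler_subC.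
move: (euler_sub d C b%:R v) => w.
rewrite (euler_sub_eval d C b.+1%:R) (euler_sub_eval d C (b.+1%:R - n2%:R)).
have en' : n%:R = 2 * n2%:R :> R by rewrite [in LHS]en natrM.
rewrite -[_ *+ n]mulr_natr en' !exprS.
have sb0 : nsq x ^+ b != 0 by rewrite expf_neq0.
by field; rewrite sn0 sb0.
Qed.

End Symbols.

(** The weights solve a Vandermonde system with the distinct nodes 0, ..., N - 1. *)
Lemma exists_second_diff_weights (R : realType) (N : nat) :
  exists nu : 'I_N -> R, forall l, (l < N)%N ->
    \sum_(b < N) nu b * b%:R ^+ l = 2 * (l == 2)%:R.
Proof.
pose a : 'rV[R]_N := \row_b b%:R.
pose c : 'cV[R]_N := \col_l (2 * (l == 2 :> nat)%:R).
have Vu : Vandermonde N a \in unitmx.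
  rewrite unitmxE det_Vandermonde unitfE.
  apply/prodf_neq0 => i _; apply/prodf_neq0 => j ij.
  by rewrite !mxE subr_eq0 eqr_nat gtn_eqF.
exists (fun b => (invmx (Vandermonde N a) *m c) b 0) => l lN.
have := mulKVmx Vu c => /matrixP/(_ (Ordinal lN) 0); rewrite mxE [RHS]mxE /= => <-.
by apply: eq_bigr => b _; rewrite !mxE mulrC.
Qed.

(** * A discrete Laplacian of high order *)

Section DiscreteLaplacian.
Context {R : realType} {n : nat} (N : nat) (nu : 'I_N -> R).
Hypothesis N_gt2 : (2 < N)%N.
Hypothesis nuP : forall l, (l < N)%N ->
  \sum_(b < N) nu b * b%:R ^+ l = 2 * (l == 2)%:R.
Implicit Types (f g p : 'rV[R]_n -> R) (x y : 'rV[R]_n) (i : 'I_n).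

Definition diff2 i f x : R := \sum_(b < N) nu b * f (x + b%:R *: basis_vec i).
(** A discrete antiderivative of [diff2] in the direction e_i, see [diff1_telescope]; it
    approximates the first partial derivative. *)
Definition diff1 i f x : R :=
  \sum_(b < N) nu b * \sum_(l < b) f (x + l%:R *: basis_vec i).
Definition dlap f x : R := \sum_(i < n) diff2 i f x.

Lemma is_stencil_step i (b : nat) :
  is_stencil (fun f x => f (x + b%:R *: basis_vec i)).
Proof.
have [s hs] := is_stencil_shift (R := R) ((delta_mx 0 i : 'rV[int]_n) *+ b).
exists s => f x; rewrite -hs; congr (f (x + _)).
elim: b {s hs} => [|b ih]; first by rewrite scale0r mulr0n lattice_pt0.
by rewrite [X in lattice_pt X]mulrS lattice_ptD -ih lattice_pt_delta -natr1 scalerDl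
  scale1r addrC.
Qed.

Lemma is_stencil_diff2 i : is_stencil (diff2 i).
Proof. by apply: is_stencil_sum => b; apply/is_stencilZ/is_stencil_step. Qed.

Lemma is_stencil_diff1 i : is_stencil (diff1 i).
Proof.
apply: is_stencil_sum => b; apply/is_stencilZ/is_stencil_sum => l.
exact: is_stencil_step.
Qed.

Lemma is_stencil_dlap : is_stencil dlap.
Proof. by apply: is_stencil_sum => i; exact: is_stencil_diff2. Qed.

Lemma diff1_telescope i f x :
  diff1 i f (x + basis_vec i) - diff1 i f x = diff2 i f x.
Proof.
rewrite /diff1 /diff2 -sumrB.
have n0 : \sum_(b < N) nu b = 0.
  have := nuP (ltnW (ltnW N_gt2)); rewrite /= mulr0 => e; rewrite -[RHS]e.
  by apply: eq_bigr => b _; rewrite expr0 mulr1.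
transitivity (\sum_(b < N) nu b * (f (x + b%:R *: basis_vec i) - f x)).
  apply: eq_bigr => b _; rewrite -mulrBr; congr (_ * _).
  elim: (nat_of_ord b) => [|m ih]; first by rewrite !big_ord0 scale0r addr0 !subrr.
  have e : x + basis_vec i + m%:R *: basis_vec i = x + m.+1%:R *: basis_vec i.
    by rewrite -natr1 scalerDl scale1r [m%:R *: _ + _]addrC addrA.
  by rewrite !big_ord_recr /= e; move: ih; lra.
under eq_bigr do rewrite mulrBr.
by rewrite sumrB -mulr_suml n0 mul0r subr0.
Qed.

Lemma weights_taylor (c : nat -> R) :
  \sum_(b < N) nu b * (\sum_(k < N) c k * b%:R ^+ k / k`!%:R) = c 2%N.
Proof.
under eq_bigr do rewrite mulr_sumr.
rewrite exchange_big /= (bigD1 (Ordinal N_gt2))//= [X in _ + X]big1 ?addr0.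
  rewrite (eq_bigr (fun b : 'I_N => nu b * b%:R ^+ 2 * (c 2%N / 2))).
    by rewrite -mulr_suml nuP// eqxx mulr1; field.
  by move=> b _; rewrite /= (_ : 2`! = 2)//; ring.
move=> k k2; rewrite (eq_bigr (fun b : 'I_N => nu b * b%:R ^+ k * (c k / k`!%:R))).
  rewrite -mulr_suml nuP// (_ : (k == 2 :> nat) = false) ?mulr0 ?mul0r//.
  by apply: contraNF k2 => /eqP e; apply/eqP/val_inj.
by move=> b _; ring.
Qed.

(** On polynomials of degree less than N the weights give the second derivative exactly. *)
Lemma dlap_poly m p : poly_lt m p -> (m <= N)%N -> poly_lt (m - 2) (dlap p).
Proof.
move=> hp mN; apply: poly_lt_sum => i.
have [F [F0 hF tF]] := poly_line_taylor i hp mN.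
apply: eq_poly_lt (hF 2%N) => x; rewrite /diff2.
under eq_bigr do rewrite tF//.
by rewrite (weights_taylor (fun k => F k x)).
Qed.

Lemma iter_dlap_poly_eq0 m k p : poly_lt m p -> (m <= N)%N -> (m <= 2 * k)%N ->
  iter k dlap p = fun _ => 0.
Proof.
move=> hp mN mk; apply: poly_lt_eq0.
suff h : poly_lt (m - 2 * k) (iter k dlap p) by move: h; rewrite (eqP mk).
elim: k {mk} => [|k ih]; first by rewrite muln0 subn0.
rewrite (_ : m - 2 * k.+1 = m - 2 * k - 2)%N; last by lia.
by apply: dlap_poly ih _; lia.
Qed.

Section OnRadial.
Variables (d : nat) (C : R).
Hypotheses (d_gt0 : (0 < d)%N) (C_gt0 : 0 < C).

Lemma radial_fun_pd2 i b v x : 0 < `|x| ->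
  has_pd i (fun x => 2 * x 0 i * radial_fun d C b.+1 (euler_sub d C b%:R v) x) x
   (2 * radial_fun d C b.+1 (euler_sub d C b%:R v) x +
     2 * x 0 i * (2 * x 0 i * radial_fun d C b.+2
         (euler_sub d C b.+1%:R (euler_sub d C b%:R v)) x)).
Proof.
move=> x0.
have h1 := has_pdM (has_pdM (has_pd_cst i 2 x) (has_pd_coord i i x))
  (radial_fun_pd d_gt0 C_gt0 i b.+1 (euler_sub d C b%:R v) x0).
by apply: (has_deriv_eq h1); rewrite eqxx mulr1n; ring.
Qed.

(** The weights are exact on the Taylor polynomial of degree N - 1, and the N-th
    derivative, which bounds the remainder, is a symbol with large index. *)
Lemma diff2_radial q i b v : (4 * d + q <= N)%N ->
  decays q (fun x => diff2 i (radial_fun d C b v) x -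
   (2 * radial_fun d C b.+1 (euler_sub d C b%:R v) x +
     2 * x 0 i * (2 * x 0 i * radial_fun d C b.+2
         (euler_sub d C b.+1%:R (euler_sub d C b%:R v)) x))).
Proof.
move=> hN.
set f2 := (X in decays _ (fun x => _ - X x)).
have sf2 : symbol d C 0 2 f2.
  apply: symbolD.
    by apply: (@symbol_base _ _ _ _ _ _ 0); [exact: poly_ltC|lia].
  rewrite (_ : (fun x => _) = fun x => (4 * (x 0 i * x 0 i)) *
      radial_fun d C b.+2 (euler_sub d C b.+1%:R (euler_sub d C b%:R v)) x); last first.
    by apply/funext => x; ring.
  apply: (@symbol_base _ _ _ _ _ _ 2); last by lia.
  apply/poly_ltZ/poly_ltX; exact: poly_lt_coord.
have [G [G0 hG dG]] := symbol_chain d_gt0 C_gt0 i (N - 2) sf2.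
(* The first two derivatives are prescribed; the chain of symbols continues them. *)
pose F k : 'rV[R]_n -> R := match k with
  | 0 => radial_fun d C b v
  | 1 => fun x => 2 * x 0 i * radial_fun d C b.+1 (euler_sub d C b%:R v) x
  | k.+2 => G k end.
have dF k x : (k < N)%N -> 1 <= `|x| -> has_pd i (F k) x (F k.+1 x).
  move=> kN x1; have x0 : 0 < `|x| by lra.
  case: k kN => [|[|k]] kN /=; first exact: radial_fun_pd.
    by rewrite G0; exact: radial_fun_pd2.
  by apply: dG => //; lia.
have dN : decays q (F N).
  have eN : N = (N - 2).+2 by lia.
  have -> : F N = G (N - 2)%N by rewrite [in LHS]eN.
  by apply: (symbol_decays d_gt0 C_gt0 (hG _ (leqnn _))); lia.
have hd : decays q (fun x => \sum_(b < N) nu b * (F 0%N (x + b%:R *: basis_vec i) -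
                     \sum_(k < N) F k x * b%:R ^+ k / k`!%:R)).
  apply: decays_sum => b'; apply: decaysZ.
  by apply: (decays_line (r0 := 1)).
apply: eq_decays hd => x.
under eq_bigr do rewrite mulrBr.
by rewrite sumrB (weights_taylor (fun k => F k x)) /= G0.
Qed.

Variable n2 : nat.
Hypotheses (n_eq : n = (2 * n2)%N) (n2_gt0 : (0 < n2)%N).

Definition lap_phi k x : R := 4 ^+ k * radial_fun d C k (radial_lap d C n2 k) x.

Lemma decays_eq_far q f g : (forall x, 1 <= `|x| -> f x = g x) -> decays q f -> decays q g.
Proof.
move=> fg [B [r [B0 r1 hB]]]; exists B, r; split=> // x rx.
by rewrite -fg ?hB//; exact: le_trans rx.
Qed.

Lemma dlap_lap_phi q k : (4 * d + q <= N)%N ->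
  decays q (fun x => dlap (lap_phi k) x - lap_phi k.+1 x).
Proof.
move=> hN; set v := radial_lap d C n2 k.
have h := decaysZ (4 ^+ k) (decays_sum (index_enum 'I_n)
   (fun i => diff2_radial i k v hN)).
apply: decays_eq_far h => x x1.
rewrite sumrB (radial_fun_laplacian d C k v n_eq (lt_le_trans ltr01 x1)).
have -> : dlap (lap_phi k) x = 4 ^+ k * \sum_(i < n) diff2 i (radial_fun d C k v) x.
  rewrite mulr_sumr; apply: eq_bigr => i _; rewrite /diff2 mulr_sumr.
  by apply: eq_bigr => b _; rewrite mulrCA.
by rewrite /lap_phi /= exprS; ring.
Qed.

(** Shifts preserve decay, so the error made in one step survives the later ones. *)
Lemma iter_dlap_lap_phi q k : (4 * d + q <= N)%N ->
  decays q (fun x => iter k dlap (lap_phi 0) x - lap_phi k x).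
Proof.
move=> hN; elim: k => [|k ih].
  by apply: eq_decays (decays0 q) => x; rewrite /= subrr.
apply: eq_decays (decaysD (decays_stencil is_stencil_dlap ih) (dlap_lap_phi k hN)) => x /=.
have e : (fun y => iter k dlap (lap_phi 0) y - lap_phi k y) =
   (fun y => -1 * lap_phi k y + iter k dlap (lap_phi 0) y).
  by apply/funext => y; ring.
by rewrite e (is_stencil_linear is_stencil_dlap); ring.
Qed.

Lemma decays_lap_phi m0 q0 : (d * q0.+1 = n2 + m0)%N -> (d * q0 < n2)%N ->
  decays (2 * n + 2 * d + 2 * m0) (lap_phi (n2 + d)).
Proof.
move=> e1 e2.
have [B B0 hB] := radial_eval_bound_tail d C_gt0 (radial_lap_tail d_gt0 C_gt0 n2_gt0 e1 e2).
apply: (@decays_of_bound _ _ _ _ (4 ^+ (n2 + d) * B)).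
  by rewrite mulr_ge0// exprn_ge0.
move=> x x1; have x0 : 0 < `|x| by lra.
rewrite normrM ger0_norm ?exprn_ge0// -mulrA ler_wpM2l ?exprn_ge0//.
rewrite /radial_fun /radial_pow normrM.
have [_ k1] := nsq_pow_bound (n2 + d) x1.
have [_ k2] := nsq_pow_bound (d * q0.+1) x1.
have nn0 : 0 <= nsq x ^- (n2 + d) by rewrite invr_ge0 exprn_ge0// nsq_ge0.
rewrite (ger0_norm nn0).
apply: le_trans (ler_pM _ _ k1 (hB _ (nsq_ge1 x1))) _ => //.
rewrite mulrCA ler_wpM2l//.
apply: le_trans (ler_wpM2l _ k2) _; first by rewrite invr_ge0 exprn_ge0.
have en : (2 * (n2 + d) + 2 * (n2 + m0) = 2 * n + 2 * d + 2 * m0)%N by lia.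
by rewrite -invfM -exprD e1 en.
Qed.

Lemma iter_dlap_decays m0 q0 : (d * q0.+1 = n2 + m0)%N -> (d * q0 < n2)%N ->
  (4 * d + (2 * n + 2 * d + 2 * m0) <= N)%N ->
  decays (2 * n + 2 * d + 2 * m0) (iter (n2 + d) dlap (lap_phi 0)).
Proof.
move=> e1 e2 hN.
apply: eq_decays (decaysD (iter_dlap_lap_phi (n2 + d) hN) (decays_lap_phi e1 e2)) => x.
by rewrite subrK.
Qed.

Lemma sum_ord_natr (b : nat) : \sum_(l < b) l%:R = (b%:R ^+ 2 - b%:R) / 2 :> R.
Proof.
elim: b => [|b ih]; first by rewrite big_ord0 expr0n /= subrr mul0r.
by rewrite big_ord_recr /= ih -natr1; field.
Qed.

(** Exactness in the degrees 1 and 2 makes [diff1] return the slope of an affine function. *)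
Lemma weights_flux (a c : R) :
  \sum_(b < N) nu b * \sum_(l < b) (a + c * l%:R) = c.
Proof.
rewrite (eq_bigr (fun b : 'I_N => nu b * b%:R ^+ 1 * (a - c / 2) + nu b * b%:R ^+ 2 * (c
  / 2))).
  rewrite big_split /= -!mulr_suml !nuP//; last exact: ltnW.
  by rewrite /= mulr0 mul0r add0r mulr1; field.
move=> b _; rewrite big_split /= -mulr_sumr sum_ord_natr sumr_const card_ord -mulr_natr.
by field.
Qed.

(** To leading order [diff1] is a partial derivative of a multiple of
    s^(1-K) F, hence a multiple of x_i s^-K (kappa' u + O(1)) by [radial_lap_flux]; as
    u ~ s^d, this is a multiple of x_i s^(-n/2).  The error is O(s^(-n/2)). *)
Lemma diff1_flux : (4 * d + n <= N)%N ->
  exists2 kappa : R, kappa != 0 & forall i,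
  decays n (fun x => diff1 i (iter (n2 + d).-1 dlap (lap_phi 0)) x -
     kappa * (x 0 i * nsq x ^- n2)).
Proof.
move=> hN; set K := (n2 + d)%N.
have K0 : (0 < K)%N by rewrite addn_gt0 n2_gt0.
set v := radial_lap d C n2 K.-1.
set w := euler_sub d C K.-1%:R v.
have [w1 w2 w3] := radial_lap_flux d_gt0 C_gt0 n2_gt0 : [/\ rad_ulog w = 0, rad_log w =
  0 & rad_u w != 0].
set w' := euler_sub d C K.-1.+1%:R w.
have [w'1 w'2] : rad_ulog w' = 0 /\ rad_log w' = 0.
  rewrite /w'; move: w w1 w2 {w3 w'} => z z1 z2.
  by rewrite /= z1 z2; split; ring.
exists (4 ^+ K.-1 * (2 * rad_u w)).
  by rewrite !mulf_neq0// expf_neq0.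
move=> i; set g := iter _ _ _.
pose f0 := lap_phi K.-1.
pose f1 x : R := 4 ^+ K.-1 * (2 * x 0 i * radial_fun d C K w x).
pose f2 x : R := 4 ^+ K.-1 * (2 * radial_fun d C K w x + 2 * x 0 i * (2 * x 0 i *
   radial_fun d C K.+1 w' x)).
have sK : K.-1.+1 = K by rewrite prednK.
have df0 x : 1 <= `|x| -> has_pd i f0 x (f1 x).
  move=> x1; have x0 : 0 < `|x| by lra.
  have := radial_fun_pd d_gt0 C_gt0 i K.-1 v x0; rewrite sK => h.
  by apply: (has_deriv_eq (has_pdM (has_pd_cst i (4 ^+ K.-1) x) h)); rewrite /f1; ring.
have df1 x : 1 <= `|x| -> has_pd i f1 x (f2 x).
  move=> x1; have x0 : 0 < `|x| by lra.
  have := radial_fun_pd2 i K.-1 v x0; rewrite -/w -/w' sK => h.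
  by apply: (has_deriv_eq (has_pdM (has_pd_cst i (4 ^+ K.-1) x) h)); rewrite /f2; ring.
have rfb a b (z : radial) : rad_ulog z = 0 -> rad_log z = 0 ->
    exists2 B, 0 <= B & forall x, 1 <= `|x| ->
      `|radial_fun d C (a + b + d) z x| <= B / nsq x ^+ a / `|x| ^+ (2 * b).
  move=> z1 z2; have [B B0 hB] := radial_eval_bound_nolog d C_gt0 z1 z2.
  exists B => // x x1; have x0 : 0 < `|x| by lra.
  have s0 := nsq_gt0 x0; have sn0 := lt0r_neq0 s0.
  rewrite /radial_fun /radial_pow normrM ger0_norm ?invr_ge0 ?exprn_ge0 ?nsq_ge0//.
  have [_ k1] := nsq_pow_bound b x1.
  apply: le_trans (ler_wpM2l _ (hB _ (nsq_ge1 x1))) _.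
    by rewrite invr_ge0 exprn_ge0 ?nsq_ge0.
  rewrite [leLHS](_ : _ = B / nsq x ^+ a * nsq x ^- b); last first.
    rewrite !exprD; field; by rewrite !expf_neq0.
  by rewrite ler_wpM2l// divr_ge0// exprn_ge0// nsq_ge0.
have df2 : decays n f2.
  apply: decaysZ; apply: decaysD.
    have [B B0 hB] := rfb 0%N n2 w w1 w2.
    apply: decaysZ; apply: (decays_of_bound B0) => x x1.
    by have := hB x x1; rewrite add0n -/K expr0 divr1 -n_eq.
  have [B B0 hB] := rfb 1%N n2 w' w'1 w'2.
  apply: (@decays_of_bound _ _ _ _ (4 * B)); first by rewrite mulr_ge0.
  move=> x x1; have := hB x x1; rewrite add1n addSn -/K -n_eq expr1 => h.
  have x0 : 0 < `|x| by lra.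
  have s0 := nsq_gt0 x0.
  have xi : `|x 0 i| ^+ 2 <= nsq x.
    apply: le_trans (normr_sqr_le_nsq x).
    by rewrite lerXn2r ?nnegrE// normr_coord_le.
  rewrite (_ : 2 * _ * _ = 4 * x 0 i ^+ 2 * radial_fun d C K.+1 w' x); last by ring.
  rewrite 2!normrM normrX (ger0_norm (ler0n _ 4)) -!(mulrA 4) ler_wpM2l//.
  apply: le_trans (ler_pM _ _ xi h) _ => //.
  rewrite le_eqVlt; apply/orP; left; apply/eqP; field.
  by rewrite !lt0r_neq0// exprn_gt0.
have taylor2 (l : nat) : decays n (fun x => f0 (x + l%:R *: basis_vec i) - (f0 x + f1 x
  * l%:R)).
  pose F k := if k is k'.+1 then (if k' is _.+1 then f2 else f1) else f0.
  have := @decays_line _ _ i 2 F l%:R 1 n (ler0n _ _) _ df2.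
  move=> h; apply: eq_decays (h _) => [x|[|[|//]] x _ /=]; last 2 first.
  - exact: df0.
  - exact: df1.
  by rewrite !big_ord_recr big_ord0 /= add0r expr0 expr1 !divr1 mulr1.
have flux1 : decays n (fun x => diff1 i f0 x - f1 x).
  have h : decays n (fun x => \sum_(b < N) nu b * \sum_(l < b)
      (f0 (x + l%:R *: basis_vec i) - (f0 x + f1 x * l%:R))).
    by apply: decays_sum => b; apply: decaysZ; apply: decays_sum => l.
  apply: eq_decays h => x.
  rewrite /diff1 -[in RHS](weights_flux (f0 x) (f1 x)) -sumrB.
  by apply: eq_bigr => b _; rewrite sumrB mulrBr.
have flux2 : decays n (fun x => f1 x - 4 ^+ K.-1 * (2 * rad_u w) * (x 0 i * nsq x ^- n2)).
  pose z := Radial 0 0 0 (rad_poly w + (rad_u w * C)%:P).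
  have [B B0 hB] := poly_bound01 (rad_poly w + (rad_u w * C)%:P).
  apply: (@decays_eq_far _ (fun x => 4 ^+ K.-1 * (2 * (x 0 i * (nsq x ^- K * (rad_poly
    z).[C / radial_u d C (nsq x)]))))).
    move=> x x1; have x0 : 0 < `|x| by lra.
    have sn0 := lt0r_neq0 (nsq_gt0 x0).
    rewrite /f1 /radial_fun /radial_pow /radial_eval w1 w2 /= hornerD hornerC /K exprD.
    have -> : radial_u d C (nsq x) = C + nsq x ^+ d by [].
    field; by rewrite !expf_neq0.
  apply: decaysZ; apply: decaysZ; apply: (decays_of_bound B0) => x x1.
  have x0 : 0 < `|x| by lra.
  have [_ k1] := nsq_pow_bound K x1.
  rewrite !normrM (ger0_norm (_ : 0 <= nsq x ^- K)) ?invr_ge0 ?exprn_ge0 ?nsq_ge0//.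
  have hb : `|(rad_poly z).[C / radial_u d C (nsq x)]| <= B.
    by apply: hB; apply: radial_w_itv => //; exact: nsq_ge0.
  apply: le_trans (ler_pM _ _ (normr_coord_le x i) (ler_pM _ _ k1 hb)) _ => //.
    by rewrite mulr_ge0// invr_ge0 exprn_ge0// nsq_ge0.
    by rewrite invr_ge0 exprn_ge0// nsq_ge0.
  rewrite mulrA mulrC ler_wpM2l// ler_pdivrMr ?exprn_gt0// ler_pdivlMl ?exprn_gt0//.
  rewrite -exprSr ler_weXn2l// /K; lia.
have err : decays n (diff1 i (fun x => g x - f0 x)).
  exact: decays_stencil (is_stencil_diff1 i) (iter_dlap_lap_phi K.-1 hN).
apply: eq_decays (decaysD err (decaysD flux1 flux2)) => x.
have e : (fun y => g y - f0 y) = (fun y => -1 * f0 y + g y).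
  by apply/funext => y; ring.
by rewrite e (is_stencil_linear (is_stencil_diff1 i)); ring.
Qed.

End OnRadial.
End DiscreteLaplacian.

(** * Periodic sums of decaying functions *)

Section PeriodicSums.
Context {R : realType} {n : nat}.
Implicit Types (f g p : 'rV[R]_n -> R) (x y a : 'rV[R]_n) (i : 'I_n).

Definition locally_bounded f := forall r : R, exists2 B, 0 <= B & forall x, `|x| <= r ->
  `|f x| <= B.

Lemma eq_locally_bounded f g : f =1 g -> locally_bounded f -> locally_bounded g.
Proof. by move=> e; rewrite (funext e). Qed.

Lemma locally_boundedD f g : locally_bounded f -> locally_bounded g ->
  locally_bounded (fun x => f x + g x).
Proof.
move=> hf hg r; have [B B0 hB] := hf r; have [B' B'0 hB'] := hg r.
exists (B + B'); first exact: addr_ge0.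
by move=> x xr; rewrite (le_trans (ler_normD _ _))// lerD ?hB ?hB'.
Qed.

Lemma locally_boundedM f g : locally_bounded f -> locally_bounded g ->
  locally_bounded (fun x => f x * g x).
Proof.
move=> hf hg r; have [B B0 hB] := hf r; have [B' B'0 hB'] := hg r.
exists (B * B'); first exact: mulr_ge0.
by move=> x xr; rewrite normrM ler_pM ?hB ?hB'.
Qed.

Lemma locally_bounded_cst c : locally_bounded (fun _ => c).
Proof. by move=> r; exists `|c|. Qed.

Lemma locally_bounded_shift f a : locally_bounded f ->
  locally_bounded (fun x => f (x + a)).
Proof.
move=> hf r; have [B B0 hB] := hf (r + `|a|); exists B => // x xr.
by apply: hB; rewrite (le_trans (ler_normD _ _))// lerD2r.
Qed.

Lemma locally_bounded_stencil A f : is_stencil A -> locally_bounded f ->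
  locally_bounded (A f).
Proof.
move=> [s hs] hf; apply: (@eq_locally_bounded (stencil s f)); first by move=> x; rewrite hs.
rewrite /stencil; elim: s {hs} => [|t s ih].
  by apply: eq_locally_bounded (locally_bounded_cst 0) => x; rewrite big_nil.
apply: eq_locally_bounded (locally_boundedD (locally_boundedM (locally_bounded_cst t.1)
   (locally_bounded_shift (lattice_pt t.2) hf)) ih) => x.
by rewrite big_cons.
Qed.

Lemma locally_bounded_poly m p : poly_lt m p -> locally_bounded p.
Proof.
move=> /poly_lt_bound[C C0 hC] r; exists (C * (1 + `|r|) ^+ m.-1).
  by rewrite mulr_ge0// exprn_ge0// addr_ge0.
move=> x xr; apply: le_trans (hC x) _; rewrite ler_wpM2l// lerXn2r ?nnegrE ?addr_ge0//.
by rewrite lerD2l (le_trans xr)// ler_norm.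
Qed.

(** The global counterpart of [decays], which also controls the function near the origin. *)
Definition power_decay k f := exists2 C : R, 0 <= C & forall x, `|f x| <= C * (1 + `|x|)
  ^- k.

Lemma eq_power_decay k f g : f =1 g -> power_decay k f -> power_decay k g.
Proof. by move=> e; rewrite (funext e). Qed.

Lemma power_decayP k f : locally_bounded f -> decays k f -> power_decay k f.
Proof.
move=> lf [B [r [B0 r1 hB]]]; have [B' B'0 hB'] := lf r.
have pos1 : 0 <= B * 2 ^+ k by rewrite mulr_ge0// exprn_ge0.
have pos2 : 0 <= B' * (1 + r) ^+ k by rewrite mulr_ge0// exprn_ge0// addr_ge0//; lra.
exists (B * 2 ^+ k + B' * (1 + r) ^+ k); first exact: addr_ge0.
move=> x; have x0 : 0 <= `|x| by [].
have x1 : 0 < 1 + `|x| by lra.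
rewrite ler_pdivlMr ?exprn_gt0//.
case: (leP `|x| r) => xr.
  have : `|f x| * (1 + `|x|) ^+ k <= B' * (1 + r) ^+ k.
    apply: ler_pM => //; [exact: hB'|].
    by rewrite lerXn2r ?nnegrE//; lra.
  lra.
have h := hB x (ltW xr); have xp : 0 < `|x| by lra.
have : `|f x| * (1 + `|x|) ^+ k <= B * 2 ^+ k.
  apply: le_trans (ler_wpM2r _ h) _; first by rewrite exprn_ge0//; lra.
  rewrite -mulrA ler_wpM2l// ler_pdivrMl ?exprn_gt0// -exprMn.
  by rewrite lerXn2r ?nnegrE//; lra.
lra.
Qed.

Lemma power_decayD k f g : power_decay k f -> power_decay k g ->
  power_decay k (fun x => f x + g x).
Proof.
move=> [B B0 hB] [B' B'0 hB']; exists (B + B'); first exact: addr_ge0.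
by move=> x; rewrite mulrDl (le_trans (ler_normD _ _))// lerD.
Qed.

Lemma power_decayZ k c f : power_decay k f -> power_decay k (fun x => c * f x).
Proof.
move=> [B B0 hB]; exists (`|c| * B); first exact: mulr_ge0.
by move=> x; rewrite normrM -mulrA ler_wpM2l.
Qed.

Lemma power_decay_shift k f a : power_decay k f -> power_decay k (fun x => f (x + a)).
Proof.
move=> [B B0 hB]; exists (B * (1 + `|a|) ^+ k).
  by rewrite mulr_ge0// exprn_ge0// addr_ge0.
move=> x; apply: le_trans (hB _) _; rewrite -mulrA ler_wpM2l//.
have p1 : 0 < 1 + `|x + a| by rewrite ltr_pwDl.
have p2 : 0 < 1 + `|x| by rewrite ltr_pwDl.
rewrite ler_pdivlMr ?exprn_gt0// ler_pdivrMl ?exprn_gt0// -exprMn.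
rewrite lerXn2r ?nnegrE ?mulr_ge0 ?addr_ge0// ?(ltW p1)//.
have := ler_normB (x + a) a; rewrite addrK => h.
have h2 : 0 <= `|x + a| * `|a| by rewrite mulr_ge0.
have := normr_ge0 a; lra.
Qed.

Lemma power_decay_sum k (I : Type) (s : seq I) (F : I -> 'rV[R]_n -> R) :
  (forall j, power_decay k (F j)) -> power_decay k (fun x => \sum_(j <- s) F j x).
Proof.
move=> h; elim: s => [|j s ih].
  exists 0 => // x; by rewrite big_nil normr0 mul0r.
by apply: eq_power_decay (power_decayD (h j) ih) => x; rewrite big_cons.
Qed.

Lemma power_decay_stencil k A f : is_stencil A -> power_decay k f -> power_decay k (A f).
Proof.
move=> [s hs] hf.
apply: (@eq_power_decay k (fun x => \sum_(t <- s) t.1 * f (x + lattice_pt t.2))).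
  by move=> x; rewrite hs.
by apply: power_decay_sum => t; exact/power_decayZ/power_decay_shift.
Qed.

Lemma power_decay_poly k m q f : poly_lt m q -> power_decay (k + m.-1) f ->
  power_decay k (fun x => q x * f x).
Proof.
move=> /poly_lt_bound[C C0 hC] [B B0 hB]; exists (C * B); first exact: mulr_ge0.
move=> x; have p : 0 < 1 + `|x| by rewrite ltr_pwDl.
rewrite normrM (le_trans (ler_pM _ _ (hC x) (hB x)))//.
rewrite exprD le_eqVlt; apply/orP; left; apply/eqP; field.
by rewrite !expf_neq0// lt0r_neq0.
Qed.

Definition periodic_sum f x : R := lattice_sum (fun j => f (x - lattice_pt j)).

Lemma periodic_sums_le f : power_decay n.+1 f ->
  exists2 C : R, 0 <= C & forall x, sums_le (fun j => f (x - lattice_pt j)) C.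
Proof.
move=> [B B0 hB]; exists (8 ^+ n * (B * 2)).
  by rewrite mulr_ge0 ?exprn_ge0// mulr_ge0.
move=> x; apply: (@sums_le_pow _ _ x) => // j.
Qed.

Lemma periodic_sumP f x : power_decay n.+1 f ->
  has_sum (fun j => f (x - lattice_pt j)) (periodic_sum f x).
Proof. by move=> /periodic_sums_le[C _ /(_ x)/lattice_sumP[]]. Qed.

Lemma periodic_sum_bounded f : power_decay n.+1 f ->
  exists C : R, forall x, `|periodic_sum f x| <= C.
Proof.
move=> hf; have [C C0 hC] := periodic_sums_le hf; exists C => x.
exact: has_sum_norm_le (periodic_sumP x hf) (hC x).
Qed.

Lemma periodic_sum_has_sum f x l : power_decay n.+1 f ->
  has_sum (fun j => f (x - lattice_pt j)) l -> periodic_sum f x = l.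
Proof. by move=> hf; apply: has_sum_unique; exact: periodic_sumP. Qed.

Lemma periodic_sum_linear c f g x : power_decay n.+1 f -> power_decay n.+1 g ->
  periodic_sum (fun y => c * f y + g y) x = c * periodic_sum f x + periodic_sum g x.
Proof.
move=> hf hg; apply: periodic_sum_has_sum.
  by apply: power_decayD => //; exact: power_decayZ.
by apply: has_sumD; [apply: has_sumZ|]; exact: periodic_sumP.
Qed.

Lemma periodic_sum_shift f a x : periodic_sum (fun y => f (y + a)) x = periodic_sum f (x
  + a).
Proof. by congr lattice_sum; apply/funext => j; rewrite addrAC. Qed.

Lemma periodic_sum_lattice f x (b : 'rV[int]_n) : power_decay n.+1 f ->
  periodic_sum f (x + lattice_pt b) = periodic_sum f x.
Proof.
move=> hf; apply: (periodic_sum_has_sum hf).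
have := has_sum_bij (addrNK b) (addrK b) (periodic_sumP x hf).
apply: eq_has_sum => j; congr f.
by rewrite lattice_ptB opprB [lattice_pt b - _]addrC addrA addrAC.
Qed.

Lemma periodic_sum_sum (I : Type) (s : seq I) (c : I -> R) (F : I -> 'rV[R]_n -> R) x :
  (forall j, power_decay n.+1 (F j)) ->
  periodic_sum (fun y => \sum_(j <- s) c j * F j y) x = \sum_(j <- s) c j * periodic_sum
    (F j) x.
Proof.
move=> h; apply: periodic_sum_has_sum.
  by apply: power_decay_sum => j; exact: power_decayZ.
by apply: has_sum_bigsum => j; apply: has_sumZ; exact: periodic_sumP.
Qed.

End PeriodicSums.

(** * Differences with a real step *)

Section RealSteps.
Context {R : realType} {n : nat}.
Implicit Types (f g p : 'rV[R]_n -> R) (x y a : 'rV[R]_n).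
Variables (i : 'I_n) (t : R).

Definition step_diff f x : R := f (x + t *: basis_vec i) - f x.

Lemma iter_step_diff_shift m f a :
  iter m step_diff (fun y => f (y + a)) = fun y => iter m step_diff f (y + a).
Proof.
elim: m => [//|m ih] /=; rewrite ih; apply/funext => y.
by rewrite /step_diff addrAC.
Qed.

Lemma iter_step_diff_sum m (I : Type) (s : seq I) (c : I -> R) (F : I -> 'rV[R]_n -> R) :
  iter m step_diff (fun y => \sum_(j <- s) c j * F j y) =
  fun y => \sum_(j <- s) c j * iter m step_diff (F j) y.
Proof.
elim: m => [//|m ih] /=; rewrite ih; apply/funext => y.
by rewrite /step_diff -sumrB; apply: eq_bigr => j _; rewrite mulrBr.
Qed.

Lemma iter_step_diff_power_decay m k f : power_decay k f ->
  power_decay k (iter m step_diff f).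
Proof.
move=> hf; elim: m => [//|m ih] /=.
apply: eq_power_decay (power_decayD (power_decay_shift (t *: basis_vec i) ih)
  (power_decayZ (-1) ih)) => x.
by rewrite mulN1r.
Qed.

Lemma iter_step_diff_locally_bounded m f : locally_bounded f ->
  locally_bounded (iter m step_diff f).
Proof.
move=> hf; elim: m => [//|m ih] /=.
apply: eq_locally_bounded (locally_boundedD (locally_bounded_shift (t *: basis_vec i) ih)
  (locally_boundedM (locally_bounded_cst (-1)) ih)) => x.
by rewrite mulN1r.
Qed.

Lemma periodic_sum_iter_step_diff m f : power_decay n.+1 f ->
  periodic_sum (iter m step_diff f) = iter m step_diff (periodic_sum f).
Proof.
move=> hf; elim: m => [//|m ih] /=; rewrite -ih; apply/funext => x.
have hm := iter_step_diff_power_decay m hf.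
rewrite /step_diff -periodic_sum_shift.
have := periodic_sum_linear (-1) x hm (power_decay_shift (t *: basis_vec i) hm).
rewrite mulN1r addrC => <-; congr (periodic_sum _ x).
by apply/funext => y; rewrite mulN1r addrC.
Qed.

Hypothesis t_ge0 : 0 <= t.

Lemma iter_step_diff_pd m f f' (r : R) :
  (forall x, r < `|x| -> has_pd i f x (f' x)) ->
  forall x, r + m%:R * t < `|x| ->
    has_pd i (iter m step_diff f) x (iter m step_diff f' x).
Proof.
move=> h; elim: m => [|m ih] x.
  by rewrite mul0r addr0; exact: h.
rewrite -natr1 mulrDl mul1r addrA => hx /=.
have hx1 : r + m%:R * t < `|x| by apply: le_lt_trans hx; rewrite lerDl.
have hx2 : r + m%:R * t < `|x + t *: basis_vec i|.
  move: (r + m%:R * t) hx {ih hx1} => z hx.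
  have := norm_scale_basis_vec t i; rewrite (ger0_norm t_ge0) => h1.
  have := ler_normB (x + t *: basis_vec i) (t *: basis_vec i); rewrite addrK; lra.
have d1 := ih _ hx1; have d2 := ih _ hx2.
have d3 : has_pd i (fun y => iter m step_diff f (y + t *: basis_vec i)) x
   (iter m step_diff f' (x + t *: basis_vec i)).
  by move: d2; rewrite /has_pd; congr has_deriv; apply/funext => s; rewrite addrAC.
have := has_pdD d3 (has_pdM (has_pd_cst i (-1) x) d1).
rewrite /has_pd => h3; rewrite (_ : (fun s => _) = (fun s : R =>
  iter m step_diff f (x + s *: basis_vec i + t *: basis_vec i) +
   -1 * iter m step_diff f (x + s *: basis_vec i))).
  by apply: (has_deriv_eq h3); rewrite /step_diff; ring.
by apply/funext => s; rewrite /step_diff mulN1r.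
Qed.

(** If the second difference of g vanishes, then g(x + kt) is affine in k, and constant if g
    is bounded.  So the order of a vanishing difference can be lowered down to one. *)
Lemma bounded_step_diff m f (B : R) : (forall x, `|f x| <= B) ->
  (forall x, iter m.+1 step_diff f x = 0) -> forall x, f (x + t *: basis_vec i) = f x.
Proof.
move=> fB; elim: m => [|m ih] h x.
  by apply/eqP; rewrite -subr_eq0; apply/eqP; exact: h.
apply: ih => {}x; set g := iter m step_diff f.
have [B' gB] : exists B', forall y, `|g y| <= B'.
  rewrite /g; elim: m {h g} => [|m [B' hB']]; first by exists B.
  exists (B' + B') => y /=; rewrite /step_diff (le_trans (ler_normB _ _))// lerD//.
rewrite /= -/g; set c := step_diff g x.
have gk (k : nat) : g (x + k%:R *: (t *: basis_vec i)) = g x + k%:R * c /\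
    step_diff g (x + k%:R *: (t *: basis_vec i)) = c.
  elim: k => [|k [ih1 ih2]]; first by rewrite scale0r !addr0 mul0r addr0.
  have e : x + k.+1%:R *: (t *: basis_vec i) =
      x + k%:R *: (t *: basis_vec i) + t *: basis_vec i.
    by rewrite -natr1 scalerDl scale1r addrA.
  split.
    rewrite e -natr1 mulrDl mul1r addrA -ih1 -[in RHS]ih2 /step_diff; ring.
  rewrite e -[RHS]ih2; apply/eqP; rewrite -subr_eq0; apply/eqP.
  exact: (h (x + k%:R *: (t *: basis_vec i))).
apply/eqP; apply/negPn/negP => c0.
have c0' : 0 < `|c| by rewrite normr_gt0.
have B'0 : 0 <= B' by apply: le_trans (gB 0).
have q0 : 0 <= (B' + B') / `|c| by rewrite divr_ge0// addr_ge0.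
have := truncnS_gt ((B' + B') / `|c|); rewrite ltr_pdivrMr//.
set k := (Num.truncn _).+1 => hk.
have [e _] := gk k.
have : k%:R * c = g (x + k%:R *: (t *: basis_vec i)) - g x by rewrite e; ring.
move=> /(congr1 Num.norm); rewrite normrM normr_nat => e2.
have := le_trans (ler_normB _ _) (lerD (gB (x + k%:R *: (t *: basis_vec i))) (gB x)).
by rewrite -e2 leNgt hk.
Qed.

Section OnSymbols.
Variables (d : nat) (C : R).
Hypotheses (d_gt0 : (0 < d)%N) (C_gt0 : 0 < C).

(** By the mean value theorem each difference may be traded for a derivative at a nearby
    point. *)
Lemma iter_step_diff_symbol A k m q f : symbol d C A k f ->
  (A + 4 * d + q <= k + m)%N -> decays q (iter m step_diff f).
Proof.
elim: m k f => [|m ih] k f hf hq.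
  by apply: (symbol_decays d_gt0 C_gt0 hf); rewrite addn0 in hq.
have [f' hf' df] := symbol_pd d_gt0 C_gt0 i hf.
have df' : forall x, 0 < `|x| -> has_pd i f x (f' x) by [].
have dm := iter_step_diff_pd (m := m) df'.
have hm : decays q (iter m step_diff f') by apply: ih hf' _; rewrite addSnnS.
apply: (decays_near (a := t) t_ge0 _ (decaysZ t hm)).
exists (1 + m%:R * t + t) => x hx.
have [|c /andP[c0 ct]] := @mean_value _ (fun s => iter m step_diff f (x + s *: basis_vec i))
   (fun s => iter m step_diff f' (x + s *: basis_vec i)) t t_ge0.
  move=> s /andP[s0 st]; apply/has_pd_line/dm.
  have := norm_scale_basis_vec s i; rewrite (ger0_norm s0) => h1.
  have := ler_normB (x + s *: basis_vec i) (s *: basis_vec i); rewrite addrK; lra.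
rewrite scale0r addr0 => e; exists (x + c *: basis_vec i).
  rewrite opprD addrA subrr sub0r normrN (le_trans (norm_scale_basis_vec _ _))//.
  by rewrite ger0_norm.
by rewrite /= /step_diff e mulrC.
Qed.

End OnSymbols.
End RealSteps.

(** * Moments of the kernel *)

Section ConstantMoments.
Context {R : realType} {n : nat} (d : nat) (C : R) (M : nat).
Hypotheses (d_gt0 : (0 < d)%N) (C_gt0 : 0 < C).
Variables (A : ('rV[R]_n -> R) -> 'rV[R]_n -> R).
Hypothesis A_stencil : is_stencil A.
Hypothesis A_poly : forall q, poly_lt M q -> A q = fun _ => 0.
Let phi : 'rV[R]_n -> R := radial_fun d C 0 radial_phi.
Hypothesis phi_loc : locally_bounded phi.
Implicit Types (q : 'rV[R]_n -> R) (x y : 'rV[R]_n).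

(** Expand A phi into shifts and move the polynomial inside the shift b, where it becomes
    q(. - b).  The m-th differences of q(. - b) phi decay, so their periodic sums exist
    and are invariant under the shift b; undoing the expansion without the shifts leaves
    phi times the combination of the q(. - b), which A kills. *)
Lemma moment_step_diff q i t : 0 <= t -> poly_lt M q ->
  power_decay n.+1 (fun y => q y * A phi y) ->
  let m := (M + 4 * d + n.+1)%N in
  forall x, iter m (step_diff i t) (periodic_sum (fun y => q y * A phi y)) x = 0.
Proof.
move=> t0 hq hdec m x; have [s hs] := A_stencil.
pose qb (b : 'rV[int]_n) y := q (y - lattice_pt b).
have hqb b : poly_lt M (qb b) by exact: poly_lt_shift.
have kill y : \sum_(u <- s) u.1 * qb u.2 y = 0.
  have := A_poly (poly_lt_scale_shift (-1) 0 hq).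
  move=> /(congr1 (fun f => f (- y))); rewrite hs /stencil => e; rewrite -[RHS]e.
  apply: eq_bigr => u _; congr (_ * q _).
  by rewrite addr0 scaleN1r opprD opprK.
have e : (fun y => q y * A phi y) =
    fun y => \sum_(u <- s) u.1 * (qb u.2 (y + lattice_pt u.2) * phi (y + lattice_pt u.2)).
  apply/funext => y; rewrite hs /stencil mulr_sumr; apply: eq_bigr => u _.
  by rewrite /qb addrK mulrCA.
have dq b : power_decay n.+1 (iter m (step_diff i t) (fun y => qb b y * phi y)).
  apply: power_decayP.
    apply: iter_step_diff_locally_bounded; apply: locally_boundedM phi_loc.
    exact: locally_bounded_poly (hqb b).
  have sy : symbol d C M 0 (fun y => qb b y * phi y).
    apply: (@symbol_base _ _ _ _ _ _ M); last by lia.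
    exact: poly_lt_mono (leqnSn _) (hqb b).
  by apply: (iter_step_diff_symbol i t0 d_gt0 C_gt0 sy); rewrite /m; lia.
rewrite -periodic_sum_iter_step_diff// e iter_step_diff_sum.
rewrite (periodic_sum_sum (I := R * 'rV[int]_n) s (fun u => u.1)
   (F := fun u => iter m (step_diff i t) (fun y => qb u.2 (y + lattice_pt u.2) * phi (y
     + lattice_pt u.2)))); last first.
  move=> u; rewrite (iter_step_diff_shift _ _ _ (fun y => qb u.2 y * phi y)).
  exact: power_decay_shift.
have -> : \sum_(u <- s) u.1 * periodic_sum (iter m (step_diff i t)
     (fun y => qb u.2 (y + lattice_pt u.2) * phi (y + lattice_pt u.2))) x =
   \sum_(u <- s) u.1 * periodic_sum (iter m (step_diff i t) (fun y => qb u.2 y * phi y)) x.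
  apply: eq_bigr => u _; congr (_ * _).
  rewrite (iter_step_diff_shift _ _ _ (fun y => qb u.2 y * phi y)).
  by rewrite periodic_sum_shift periodic_sum_lattice.
rewrite -(periodic_sum_sum (I := R * 'rV[int]_n) s (fun u => u.1)
   (F := fun u => iter m (step_diff i t) (fun y => qb u.2 y * phi y)))//.
rewrite -iter_step_diff_sum.
have -> : (fun y => \sum_(u <- s) u.1 * (qb u.2 y * phi y)) =
    fun y => \sum_(u <- [::] : seq (R * 'rV[int]_n)) u.1 * (qb u.2 y * phi y).
  apply/funext => y; rewrite big_nil.
  by under eq_bigr do rewrite mulrA; rewrite -mulr_suml kill mul0r.
rewrite iter_step_diff_sum (periodic_sum_sum (I := R * 'rV[int]_n) [::] (fun u => u.1)
   (F := fun u => iter m (step_diff i t) (fun y => qb u.2 y * phi y)))//.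
by rewrite big_nil.
Qed.

(** No real step along a coordinate axis changes the periodic sum. *)
Lemma moment_const q x : poly_lt M q ->
  power_decay n.+1 (fun y => q y * A phi y) ->
  periodic_sum (fun y => q y * A phi y) x = periodic_sum (fun y => q y * A phi y) 0.
Proof.
move=> hq hdec; set G := periodic_sum _.
have [B hB] := periodic_sum_bounded hdec.
have step i t y : G (y + t *: basis_vec i) = G y.
  have pos s z : 0 <= s -> G (z + s *: basis_vec i) = G z.
    move=> s0; apply: (@bounded_step_diff _ _ i s (M + 4 * d + n) G B hB) => u.
    by have := moment_step_diff i s0 hq hdec u; rewrite addnS.
  case: (leP 0 t) => t0; first exact: pos.
  have := pos (- t) (y + t *: basis_vec i); rewrite scaleNr addrK => h.
  by rewrite h// oppr_ge0 ltW.
have h (s : seq 'I_n) : G (\sum_(i <- s) x 0 i *: basis_vec i) = G 0.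
  elim: s => [|i s ih]; first by rewrite big_nil.
  by rewrite big_cons addrC step.
by rewrite [x in LHS]row_sum_delta h.
Qed.

End ConstantMoments.

(** * Flux through the faces of a cube *)

Section BoxFlux.
Context {R : realType} {n : nat} (n2 : nat).
Hypotheses (n_eq : n = (2 * n2)%N) (n2_gt0 : (0 < n2)%N).
Variables (psi : 'rV[R]_n -> R) (h : 'I_n -> 'rV[R]_n -> R) (kappa : R).
Hypothesis kappa0 : kappa != 0.
Hypothesis psi_div : forall x, psi x = \sum_(i < n) (h i (x + basis_vec i) - h i x).
Hypothesis h_flux : forall i, decays n (fun x => h i x - kappa * (x 0 i * nsq x ^- n2)).

Local Notation box r := {ffun 'I_n -> 'I_(2 * r).+1}.

(** The 2r + 1 values of each coordinate parametrize the cube of radius r. *)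
Definition box_pt (r : nat) (F : {ffun 'I_n -> 'I_(2 * r).+1}) : 'rV[int]_n :=
  \row_k ((F k)%:Z - r%:Z).

Lemma box_pt_inj r : injective (@box_pt r).
Proof.
move=> F G /rowP e; apply/ffunP => k; have := e k; rewrite !mxE => /addIr [] /val_inj.
exact.
Qed.

(** Rotating one coordinate cyclically turns a sum of increments over the cube into a sum
    over a face: only the points where the rotation wraps around do not cancel
    ([box_face]). *)
Definition rotate_coord r i (F : {ffun 'I_n -> 'I_(2 * r).+1}) : {ffun 'I_n -> 'I_(2 *
  r).+1} :=
  [ffun k => if k == i then ordS (F k) else F k].

Lemma rotate_coord_inj r i : injective (@rotate_coord r i).
Proof.
move=> F G /ffunP e; apply/ffunP => k; have := e k; rewrite !ffunE.
by case: eqP => // _ /(can_inj (@ordSK _)).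
Qed.

Lemma box_face r i (f : 'rV[R]_n -> R) :
  \sum_F (f (lattice_pt (@box_pt r F) + basis_vec i) - f (lattice_pt (box_pt F))) =
  \sum_(F : box r | F i == ord_max) (f (lattice_pt (@box_pt r F) + basis_vec i) -
      f (lattice_pt (box_pt F) - (2 * r)%:R *: basis_vec i)).
Proof.
rewrite sumrB [X in _ - X](reindex_inj (@rotate_coord_inj r i)) -sumrB.
rewrite (bigID (fun F : box r => F i == ord_max)) /= [X in _ + X]big1 ?addr0.
  apply: eq_bigr => F /eqP Fi; congr (_ - f _).
  apply/rowP => k; rewrite !mxE ffunE eqxx /=; case: eqP => [->|_];
    last by rewrite mulr0 subr0.
  rewrite Fi mulr1 /= modnn mul2n -addnn !intrB PoszD intrD natrD /= -!pmulrn; ring.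
move=> F Fi; apply/eqP; rewrite subr_eq0; apply/eqP; congr f.
apply/rowP => k; rewrite !mxE ffunE eqxx /=; case: eqP => [ek|_]; last by rewrite addr0.
rewrite ek /= modn_small; last first.
  by rewrite ltnS ltn_neqAle -ltnS ltn_ord andbT; exact: Fi.
by rewrite !intrB intS intrD /=; ring.
Qed.

(** A point of the cube is determined by its projection to the face and its i-th
    coordinate. *)
Lemma card_face r i : ((2 * r).+1 ^ n.-1 <= #|[pred F : {ffun 'I_n -> 'I_(2 * r).+1} | F
  i == ord_max]|)%N.
Proof.
have n0 : (0 < n)%N by rewrite n_eq; lia.
have m0 : (0 < (2 * r).+1)%N by [].
rewrite -(leq_pmul2r m0) -expnSr prednK//.
pose g (F : {ffun 'I_n -> 'I_(2 * r).+1}) :=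
  ([ffun k => if k == i then ord_max else F k] : {ffun 'I_n -> 'I_(2 * r).+1}, F i).
have gi : injective g.
  move=> F G [] /ffunP e1 e2; apply/ffunP => k; have := e1 k; rewrite !ffunE.
  by case: eqP => [->|].
rewrite -{1}(card_ord n) -{1}(card_ord (2 * r).+1) -card_ffun -(card_codom gi).
pose P : pred (box r) := fun F => F i == ord_max.
rewrite (_ : #|[pred F : box r | F i == ord_max]| = #|P|); last by apply: eq_card.
have -> : (#|P| * (2 * r).+1 = #|[predX P & predT : pred 'I_(2 * r).+1]|)%N.
  by rewrite cardX card_ord.
apply: subset_leq_card; apply/fintype.subsetP => p /codomP[F ->].
by rewrite inE /= andbT unfold_in /P /= ffunE !eqxx.
Qed.

Lemma nsq_box_le r (y : 'rV[R]_n) : (0 < r)%N -> `|y| <= (2 * r)%:R ->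
  nsq y <= (4 * n)%:R * r%:R ^+ 2.
Proof.
move=> r0 yr; apply: le_trans (nsq_le_normr_sqr y) _.
have -> : (4 * n)%:R * r%:R ^+ 2 = n%:R * (2 * r%:R) ^+ 2 :> R by rewrite natrM; ring.
by rewrite ler_wpM2l// lerXn2r ?nnegrE ?mulr_ge0// -natrM.
Qed.

Lemma norm_box_le r (F : {ffun 'I_n -> 'I_(2 * r).+1}) k :
  `|(lattice_pt (box_pt F) : 'rV[R]_n) 0 k| <= r%:R.
Proof.
rewrite !mxE intrB /= -!pmulrn ler_norml.
have : ((F k : nat)%:R : R) <= (2 * r)%:R by rewrite ler_nat -ltnS.
by rewrite natrM; have := ler0n R (F k); move: (_%:R : R) => z; lra.
Qed.

(** On the opposite faces x_i = r + 1 and x_i = -r the field kappa x_i s^(-n/2) has opposite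
    signs, so both faces contribute to the flux with the sign of kappa. *)
Lemma face_flux_lower : exists2 c : R, 0 < c & exists r1 : nat, forall r i (F : box r),
  (r1 <= r)%N -> F i == ord_max ->
  c / r%:R ^+ n.-1 <= kappa * (h i (lattice_pt (@box_pt r F) + basis_vec i) -
      h i (lattice_pt (box_pt F) - (2 * r)%:R *: basis_vec i)).
Proof.
have n0 : (0 < n)%N by rewrite n_eq; lia.
have [B B0 [r0 hB]] : exists2 B : R, 0 <= B & exists r0 : R, forall i x, r0 <= `|x| ->
   `|h i x - kappa * (x 0 i * nsq x ^- n2)| <= B / `|x| ^+ n.
  have [B hB] := choice h_flux; have [r0 hr] := choice hB.
  exists (\sum_i B i); first by apply: sumr_ge0 => i _; have [] := hr i.
  exists (\sum_i r0 i) => i x xr.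
  have Bi j : 0 <= B j by have [] := hr j.
  have ri j : 0 <= r0 j by have [_ ? _] := hr j; lra.
  have [_ _ hx] := hr i; apply: le_trans (hx x _) _.
    by apply: le_trans xr; rewrite (bigD1 i)//= lerDl sumr_ge0.
  by rewrite ler_wpM2r ?invr_ge0 ?exprn_ge0// (bigD1 i)//= lerDl sumr_ge0.
pose D : R := (4 * n)%:R ^- n2.
have D0 : 0 < D by rewrite invr_gt0 exprn_gt0// ltr0n muln_gt0.
have k2 : 0 < kappa ^+ 2 by rewrite exprn_even_gt0//.
pose c := kappa ^+ 2 * D / 2.
have c0 : 0 < c by rewrite divr_gt0// mulr_gt0.
exists c => //.
pose E := `|kappa| * B * 2.
have E0 : 0 <= E by rewrite !mulr_ge0.
(* Beyond r1 the error, at most E / r^n in total, is at most half of the main term,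
   which is at least 2 c r / r^n. *)
have [r1 [r1a r1b r1c]] : exists r1 : nat, [/\ (0 < r1)%N, (Num.truncn (E / c)).+1 <= r1
  & (Num.truncn r0).+1 <= r1]%N.
  exists (Num.truncn (E / c) + Num.truncn r0 + 2)%N.
  by move: (Num.truncn _) (Num.truncn _) => a b; split; lia.
exists r1 => r i F rr1 Fi.
have r_gt0 : (0 < r)%N by exact: leq_trans rr1.
have rp : 0 < (r%:R : R) by rewrite ltr0n.
have rE : E <= r%:R * c.
  rewrite -ler_pdivrMr//; apply/ltW; apply: lt_le_trans (truncnS_gt _) _.
  by rewrite ler_nat; exact: leq_trans rr1.
have rr0 : r0 <= r%:R.
  apply/ltW; apply: lt_le_trans (truncnS_gt _) _.
  by rewrite ler_nat; exact: leq_trans rr1.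
set y1 := lattice_pt (box_pt F) + basis_vec i; set y2 := _ - _ *: _.
have y1i : y1 0 i = r%:R + 1.
  rewrite !mxE (eqP Fi) !eqxx /= intrB PoszM intrM /= mulr1n -!pmulrn; ring.
have y2i : y2 0 i = - r%:R.
  rewrite !mxE (eqP Fi) !eqxx /= intrB PoszM intrM natrM /= mulr1n mulr1 -!pmulrn; ring.
have yb k (y : 'rV[R]_n) : y = y1 \/ y = y2 -> `|y 0 k| <= (2 * r)%:R.
  have r1' : 1 <= (r%:R : R) by rewrite ler1n.
  rewrite natrM; have [->|ki] := eqVneq k i.
    case=> ->; rewrite ?y1i ?y2i ?normrN ger0_norm//; lra.
  have e z : (lattice_pt (box_pt F) + z *: basis_vec i : 'rV[R]_n) 0 k = lattice_pt
    (box_pt F) 0 k.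
    by rewrite mxE [X in _ + X]mxE [X in _ * X]mxE (negbTE ki) andbF mulr0 addr0.
  have hb := norm_box_le F k.
  case=> ->; first by rewrite /y1 -[basis_vec i]scale1r e; lra.
  by rewrite /y2 -scaleNr e; lra.
have ybn y : y = y1 \/ y = y2 -> `|y| <= (2 * r)%:R.
  by move=> hy; apply: normr_row_le => // k; exact: yb.
have yl y : y = y1 \/ y = y2 -> r%:R <= `|y|.
  case=> ->; apply: le_trans (normr_coord_le _ i); rewrite ?y1i ?y2i ?normrN
    ger0_norm//; lra.
have err y : y = y1 \/ y = y2 -> `|h i y - kappa * (y 0 i * nsq y ^- n2)| <= B / r%:R ^+ n.
  move=> hy; apply: le_trans (hB _ _ (le_trans rr0 (yl _ hy))) _.
  have yr := yl _ hy.
  by rewrite ler_wpM2l// lef_pV2 ?posrE ?exprn_gt0//; [rewrite lerXn2r ?nnegrE|lra].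
have e1 := err y1 (or_introl erefl); have e2 := err y2 (or_intror erefl).
have main y : y = y1 \/ y = y2 -> D / r%:R ^+ n <= nsq y ^- n2.
  move=> hy; have rn : r%:R ^+ n = (r%:R ^+ 2) ^+ n2 :> R by rewrite [in LHS]n_eq exprM.
  rewrite /D rn -invfM -exprMn lef_pV2 ?posrE.
  - rewrite lerXn2r ?nnegrE ?nsq_ge0 ?mulr_ge0 ?exprn_ge0//.
    exact: nsq_box_le r_gt0 (ybn _ hy).
  - by rewrite exprn_gt0// mulr_gt0 ?exprn_gt0// ltr0n muln_gt0.
  - by rewrite exprn_gt0// nsq_gt0// (lt_le_trans rp)// yl.
have m1 := main y1 (or_introl erefl); have m2 := main y2 (or_intror erefl).
move: e1 e2; rewrite y1i y2i.
move: (h i y1) (h i y2) (nsq y1 ^- n2) (nsq y2 ^- n2) m1 m2 => H1 H2 N1 N2 m1 m2 e1 e2.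
set T := r%:R ^+ n in m1 m2 e1 e2.
have T0 : 0 < T by rewrite exprn_gt0.
have -> : c / r%:R ^+ n.-1 = r%:R * c / T.
  rewrite /T -[in X in _ = X](prednK n0) exprS; field.
  by rewrite (lt0r_neq0 rp) ?expf_neq0 ?(lt0r_neq0 rp).
have s1 : `|kappa * (H1 - kappa * ((r%:R + 1) * N1))| <= E / T / 2.
  rewrite normrM (_ : E / T / 2 = `|kappa| * (B / T)); first by rewrite ler_wpM2l.
  by rewrite /E; field; rewrite lt0r_neq0.
have s2 : `|kappa * (H2 - kappa * (- r%:R * N2))| <= E / T / 2.
  rewrite normrM (_ : E / T / 2 = `|kappa| * (B / T)); first by rewrite ler_wpM2l.
  by rewrite /E; field; rewrite lt0r_neq0.
have s3 : E / T <= r%:R * c / T by rewrite ler_wpM2r// invr_ge0 ltW.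
have DT : 0 <= D / T by rewrite divr_ge0// ltW.
have s4 : kappa ^+ 2 * (r%:R * (D / T)) <= kappa ^+ 2 * ((r%:R + 1) * N1).
  rewrite ler_pM2l// ler_pM ?(ltW rp)// lerDl ler01//.
have s5 : 0 <= kappa ^+ 2 * (r%:R * N2).
  by rewrite mulr_ge0 ?(ltW k2)// mulr_ge0 ?(ltW rp)// (le_trans DT).
have s6 : kappa ^+ 2 * (r%:R * (D / T)) = 2 * (r%:R * c / T).
  by rewrite /c; field; rewrite lt0r_neq0.
rewrite s6 in s4.
move: s1 s2; rewrite !ler_norml => /andP[s1 _] /andP[_ s2].
have -> : kappa * (H1 - H2) = kappa * (H1 - kappa * ((r%:R + 1) * N1)) -
   kappa * (H2 - kappa * (- r%:R * N2)) + kappa ^+ 2 * ((r%:R + 1) * N1)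
   + kappa ^+ 2 * (r%:R * N2) by ring.
move: (kappa * (H1 - _)) (kappa * (H2 - _)) (kappa ^+ 2 * ((r%:R + 1) * N1))
  (kappa ^+ 2 * (r%:R * N2)) s1 s2 s3 s4 s5 => a1 a2 a3 a4 s1 s2 s3 s4 s5.
lra.
Qed.

Lemma box_flux_lower : exists2 c : R, 0 < c & exists r1 : nat, forall r,
  (r1 <= r)%N -> c <= kappa * \sum_F psi (lattice_pt (@box_pt r F)).
Proof.
have n0 : (0 < n)%N by rewrite n_eq; lia.
have [c c0 [r1 hc]] := face_flux_lower.
exists c => //; exists (maxn r1 1) => r; rewrite geq_max => /andP[rr1 r_gt0].
have rp : 0 < (r%:R : R) by rewrite ltr0n.
rewrite (eq_bigr (fun F => \sum_(i < n) (h i (lattice_pt (@box_pt r F) + basis_vec i) -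
   h i (lattice_pt (box_pt F))))); last by move=> F _; rewrite psi_div.
rewrite exchange_big /= mulr_sumr.
(* All directions contribute with the same sign, so one of them suffices. *)
have face i : c <= kappa * \sum_F (h i (lattice_pt (@box_pt r F) + basis_vec i) -
   h i (lattice_pt (box_pt F))).
  rewrite box_face mulr_sumr.
  apply: (@le_trans _ _ (\sum_(F : {ffun 'I_n -> 'I_(2 * r).+1} | F i == ord_max) c /
    r%:R ^+ n.-1)).
    rewrite sumr_const -[leRHS]mulr_natr -mulrA ler_peMr ?(ltW c0)//.
    rewrite ler_pdivlMl ?exprn_gt0// mulr1 -natrX ler_nat.
    apply: leq_trans (card_face r i).
    case: (n.-1) => [//|k]; rewrite leq_exp2r//; lia.
  by apply: ler_sum => F Fi; exact: hc.
rewrite (bigD1 (Ordinal n0))//= -[c]addr0 lerD//.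
by apply: sumr_ge0 => i _; apply: le_trans (face i); exact: ltW.
Qed.

(** The sum over a cube is its flux through the faces, which times kappa stays above a
    positive constant; it can not converge to 0. *)
Lemma flux_sum_neq0 l : has_sum (fun j => psi (0 - lattice_pt j)) l -> l != 0.
Proof.
move=> hl; apply/eqP => l0; move: hl; rewrite l0 => hl.
have [c c0 [r1 hc]] := box_flux_lower.
have k0 : 0 < `|kappa| by rewrite normr_gt0.
have e0 : 0 < c / `|kappa| / 2 by rewrite !divr_gt0.
have [A hA] := hl _ e0.
pose r2 := \max_(j <- A) \max_(k < n) absz (j 0%R k).
have [r [rr1 rr2]] : exists r : nat, (r1 <= r /\ r2 <= r)%N.
  by exists (maxn r1 r2); rewrite leq_maxl leq_maxr.
pose bx := [fset (- box_pt F) | F : {ffun 'I_n -> 'I_(2 * r).+1}]%fset.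
have AB : (A `<=` bx)%fset.
  apply/fsubsetP => j jA.
  have jr k : (absz (j 0%R k) <= r)%N.
    apply: leq_trans rr2; rewrite /r2 (big_fsetD1 j)//=.
    by apply: leq_trans (leq_maxl _ _); exact: (leq_bigmax (F := fun k => absz (j 0%R k))).
  apply/imfsetP; exists [ffun k => inord (absz (r%:Z - j 0%R k)%R)]; first by [].
  apply/rowP => k; rewrite !mxE ffunE inordK; have := jr k; lia.
have := hA _ AB; rewrite subr0 big_imfset /=; last first.
  by move=> F G _ _ /oppr_inj; exact: box_pt_inj.
rewrite big_enum /=.
under eq_bigr do rewrite lattice_ptN sub0r opprK.
have := hc r rr1; set S := \sum_F _ => h1 h2.
have : c <= `|kappa| * `|S| by rewrite -normrM (le_trans h1)// ler_norm.
have : `|kappa| * `|S| <= `|kappa| * (c / `|kappa| / 2) by rewrite ler_wpM2l.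
rewrite (_ : `|kappa| * (c / `|kappa| / 2) = c / 2); first lra.
by field; rewrite lt0r_neq0.
Qed.

End BoxFlux.

(** * The reproducing kernel *)

Section Kernel.
Context {R : realType} {n : nat}.
Implicit Types (f g p q : 'rV[R]_n -> R) (x y : 'rV[R]_n).

Lemma power_decay_mono k k' f : (k' <= k)%N -> power_decay k f -> power_decay k' f.
Proof.
move=> kk [B B0 hB]; exists B => // x; apply: le_trans (hB x) _.
rewrite ler_wpM2l// lef_pV2 ?posrE ?exprn_gt0 ?ltr_pwDl//.
by rewrite ler_weXn2l// lerDl.
Qed.

Lemma rbf_radial d (c : R) : rbf d c = radial_fun d (c ^+ (2 * d)) 0 radial_phi :>
  ('rV[R]_n -> R).
Proof.
apply/funext => x; rewrite /rbf /radial_fun /radial_pow /radial_eval /= horner0 (exprM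
  (enorm x)).
by rewrite enorm_sqr /radial_u expr0 invr1 !mul1r !mul0r !addr0.
Qed.

Lemma radial_phi_locally_bounded d C : 0 < C ->
  locally_bounded (radial_fun d C 0 radial_phi : 'rV[R]_n -> R).
Proof.
move=> C0 r; pose U := C + (n%:R * `|r| ^+ 2) ^+ d.
have s0 : 0 <= n%:R * `|r| ^+ 2 by rewrite mulr_ge0 ?exprn_ge0.
have U0 : C <= U by rewrite lerDl exprn_ge0.
have U1 : 0 <= U by lra.
exists (U * (`|ln C| + `|ln U|)); first by apply: mulr_ge0 => //; exact: addr_ge0.
move=> x xr; rewrite /radial_fun /radial_pow /radial_eval /= horner0.
rewrite expr0 invr1 !mul1r !mul0r !addr0 normrM.
have u0 : C <= radial_u d C (nsq x) by rewrite lerDl exprn_ge0 ?nsq_ge0.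
have u1 : radial_u d C (nsq x) <= U.
  rewrite lerD2l lerXn2r ?nnegrE ?nsq_ge0// (le_trans (nsq_le_normr_sqr x))//.
  by rewrite ler_wpM2l// lerXn2r ?nnegrE// (le_trans xr)// ler_norm.
move: (radial_u _ _ _) u0 u1 => u u0 u1.
have up : 0 < u by lra.
apply: ler_pM => //; first by rewrite ger0_norm// ltW.
have l1 : ln C <= ln u by rewrite ler_ln ?posrE.
have l2 : ln u <= ln U by rewrite ler_ln ?posrE//; lra.
have := ler_norm (ln U); have := ler_norm (- ln C); rewrite normrN.
have := normr_ge0 (ln U); have := normr_ge0 (ln C).
by rewrite ler_norml => *; apply/andP; split; lra.
Qed.

Lemma is_stencil_apply s : is_stencil (stencil s : ('rV[R]_n -> R) -> _).
Proof. by exists s. Qed.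

(** Divided by the sum of its weights, the stencil is the identity minus an operator B that
    lowers the degree, so the Neumann series of B is finite on polynomials. *)
Lemma stencil_inverse (s : seq (R * 'rV[int]_n)) M :
  \sum_(t <- s) t.1 != 0 ->
  exists s' : seq (R * 'rV[int]_n), forall q, poly_lt M q -> stencil s' (stencil s q) = q.
Proof.
move=> l0; set l := \sum_(t <- s) t.1 in l0 *.
pose B f x : R := -1 * (l^-1 * stencil s f x) + f x.
have hB : is_stencil B.
  apply: is_stencilD; last exact: is_stencil_id.
  by do 2!apply: is_stencilZ; exact: is_stencil_apply.
have Blow m q : poly_lt m q -> poly_lt m.-1 (B q).
  move=> hq; apply: (@eq_poly_lt _ _ _ (fun x => \sum_(t <- s) (- l^-1 * t.1) *
      (q (x + lattice_pt t.2) - q x))); last first.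
    by apply: poly_lt_sum => t; exact/poly_ltZ/poly_lt_diff.
  move=> x; under eq_bigr do rewrite mulrBr.
  rewrite sumrB -mulr_suml -mulr_sumr -/l mulNr mulVf// mulN1r opprK /B mulN1r -mulNr.
  congr (_ + _); rewrite [RHS]mulr_sumr; apply: eq_bigr => t _.
  by rewrite [RHS]mulrA.
have Bk k m q : poly_lt m q -> poly_lt (m - k) (iter k B q).
  move=> hq; elim: k => [|k ih]; first by rewrite subn0.
  by rewrite subnS; exact: Blow.
have [s' hs'] : is_stencil (fun f x => l^-1 * \sum_(i < M) iter i B f x).
  apply: is_stencilZ; apply: is_stencil_sum => i; exact: is_stencil_iter.
exists s' => q hq; apply/funext => x; rewrite -hs'.
have e : stencil s q = fun y => l * (-1 * B q y + q y).
  by apply/funext => y; rewrite /B; field.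
have Bi i : iter i B (stencil s q) x = l * (- iter i.+1 B q x + iter i B q x).
  have hi := is_stencil_iter i hB.
  have [si hsi] := hi; rewrite hsi e /stencil.
  transitivity (l * (-1 * iter i B (B q) x + iter i B q x)).
    rewrite !hsi /stencil mulr_sumr -big_split /= mulr_sumr.
    by apply: eq_bigr => t _; ring.
  by rewrite mulN1r -iterSr.
under eq_bigr do rewrite Bi.
rewrite -mulr_sumr mulKf//.
have -> : forall m, \sum_(i < m) (- iter i.+1 B q x + iter i B q x) = q x - iter m B q x.
  elim=> [|m ih]; first by rewrite big_ord0 subrr.
  by rewrite big_ord_recr /= ih; ring.
by have := Bk M _ _ hq; rewrite subnn => /poly_lt_eq0 ->; rewrite subr0.
Qed.

(** The moments L of psi0 are given by a stencil evaluated at 0, by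
    [poly_functional_eval].  Applying to psi0 the reflection of an inverse of this stencil
    turns the moments of q into q(0). *)
Lemma reproducing_kernel (n2 d m0 q0 : nat) (C : R) :
  n = (2 * n2)%N -> (0 < n2)%N -> (0 < d)%N -> 0 < C ->
  (d * q0.+1 = n2 + m0)%N -> (d * q0 < n2)%N ->
  let phi : 'rV[R]_n -> R := radial_fun d C 0 radial_phi in
  exists s : seq (R * 'rV[int]_n),
    power_decay (2 * n + 2 * d + 2 * m0) (stencil s phi) /\
    forall q, poly_lt (n + 2 * d) q -> forall x,
      power_decay n.+1 (fun y => q y * stencil s phi y) /\
      has_sum (fun j => q (x - lattice_pt j) * stencil s phi (x - lattice_pt j)) (q 0).
Proof.
move=> n_eq n2_gt0 d_gt0 C_gt0 e1 e2 phi.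
pose P := (2 * n + 2 * d + 2 * m0)%N; pose M := (n + 2 * d)%N; pose K := (n2 + d)%N.
(* N bounds the degrees of the polynomials in play and makes the errors of the
   discrete Laplacian decay at least like psi0. *)
pose N := (4 * d + P + 3)%N.
have [nu nuP] := exists_second_diff_weights R N.
have N2 : (2 < N)%N by rewrite /N; lia.
pose D := @dlap R n N nu.
have hD : is_stencil D by exact: is_stencil_dlap.
have phiE : lap_phi d C n2 0 = phi.
  by apply/funext => x; rewrite /lap_phi expr0 mul1r.
pose psi0 := iter K D phi.
have hA : is_stencil (iter K D) by exact: is_stencil_iter.
have ploc := @radial_phi_locally_bounded d C C_gt0.
have psi0_dec : power_decay P psi0.
  apply: power_decayP; first exact: locally_bounded_stencil.
  by rewrite /psi0 -phiE; apply: (iter_dlap_decays N2 nuP d_gt0 C_gt0 n_eq n2_gt0 e1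
    e2); rewrite /N /P; lia.
have Akill q : poly_lt M q -> iter K D q = fun _ => 0.
  by move=> hq; apply: (iter_dlap_poly_eq0 N2 nuP hq); rewrite /N /P /M /K; lia.
have qdec q f : poly_lt M q -> power_decay P f -> power_decay n.+1 (fun y => q y * f y).
  move=> hq hf; apply: (power_decay_poly hq); apply: power_decay_mono hf.
  by rewrite /P /M; lia.
have one : poly_lt M (fun _ : 'rV[R]_n => 1).
  by rewrite /M (_ : n + 2 * d = (n + 2 * d).-1.+1)%N; [exact: poly_ltC|lia].
pose L q := periodic_sum (fun y => q y * psi0 y) 0.
have l0 : L (fun _ => 1) != 0.
  have hN : (4 * d + n <= N)%N by rewrite /N /P; lia.
  have [kappa kappa0 hk] := diff1_flux N2 nuP d_gt0 C_gt0 n_eq n2_gt0 hN.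
  apply: (flux_sum_neq0 n_eq n2_gt0 kappa0 _ hk (psi := psi0)).
    move=> x; rewrite /psi0 -phiE -{1}(prednK (_ : 0 < K)%N); last by rewrite /K; lia.
    rewrite iterS /D /dlap; apply: eq_bigr => i _.
    by rewrite (diff1_telescope N2 nuP).
  have := periodic_sumP 0 (qdec _ _ one psi0_dec).
  by apply: eq_has_sum => j; rewrite mul1r.
have [L' [s hs] hL'] : exists2 L', is_eval L' & forall q, poly_lt M q -> L q = L' q.
  apply: poly_functional_eval => k p q hp hq.
  rewrite /L -periodic_sum_linear; [|exact: qdec..].
  by congr (periodic_sum _ 0); apply/funext => y; ring.
have sl : \sum_(t <- s) t.1 != 0.
  move: l0; rewrite hL'// hs /stencil.
  by under eq_bigr do rewrite mulr1.
have [v hv] := stencil_inverse M sl.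
pose refl f x := \sum_(t <- v) t.1 * f (x - lattice_pt t.2) : R.
have hrefl : is_stencil refl.
  apply: is_stencil_sum => t; apply: is_stencilZ.
  have [s1 h1] := is_stencil_shift (R := R) (- t.2).
  by exists s1 => f x; rewrite -h1 lattice_ptN.
have [s' hs'] := is_stencil_comp hrefl hA.
exists s'.
have es : stencil s' phi = refl psi0 by apply/funext => x; rewrite -hs'.
rewrite es.
have rdec : power_decay P (refl psi0) by exact: power_decay_stencil.
split=> // q hq x.
have qd := qdec q _ hq rdec.
split=> //.
have := periodic_sumP x qd; rewrite (_ : periodic_sum _ x = q 0)//.
pose qb (b : 'rV[int]_n) y := q (y + lattice_pt b).
have hqb b : poly_lt M (qb b) by exact: poly_lt_shift.
have -> : (fun y => q y * refl psi0 y) =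
   fun y => \sum_(t <- v) t.1 * (qb t.2 (y - lattice_pt t.2) * psi0 (y - lattice_pt t.2)).
  apply/funext => y; rewrite /refl mulr_sumr; apply: eq_bigr => t _.
  by rewrite /qb subrK mulrCA.
have dq b : power_decay n.+1 (fun y => qb b y * psi0 y) by exact: qdec.
rewrite (periodic_sum_sum (I := R * 'rV[int]_n) v (fun t => t.1)
   (F := fun t y => qb t.2 (y - lattice_pt t.2) * psi0 (y - lattice_pt t.2))); last first.
  by move=> t; exact: (power_decay_shift (- lattice_pt t.2) (dq t.2)).
rewrite -[RHS](congr1 (fun f => f 0) (hv q hq)) [RHS]/stencil.
apply: eq_bigr => t _; congr (_ * _).
rewrite (periodic_sum_shift (fun y => qb t.2 y * psi0 y)) -lattice_ptN
  periodic_sum_lattice//.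
rewrite (moment_const d_gt0 C_gt0 hA Akill ploc x (hqb t.2) (dq t.2)).
rewrite -/(L (qb t.2)) hL'// hs.
exact: (is_stencil_comm_shift (lattice_pt t.2) (is_stencil_apply s) q 0).
Qed.

End Kernel.

(** * Taylor approximation of functions with bounded derivatives *)

Section MultivariateTaylor.
Context {R : realType} {n : nat}.
Implicit Types (f g p q : 'rV[R]_n -> R) (x y : 'rV[R]_n) (i : 'I_n).

Lemma derivable_has_pd i f x : derivable f x (delta_mx 0 i) ->
  has_pd i f x ('D_(delta_mx 0 i) f x).
Proof.
rewrite /has_pd /has_deriv; set g := fun t => _.
have e : (fun h : R => h^-1 *: ((f \o shift x) (h *: delta_mx 0 i) - f x)) =
    (fun h : R => h^-1 *: ((g \o shift 0) (h *: (1 : R)) - g 0)).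
  apply/funext => h; rewrite /g /= /basis_vec addr0 scale0r addr0 [h *: 1]mulr1.
  by rewrite [x + _]addrC.
rewrite /derivable /derive e => h.
by split.
Qed.

Lemma bounded_fun_le f : bounded_fun f -> exists2 B, 0 <= B & forall x, `|f x| <= B.
Proof.
move=> [B [_ hB]]; exists (`|B| + 1); first by rewrite addr_ge0.
by move=> x; apply: hB => //; have := ler_norm B; lra.
Qed.

Lemma line_taylor_signed i m (F : nat -> 'rV[R]_n -> R) x (T B : R) :
  (forall k x, (k < m)%N -> has_pd i (F k) x (F k.+1 x)) ->
  (forall x, `|F m x| <= B) ->
  `|F 0%N (x + T *: basis_vec i) - \sum_(k < m) F k x * T ^+ k / k`!%:R| <= B * `|T| ^+ m.
Proof.
move=> hF hB; case: (leP 0 T) => T0.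
  by rewrite (ger0_norm T0); apply: line_taylor => // k t km _; exact: hF.
have T0' : 0 <= - T by rewrite oppr_ge0 ltW.
rewrite (ltr0_norm T0).
have := @taylor_segment _ m (fun k t => (-1) ^+ k * F k (x + (- t) *: basis_vec i)) (-
  T) B T0'.
rewrite expr0 mul1r opprK oppr0 scale0r addr0.
rewrite (eq_bigr (fun k : 'I_m => F k x * T ^+ k / k`!%:R)); last first.
  move=> k _; have e : (-1) ^+ k * (-1) ^+ k = 1 :> R.
    by rewrite -exprMn mulrNN mulr1 expr1n.
  rewrite (exprNn T); move: ((-1) ^+ k) e => v e.
  by rewrite [LHS](_ : _ = v * v * (F k x * T ^+ k / k`!%:R)); [rewrite e mul1r|ring].
apply.
- move=> k t km _; have h1 : has_deriv (fun t : R => - t) t (-1).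
    have := has_derivZ (-1) (has_deriv_id t); rewrite mulr1.
    by rewrite /has_deriv; under [X in is_derive _ _ X]eq_fun do rewrite mulN1r.
  have h2 : has_deriv (fun t => F k (x + t *: basis_vec i)) (- t) (F k.+1 (x + - t *:
    basis_vec i)).
    by apply: has_pd_line; exact: hF.
  apply: (has_deriv_eq (has_derivZ ((-1) ^+ k) (has_deriv_comp h2 h1))).
  by rewrite exprS; ring.
- by move=> t _; rewrite normrM normrX normrN1 expr1n mul1r.
Qed.

Lemma poly_ltXn i k m p : poly_lt m p -> poly_lt (m + k) (fun y => y 0 i ^+ k * p y).
Proof.
move=> hp; elim: k => [|k ih].
  by rewrite addn0; apply: eq_poly_lt hp => y; rewrite expr0 mul1r.
by rewrite addnS; apply: eq_poly_lt (poly_ltX i ih) => y; rewrite exprS mulrA.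
Qed.

Definition coord_proj (l : seq 'I_n) y : 'rV[R]_n := \sum_(i <- l) y 0 i *: basis_vec i.

(** One coordinate after the other: the Taylor coefficients in the direction e_i are
    functions of the remaining coordinates, to which the induction applies. *)
Lemma taylor_coords M f (l : seq 'I_n) : Cn M f -> bounded_derivatives M f ->
  forall m s, (size s + m)%N = M ->
  exists2 C : R, 0 <= C & forall x, exists2 p, poly_lt m p & forall y,
    `|pderiv s f (x + coord_proj l y) - p y| <= C * `|y| ^+ m /\
    `|p y| <= C * (1 + `|y|) ^+ m.-1.
Proof.
move=> [fd _] fb; elim: l => [|i l ih] m s sm.
  have [B B0 hB] : exists2 B, 0 <= B & forall x, `|pderiv s f x| <= B.
    by apply: bounded_fun_le; apply: fb; rewrite -sm leq_addr.
  exists B => // x; case: m sm => [|m] sm.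
    exists (fun _ => 0); first exact: poly_lt0.
    by move=> y; rewrite subr0 normr0 /= !expr0 !mulr1; split; first exact: hB.
  exists (fun _ => pderiv s f x); first exact: poly_ltC.
  move=> y; rewrite /coord_proj big_nil addr0 subrr normr0; split.
    by rewrite mulr_ge0// exprn_ge0.
  by apply: le_trans (hB x) _; rewrite ler_peMr// exprn_ege1// lerDl.
pose F k := pderiv (nseq k i ++ s) f.
have hF k x : (k < m)%N -> has_pd i (F k) x (F k.+1 x).
  move=> km; apply: derivable_has_pd; apply: fd.
  by rewrite size_cat size_nseq; lia.
have [B B0 hB] : exists2 B, 0 <= B & forall x, `|F m x| <= B.
  by apply: bounded_fun_le; apply: fb; rewrite size_cat size_nseq; lia.
have ihk (k : 'I_m) : exists2 C : R, 0 <= C & forall x, exists2 p, poly_lt (m - k) p &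
  forall y,
    `|F k (x + coord_proj l y) - p y| <= C * `|y| ^+ (m - k) /\
    `|p y| <= C * (1 + `|y|) ^+ (m - k).-1.
  by apply: ih; rewrite size_cat size_nseq; have := ltn_ord k; lia.
have [C C0 hC] := fin_all_exists2 ihk.
exists (B + \sum_k C k); first by rewrite addr_ge0// sumr_ge0.
move=> x; have [p hp hpy] := fin_all_exists2 (fun k => hC k x).
exists (fun y => \sum_(k < m) y 0 i ^+ k * ((k`!%:R)^-1 * p k y)).
  apply: poly_lt_sum => k.
  apply: (@poly_lt_mono _ _ ((m - k) + k)); first by rewrite subnK// ltnW.
  by apply: poly_ltXn; exact: poly_ltZ.
have fk (k : nat) : (k`!%:R)^-1 <= 1 :> R.
  by rewrite invf_le1 ?ltr0n ?fact_gt0// ler1n fact_gt0.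
have fk0 (k : nat) : 0 <= (k`!%:R)^-1 :> R by rewrite invr_ge0.
move=> y; have yi := normr_coord_le y i; split; last first.
  apply: le_trans (ler_norm_sum _ _ _) _; rewrite mulrDl mulr_suml.
  rewrite -[leLHS]add0r lerD//; first by rewrite mulr_ge0// exprn_ge0// addr_ge0.
  apply: ler_sum => k _; have [_ h] := hpy k y.
  rewrite !normrM (ger0_norm (fk0 k)) normrX.
  have y1 : `|y 0 i| ^+ k <= (1 + `|y|) ^+ k.
    by rewrite lerXn2r ?nnegrE ?addr_ge0// (le_trans yi)// lerDr.
  have p1 : (k`!%:R)^-1 * `|p k y| <= C k * (1 + `|y|) ^+ (m - k).-1.
    by apply: le_trans h; rewrite ler_piMl.
  apply: le_trans (ler_pM _ _ y1 p1) _; rewrite ?exprn_ge0 ?mulr_ge0//.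
  rewrite mulrCA -exprD (_ : (k + (m - k).-1)%N = m.-1)//.
  by have := ltn_ord k; lia.
set z := x + coord_proj l y.
have -> : x + coord_proj (i :: l) y = z + y 0 i *: basis_vec i.
  by rewrite /coord_proj big_cons /z addrAC addrA.
have t := line_taylor_signed z (y 0 i) hF hB.
set S := \sum_(k < m) F k z * _ / _ in t.
have -> : pderiv s f (z + y 0 i *: basis_vec i) = F 0%N (z + y 0 i *: basis_vec i) by [].
set f0 := F 0%N _ in t *; set Q := \sum_(k < m) y 0 i ^+ k * _.
have -> : f0 - Q = (f0 - S) + (S - Q) by ring.
apply: le_trans (ler_normD _ _) _; rewrite mulrDl lerD//.
  by apply: le_trans t _; rewrite ler_wpM2l// lerXn2r ?nnegrE.
rewrite /S /Q -sumrB mulr_suml; apply: le_trans (ler_norm_sum _ _ _) _.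
apply: ler_sum => k _; have [h _] := hpy k y.
have -> : F k z * y 0 i ^+ k / k`!%:R - y 0 i ^+ k * ((k`!%:R)^-1 * p k y) =
   y 0 i ^+ k * ((k`!%:R)^-1 * (F k z - p k y)) by ring.
rewrite !normrM (ger0_norm (fk0 k)) normrX.
have y1 : `|y 0 i| ^+ k <= `|y| ^+ k by rewrite lerXn2r ?nnegrE.
have p1 : (k`!%:R)^-1 * `|F k z - p k y| <= C k * `|y| ^+ (m - k).
  by apply: le_trans h; rewrite ler_piMl.
apply: le_trans (ler_pM _ _ y1 p1) _; rewrite ?exprn_ge0 ?mulr_ge0//.
by rewrite mulrCA -exprD subnKC// ltnW.
Qed.

(** The first bound is used for small y; the second one grows more slowly and is used for
    large y. *)
Lemma taylor_approx M f : Cn M f -> bounded_derivatives M f ->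
  exists2 C : R, 0 <= C & forall x, exists2 p, poly_lt M p & forall y,
    `|f (x + y) - p y| <= C * `|y| ^+ M /\
    `|f (x + y) - p y| <= C * (1 + `|y|) ^+ M.-1.
Proof.
move=> hf fb; have [C C0 hC] := @taylor_coords M f (index_enum 'I_n) hf fb M [::] erefl.
have [B B0 hB] := bounded_fun_le (fb [::] (leq0n M)).
exists (C + B); first exact: addr_ge0.
move=> x; have [p hp h] := hC x; exists p => // y.
have [h1 h2] := h y.
have e : coord_proj (index_enum 'I_n) y = y by rewrite [RHS]row_sum_delta.
rewrite e /= in h1; split.
  by apply: le_trans h1 _; rewrite ler_wpM2r ?exprn_ge0// lerDl.
apply: le_trans (ler_normB _ _) _; rewrite mulrDl addrC lerD//.
by apply: le_trans (hB _) _; rewrite ler_peMr// exprn_ege1// lerDl.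
Qed.

(** Each monomial is a product of as many coordinates as its degree. *)
Lemma mpoly_poly_lt m (p : mpoly.mpoly n R) : tdeg_le m p -> poly_lt m.+1 (peval p).
Proof.
rewrite /tdeg_le => hp.
pose F (x : 'rV[R]_n) : R := \sum_(mm <- mpoly.msupp p)
    (mpoly.mcoeff mm p) * (\prod_(i < n) x 0 i ^+ (mpoly.fun_of_multinom mm i)).
have e : F =1 peval p by move=> x; rewrite /peval mpoly.mevalE.
apply: (eq_poly_lt e); rewrite /F.
have h : forall r : seq (mpoly.multinom n), {subset r <= mpoly.msupp p} ->
   poly_lt m.+1 (fun x => \sum_(mm <- r) (mpoly.mcoeff mm p) * (\prod_(i < n) x 0 i ^+
     (mpoly.fun_of_multinom mm i))).
  elim=> [_|mm r ih sub].
    by apply: eq_poly_lt (poly_lt0 _) => x; rewrite big_nil.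
  apply: (@eq_poly_lt _ _ _ (fun x => mpoly.mcoeff mm p * (\prod_(i < n) x 0 i ^+
    (mpoly.fun_of_multinom mm i)) +
     \sum_(mm <- r) (mpoly.mcoeff mm p) * (\prod_(i < n) x 0 i ^+ (mpoly.fun_of_multinom
       mm i)))).
    by move=> x; rewrite big_cons.
  apply: poly_ltD; last by apply: ih => u ur; apply: sub; rewrite inE ur orbT.
  apply: poly_ltZ.
  have dm : (mpoly.mdeg mm < m.+1)%N.
    by apply: leq_trans (mpoly.msize_mdeg_lt _) hp; apply: sub; exact: mem_head.
  apply: poly_lt_mono dm _; rewrite mpoly.mdegE.
  have : forall l : seq 'I_n, poly_lt (\sum_(i <- l) mpoly.fun_of_multinom mm i).+1
      (fun x => \prod_(i <- l) x 0 i ^+ mpoly.fun_of_multinom mm i).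
    elim=> [|i l ihl].
      by rewrite big_nil; apply: eq_poly_lt (poly_ltC 0 1) => x; rewrite big_nil.
    rewrite big_cons addnC -addSn.
    by apply: eq_poly_lt (poly_ltXn i (mpoly.fun_of_multinom mm i) ihl) => x;
      rewrite big_cons.
  exact.
exact: h.
Qed.

End MultivariateTaylor.

(** * Quasi-interpolation *)

Section StencilWeights.
Context {R : realType} {n : nat}.
Implicit Types (phi : 'rV[R]_n -> R) (x : 'rV[R]_n).

Lemma sums_leD (a b : 'rV[int]_n -> R) C C' : sums_le a C -> sums_le b C' ->
  sums_le (fun j => a j + b j) (C + C').
Proof.
move=> ha hb B; apply: le_trans (lerD (ha B) (hb B)); rewrite -big_split /=.
by apply: ler_sum => j _; exact: ler_normD.
Qed.

(** Entries of s with the same shift add up.  The sign turns the shifts x + b of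
    [stencil] into the shifts x - b of [quasi_lagrange]. *)
Definition stencil_weight (s : seq (R * 'rV[int]_n)) (b : 'rV[int]_n) : R :=
  \sum_(t <- s | - t.2 == b) t.1.

Lemma stencil_weight_sum s phi x :
  (exists C, sums_le (quasi_lagrange_term (stencil_weight s) phi x) C) /\
  has_sum (quasi_lagrange_term (stencil_weight s) phi x) (stencil s phi x).
Proof.
elim: s => [|t s [[C hC] hs]].
  have e : quasi_lagrange_term (stencil_weight [::]) phi x = fun _ => 0.
    by apply/funext => b; rewrite /quasi_lagrange_term /stencil_weight big_nil mul0r.
  rewrite e /stencil big_nil; split; last exact: has_sum0.
  by exists 0 => B; rewrite big1// => b _; rewrite normr0.
pose a (b : 'rV[int]_n) : R := (if - t.2 == b then t.1 else 0) * phi (x - lattice_pt b).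
have e : quasi_lagrange_term (stencil_weight (t :: s)) phi x =
    fun b => a b + quasi_lagrange_term (stencil_weight s) phi x b.
  apply/funext => b; rewrite /quasi_lagrange_term /stencil_weight big_cons /a.
  by case: ifP => _; ring.
have a0 (b : 'rV[int]_n) : b \notin [fset (- t.2)%R]%fset -> a b = 0.
  by rewrite inE eq_sym /a => /negbTE ->; rewrite mul0r.
rewrite e; split; first by eexists; exact: (sums_leD (sums_le_finsupp a0) hC).
have e2 : a (- t.2) = t.1 * phi (x + lattice_pt t.2).
  by rewrite /a eqxx lattice_ptN opprK.
have := has_sumD (has_sum_finsupp a0) hs.
by rewrite big_seq_fset1 e2 /stencil big_cons.
Qed.

Lemma quasi_lagrange_stencil s phi x :
  lattice_summable (quasi_lagrange_term (stencil_weight s) phi x) /\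
  quasi_lagrange (stencil_weight s) phi x = stencil s phi x.
Proof.
have [[C hC] hs] := stencil_weight_sum s phi x.
by split; [have [] := lattice_sumP hC|exact: has_sum_lattice_sum hC hs].
Qed.

End StencilWeights.

Section ConvergenceRate.
Context {R : realType} {n : nat}.
Variables (M m0 P : nat) (Psi : 'rV[R]_n -> R).
Hypotheses (M_gt0 : (0 < M)%N) (PE : P = (M + n + 2 * m0)%N).
Hypothesis Psi_dec : power_decay P Psi.
Hypothesis Psi_moment : forall q, poly_lt M q -> forall x,
  power_decay n.+1 (fun y => q y * Psi y) /\
  has_sum (fun j => q (x - lattice_pt j) * Psi (x - lattice_pt j)) (q 0).
Implicit Types (f q : 'rV[R]_n -> R) (x : 'rV[R]_n).

Lemma rescale_node (h : R) x j : h != 0 ->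
  h^-1 *: (x - h *: lattice_pt j) = h^-1 *: x - lattice_pt j.
Proof. by move=> h0; rewrite scalerBr scalerA mulVf// scale1r. Qed.

Lemma node_rescale (h : R) x (j : 'rV[int]_n) : h != 0 ->
  h *: lattice_pt j = - h *: (h^-1 *: x - lattice_pt j) + x.
Proof. by move=> h0; rewrite scaleNr scalerBr scalerA mulfV// scale1r opprB subrK. Qed.

Lemma quasi_interp_poly (h : R) q x : 0 < h -> poly_lt M q ->
  (exists C, sums_le (quasi_interp_term Psi h q x) C) /\
  has_sum (quasi_interp_term Psi h q x) (q x).
Proof.
move=> h0 hq; have hn0 := lt0r_neq0 h0.
pose q' y := q (- h *: y + x).
have hq' : poly_lt M q' by exact: poly_lt_scale_shift.
have [qd hs] := Psi_moment hq' (h^-1 *: x).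
have e : quasi_interp_term Psi h q x =
    fun j => q' (h^-1 *: x - lattice_pt j) * Psi (h^-1 *: x - lattice_pt j).
  by apply/funext => j; rewrite /quasi_interp_term /q' -node_rescale// rescale_node.
have [C _ hC] := periodic_sums_le qd.
rewrite e; split; first by exists C; exact: hC.
by move: hs; rewrite /q' scaler0 add0r.
Qed.

Lemma quasi_interp_bounded (h B : R) f x : 0 < h -> 0 <= B -> (forall y, `|f y| <= B) ->
  exists C, sums_le (quasi_interp_term Psi h f x) C.
Proof.
move=> h0 B0 fB; have [C C0 hC] := Psi_dec.
exists (8 ^+ n * ((B * C) * 2)).
apply: (@sums_le_pow _ _ (h^-1 *: x)); first exact: mulr_ge0.
move=> j; rewrite /quasi_interp_term rescale_node ?lt0r_neq0// normrM -mulrA.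
apply: ler_pM => //; apply: le_trans (hC _) _; rewrite ler_wpM2l//.
rewrite lef_pV2 ?posrE ?exprn_gt0 ?ltr_pwDl//.
by rewrite ler_weXn2l ?lerDl// PE; lia.
Qed.

(** Since the Taylor polynomial of f at x is reproduced, the error is the sum over j of
    the Taylor remainder at h j times Psi(z), where z = x/h - j. *)
Lemma quasi_interp_error f : Cn M f -> bounded_derivatives M f ->
  exists2 C : R, 0 <= C & forall (h : R) x, 0 < h -> h < 1 ->
    `|quasi_interp Psi h f x - f x| <=
      C * h ^+ M * (if m0 == 0%N then 4 + ln (1 / h) / ln 2 else 1).
Proof.
move=> hf fb; have [C1 C10 hC1] := taylor_approx hf fb.
have [C2 C20 hC2] := Psi_dec.
have [B B0 fB] := bounded_fun_le (fb [::] (leq0n M)).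
have l2 : 0 < ln (2 : R) by rewrite ln_gt0// ltr1n.
exists (8 ^+ n * (C1 * C2 * 2 ^+ M)).
  by rewrite !mulr_ge0// exprn_ge0.
move=> h x h0 h1; have hn0 := lt0r_neq0 h0.
have hM0 : 0 < h ^+ M by rewrite exprn_gt0.
have [p hp hpy] := hC1 x.
have p0 : p 0 = f x.
  have [h2 _] := hpy 0; move: h2.
  rewrite normr0 expr0n gtn_eqF// mulr0 normr_le0 addr0 subr_eq0 => /eqP ->//.
pose q y := p (y - x).
have hq : poly_lt M q by exact: poly_lt_shift.
have [_ hs1] := quasi_interp_poly x h0 hq.
have qx : q x = f x by rewrite /q subrr.
have [C hC] := quasi_interp_bounded x h0 B0 fB.
have [_ hs2] := lattice_sumP hC.
have := has_sumD hs2 (has_sumZ (-1) hs1); rewrite qx mulN1r.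
rewrite -/(quasi_interp Psi h f x) => hs.
pose z j : 'rV[R]_n := h^-1 *: x - lattice_pt j.
pose w j := quasi_interp_term Psi h f x j + -1 * quasi_interp_term Psi h q x j.
have wE j : w j = (f (x + - h *: z j) - p (- h *: z j)) * Psi (z j).
  rewrite /w /quasi_interp_term rescale_node// -/(z j) (node_rescale x)// -/(z j) /q addrK.
  by rewrite [_ + x]addrC; ring.
have nz j : `|- h *: z j| = h * `|z j| by rewrite normrZ normrN gtr0_norm.
have w1 j : `|w j| <= C1 * C2 * h ^+ M * (1 + `|z j|) ^+ M * (1 + `|z j|) ^- P.
  rewrite wE normrM; have [k1 _] := hpy (- h *: z j).
  apply: le_trans (ler_pM _ _ k1 (hC2 (z j))) _ => //.
  rewrite nz exprMn [leRHS](_ : _ = C1 * (h ^+ M * (1 + `|z j|) ^+ M) * (C2 * (1 + `|z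
    j|) ^- P)); last by ring.
  rewrite ler_wpM2r//; first by rewrite mulr_ge0// invr_ge0 exprn_ge0// addr_ge0.
  by rewrite ler_wpM2l// ler_wpM2l ?(ltW hM0)// lerXn2r ?nnegrE ?addr_ge0// lerDr.
have zp j : 0 < 1 + `|z j| by rewrite ltr_pwDl.
have cancelM j k : P = (M + k)%N -> (1 + `|z j|) ^+ M * (1 + `|z j|) ^- P = (1 + `|z j|)
  ^- k.
  by move=> ->; rewrite exprD invfM mulrA mulfV ?mul1r// expf_neq0// lt0r_neq0.
have D0 : 0 <= C1 * C2 * 2 ^+ M * h ^+ M by rewrite !mulr_ge0// ?exprn_ge0// ltW.
have two1 : 1 <= (2 : R) ^+ M by rewrite exprn_ege1// ler1n.
apply: (has_sum_norm_le hs).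
case: eqP => [m00|/eqP m00]; last first.
  have hw : sums_le w (8 ^+ n * (C1 * C2 * h ^+ M * 2)).
    apply: (@sums_le_pow _ _ (h^-1 *: x)).
      by rewrite !mulr_ge0// ltW.
    move=> j; apply: le_trans (w1 j) _; rewrite -mulrA (@cancelM j (n + 2 * m0)%N);
      last by rewrite PE addnA.
    rewrite ler_wpM2l//; first by rewrite !mulr_ge0// ltW.
    rewrite lef_pV2 ?posrE ?exprn_gt0 ?zp//.
    by rewrite ler_weXn2l ?lerDl//; lia.
  move=> A; apply: le_trans (hw A) _; rewrite mulr1 -!mulrA ler_wpM2l ?exprn_ge0//.
  rewrite !mulrA [leRHS]mulrAC ler_wpM2l//; first by rewrite !mulr_ge0// ltW.
  by case: (M) M_gt0 => // M' _; rewrite exprS ler_peMr// exprn_ege1// ler1n.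
have hr : 1 <= 2 / h by rewrite ler_pdivlMr// mul1r; lra.
have hw : sums_le w (8 ^+ n * (C1 * C2 * 2 ^+ M * h ^+ M * (3 + ln (2 / h) / ln 2))).
  apply: (@sums_le_log _ _ (h^-1 *: x)) => // j; rewrite -/(z j).
  have PM : P = (M + n)%N by rewrite PE m00 muln0 addn0.
  case: (leP 1 (2 / h / (1 + `|z j|))) => hz.
    rewrite mulr1; apply: le_trans (w1 j) _; rewrite -mulrA (cancelM j n PM).
    rewrite ler_wpM2r ?invr_ge0 ?exprn_ge0 ?(ltW (zp j))//.
    by rewrite [leRHS]mulrAC ler_peMr// !mulr_ge0// ltW.
  (* Here h |z| > 1, and the bound of order M - 1 gains the factor 1 / (h (1 + |z|)). *)
  have hz2 : 2 < h * (1 + `|z j|).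
    by move: hz; rewrite ltr_pdivrMr// mul1r ltr_pdivrMr// mulrC.
  rewrite wE normrM; have [_ k2] := hpy (- h *: z j).
  apply: le_trans (ler_pM _ _ k2 (hC2 (z j))) _ => //.
  have k3 : (1 + `|- h *: z j|) ^+ M.-1 <= (2 * (h * (1 + `|z j|))) ^+ M.-1.
    rewrite nz lerXn2r ?nnegrE//.
    - by rewrite addr_ge0// mulr_ge0// ltW.
    - by rewrite !mulr_ge0// ltW.
    - by move: hz2; rewrite mulrDr mulr1; lra.
  apply: (@le_trans _ _ (C1 * (2 * (h * (1 + `|z j|))) ^+ M.-1 * (C2 * (1 + `|z j|) ^- P))).
    rewrite ler_wpM2r//; first by rewrite mulr_ge0// invr_ge0 exprn_ge0// ltW.
    by rewrite ler_wpM2l.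
  rewrite PM; move: (zp j); move: (1 + `|z j|) => Z Z0.
  set L := (X in X <= _).
  have L0 : 0 <= L.
    by rewrite /L !mulr_ge0// ?exprn_ge0 ?mulr_ge0 ?invr_ge0 ?exprn_ge0// ltW.
  rewrite [leRHS](_ : _ = 4 * L); first by rewrite ler_peMl// ler1n.
  rewrite /L -[in RHS](prednK M_gt0) -[in LHS](prednK M_gt0) /=.
  rewrite !exprMn !exprD !exprS.
  by field; rewrite ?expf_neq0 ?lt0r_neq0.
move=> A; apply: le_trans (hw A) _.
rewrite -!mulrA !ler_wpM2l ?exprn_ge0 ?(ltW h0)//.
rewrite lnM ?posrE ?invr_gt0// mulrDl mulfV ?lt0r_neq0// mul1r.
by move: (_ / ln 2) => v; lra.
Qed.

End ConvergenceRate.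

Theorem theorem6 (R : realType) (n d m0 : nat) (c : R)
    (n_ge2 : (2 <= n)%N) (n_even : ~~ odd n) (d_gt0 : (0 < d)%N)
    (c_gt0 : 0 < c)
    (m0_dvd : (d %| n %/ 2 + m0)%N)
    (m0_min : forall m : nat, (d %| n %/ 2 + m)%N -> (m0 <= m)%N) :
  exists mu : 'rV[int]_n -> R,
    let phi : 'rV[R]_n -> R := rbf d c in
    let Psi : 'rV[R]_n -> R := quasi_lagrange mu phi in
    let rate (h : R) : R :=
      if m0 == 0%N then h ^+ (n + 2 * d) * ln (1 / h)
      else h ^+ (n + 2 * d) in
    [/\ forall x, lattice_summable (quasi_lagrange_term mu phi x),
        exists C : R, forall x,
          `|Psi x| <= C * (1 + enorm x) ^- (2 * n + 2 * d + 2 * m0),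
        forall (h : R) (p : mpoly.mpoly n R),
          0 < h -> h < 1 -> tdeg_le (n + 2 * d - 1) p ->
          forall x,
            lattice_summable (quasi_interp_term Psi h (peval p) x) /\
            quasi_interp Psi h (peval p) x = peval p x
      & forall f : 'rV[R]_n -> R,
          Cn (n + 2 * d) f -> bounded_derivatives (n + 2 * d) f ->
          (forall (h : R) x, 0 < h -> h < 1 ->
             lattice_summable (quasi_interp_term Psi h f x)) /\
          exists C : R, \forall h \near 0^'+,
            (supnorm (fun x => quasi_interp Psi h f x - f x)%R
             <= (C * rate h)%:E)%E].
Proof.
pose n2 := (n %/ 2)%N; pose M := (n + 2 * d)%N.
have n_eq : n = (2 * n2)%N by rewrite /n2 divn2 mul2n even_halfK.
have n2_gt0 : (0 < n2)%N by lia.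
have [q0 e1 e2] : exists2 q0, (d * q0.+1 = n2 + m0)%N & (d * q0 < n2)%N.
  have /dvdnP[[|q0] e] := m0_dvd; first by rewrite -/n2 in e; lia.
  (* If d q0 >= n/2, then m0 would not be minimal: d q0 - n/2 is smaller. *)
  exists q0; first by rewrite mulnC -e.
  rewrite ltnNge; apply/negP => le.
  have := m0_min (d * q0 - n2)%N; rewrite -/n2 subnKC// dvdn_mulr// => /(_ isT).
  by rewrite -/n2 in e; lia.
have C_gt0 : 0 < c ^+ (2 * d) by rewrite exprn_gt0.
have [s []] := reproducing_kernel n_eq n2_gt0 d_gt0 C_gt0 e1 e2.
rewrite -rbf_radial => Psi_dec Psi_moment.
exists (stencil_weight s) => phi Psi rate.
have PsiE : Psi = stencil s phi.
  by apply/funext => x; have [_] := quasi_lagrange_stencil s phi x.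
rewrite -/phi -PsiE in Psi_dec Psi_moment.
have M_gt0 : (0 < M)%N by rewrite /M; lia.
have PE : (2 * n + 2 * d + 2 * m0)%N = (M + n + 2 * m0)%N by rewrite /M; lia.
split.
- by move=> x; have [] := quasi_lagrange_stencil s phi x.
- have [C C0 hC] := Psi_dec.
  exists (C * (1 + n%:R) ^+ (2 * n + 2 * d + 2 * m0)) => x.
  apply: le_trans (hC x) _; rewrite -mulrA ler_wpM2l//.
  have e0 : 0 < 1 + enorm x by rewrite ltr_pwDl// sqrtr_ge0.
  have x0 : 0 < 1 + `|x| by rewrite ltr_pwDl.
  rewrite ler_pdivlMr ?exprn_gt0// ler_pdivrMl ?exprn_gt0// -exprMn.
  rewrite lerXn2r ?nnegrE ?(ltW e0) ?mulr_ge0 ?(ltW x0) ?addr_ge0//.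
  have := enorm_le_normr x; have := normr_ge0 x; have := ler0n R n.
  move: (enorm x) `|x| (n%:R : R) => a b k k0 b0 ab.
  by have := mulr_ge0 k0 b0; nra.
- move=> h p h0 _ hp x.
  have hq : poly_lt M (peval p : 'rV[R]_n -> R).
    by have := mpoly_poly_lt hp; rewrite subn1 prednK.
  have [[C hC] hs] := quasi_interp_poly Psi_moment x h0 hq.
  by split; [have [] := lattice_sumP hC|exact: has_sum_lattice_sum hC hs].
- move=> f hf fb; split.
    move=> h x h0 _; have [B B0 fB] := bounded_fun_le (fb [::] (leq0n M)).
    have [C hC] := quasi_interp_bounded M_gt0 PE Psi_dec x h0 B0 fB.
    by have [] := lattice_sumP hC.
  have [C C0 hC] := quasi_interp_error M_gt0 PE Psi_dec Psi_moment hf fb.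
  have l2 : 0 < ln (2 : R) by rewrite ln_gt0// ltr1n.
  exists (C * (4 + (ln 2)^-1)); near=> h.
  have h0 : 0 < h by near: h; exact: nbhs_right_gt.
  have h1 : h < expR (-1) by near: h; apply: nbhs_right_lt; exact: expR_gt0.
  have h2 : h < 1 by apply: lt_trans h1 _; rewrite expR_lt1; lra.
  have hM : 0 < h ^+ M by rewrite exprn_gt0.
  (* For h < 1/e the constant in 4 + ln (1/h) / ln 2 is absorbed by ln (1/h) >= 1. *)
  have lh : 1 <= ln (1 / h).
    rewrite div1r lnV ?posrE//.
    have : ln h <= -1 by rewrite -[leRHS](@expRK R) ler_ln ?posrE ?expR_gt0// ltW.
    lra.
  apply: ge_ereal_sup => _ [x _ <-]; rewrite lee_fin.
  apply: le_trans (hC h x h0 h2) _; rewrite /rate -/M.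
  have i2 : 0 < (ln 2)^-1 :> R by rewrite invr_gt0.
  case: eqP => _; rewrite -!mulrA ler_wpM2l// mulrC.
    rewrite [leRHS]mulrCA [leLHS]mulrC ler_pM2l//.
    move: (ln (1 / h)) (ln 2)^-1 lh i2 => a b a1 b0; nra.
  by rewrite mul1r ler_peMl//; [exact: ltW|lra].
Unshelve. all: by end_near.
Qed.
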